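(* Let $k$ be an algebraically closed field of characteristic $5$, let $\Gamma\subset\mathbb{P}^2$ be a $k$-Hermitian curve, and let $\mathcal{D}$ be the set of connected components of the graph $G$ on the set $\mathcal{Q}$ of non-singular conics totally tangent to $\Gamma$. Let $\mathcal{C}_1,\mathcal{C}_2,\mathcal{C}_3$ be the vertex sets of the three connected components of the graph $H$ on $\mathcal{D}$. Let $H'$ be the graph whose set of vertices is $\mathcal{D}$, and whose set of edges is the set of pairs $\{D,D'\}$ such that $D\neq D'$ and $T(D,D')$ is either $\beta^{21}$ or $\alpha^{15}\gamma^{6}$. Then $H'$ is a connected regular graph of valency $37$. For any $i$ and $j$ with $i\neq j$, the restriction $H'|(\mathcal{C}_i\cup\mathcal{C}_j)$ of $H'$ to $\mathcal{C}_i\cup\mathcal{C}_j$ (induced subgraph) is (isomorphic to) the Higman-Sims graph.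
   Context: Work over an algebraically closed field $k$ of characteristic $5$. A $k$-Hermitian curve is a projective plane curve $\Gamma\subset\mathbb{P}^2$ of degree $6$ that is projectively isomorphic (via $\mathrm{PGL}_3(k)$) to the Fermat curve $\Gamma_5: x^6+y^6+z^6=0$. $\mathcal{P}$ denotes the set of Weierstrass points of $\Gamma$; equivalently, the set of points $P\in\Gamma$ whose tangent line meets $\Gamma$ at $P$ with intersection multiplicity $6$ (for $\Gamma=\Gamma_5$, the $\mathbb{F}_{25}$-rational points). One has $|\mathcal{P}|=126$. A line of $\mathbb{P}^2$ is a special secant line of $\Gamma$ if it passes through two distinct points of $\mathcal{P}$. A non-singular conic $Q\subset\mathbb{P}^2$ is totally tangent to $\Gamma$ if $Q$ meets $\Gamma$ at six distinct points, each with intersection multiplicity $2$. $\mathcal{Q}$ denotes the set of all such conics; one has $|\mathcal{Q}|=3150$ and $Q\cap\Gamma\subset\mathcal{P}$ for $Q\in\mathcal{Q}$. For $Q\in\mathcal{Q}$, $\mathcal{S}(Q)$ is the set of the $15$ special secant lines of $\Gamma$ passing through two distinct points of $Q\cap\Gamma$. $G$ is the graph with vertex set $\mathcal{Q}$ in which distinct $Q,Q'$ are adjacent if and only if $|Q\cap Q'|=4$ and $|\mathcal{S}(Q)\cap\mathcal{S}(Q')|=3$. $\mathcal{D}$ is the set of connected components of $G$ (there are $150$ of them); each $D\in\mathcal{D}$ is regarded as a subset of $\mathcal{Q}$, consisting of $21$ conics. For $Q\in\mathcal{Q}$ and $D'\in\mathcal{D}$ with $Q\notin D'$, the type $t(Q,D')\in\{\alpha,\beta,\gamma\}$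 is defined by the values of $|Q\cap Q'\cap\Gamma|$ as $Q'$ runs over the $21$ conics of $D'$: $t(Q,D')=\alpha$ if the value is $2$ for $3$ conics and $0$ for $18$; $t(Q,D')=\beta$ if it is $2$ for $1$ conic, $1$ for $4$ conics and $0$ for $16$; $t(Q,D')=\gamma$ if it is $1$ for $6$ conics and $0$ for $15$. (One of these three cases always occurs.) For distinct $D,D'\in\mathcal{D}$, the type $T(D,D')$ is: $\beta^{21}$ if $t(Q,D')=\beta$ for all $Q\in D$; $\gamma^{21}$ if $t(Q,D')=\gamma$ for all $Q\in D$; $\alpha^{15}\gamma^{6}$ if $t(Q,D')=\alpha$ for $15$ conics $Q\in D$ and $\gamma$ for the other $6$; $\alpha^{3}\gamma^{18}$ if $t(Q,D')=\alpha$ for $3$ conics $Q\in D$ and $\gamma$ for the other $18$. (One of these four cases always occurs, and $T(D,D')=T(D',D)$.) $H$ is the graph with vertex set $\mathcal{D}$ in which distinct $D,D'$ are adjacent if and only if $T(D,D')=\alpha^{15}\gamma^{6}$. It has exactly three connected components, with vertex sets $\mathcal{C}_1,\mathcal{C}_2,\mathcal{C}_3$ of size $50$ each. The Higman-Sims graph is the unique strongly regular graph of parameters $(v,k,\lambda,\mu)=(100,22,0,6)$. *)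

(* Defs.v *)
From Stdlib Require Import Relation_Operators.
From mathcomp Require Import all_boot all_order all_algebra.
From mathcomp Require Import fraction mpoly.
From mathcomp Require Import all_classical.

Set Implicit Arguments.
Unset Strict Implicit.
Unset Printing Implicit Defensive.

Import GRing.Theory.

Local Open Scope classical_set_scope.
Local Open Scope card_scope.
Local Open Scope ring_scope.

(* A graph is a vertex set [V] with an adjacency relation [e] of which only the
   restriction to [V] matters. *)

Section Graphs.
Variable T : Type.
Implicit Types (V : set T) (e : T -> T -> Prop).

Definition simple_graph V e :=
  (forall x, V x -> ~ e x x) /\ (forall x y, V x -> V y -> e x y -> e y x).

Definition neighbours V e (x : T) : set T := [set y | V y /\ e x y].

Definition joined V e : T -> T -> Prop :=
  clos_refl_sym_trans T (fun x y => [/\ V x, V y & e x y]).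

Definition component V e (x : T) : set T := [set y | joined V e x y].

Definition components V e : set (set T) :=
  [set D | exists2 x, V x & D = component V e x].

Definition connected_graph V e :=
  V !=set0 /\ (forall x y, V x -> V y -> joined V e x y).

Definition regular_graph V e (d : nat) :=
  simple_graph V e /\ (forall x, V x -> neighbours V e x #= `I_d).

Definition strongly_regular V e (v d l m : nat) :=
  [/\ V #= `I_v,
      regular_graph V e d,
      forall x y, V x -> V y -> e x y ->
        (neighbours V e x `&` neighbours V e y) #= `I_l
    & forall x y, V x -> V y -> x <> y -> ~ e x y ->
        (neighbours V e x `&` neighbours V e y) #= `I_m].

(* The Higman-Sims graph is the unique strongly regular graph with these
   parameters. *)
Definition is_Higman_Sims V e := strongly_regular V e 100 22 0 6.

End Graphs.

Section Plane.
Variable k : closedFieldType.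

Local Notation form := {mpoly k[3]}.
Local Notation ratfun := {fraction {mpoly k[3]}}.
Local Notation frac := (@FracField.tofrac {mpoly k[3]}).

(* Points and lines of the projective plane are the linear subspaces of k^3
   of dimension 1 and 2. *)
Definition ppoint := {U : {vspace 'rV[k]_3} | \dim U == 1%N}.
Definition pline := {U : {vspace 'rV[k]_3} | \dim U == 2%N}.

Definition on_line (P : ppoint) (L : pline) : Prop := (val P <= val L)%VS.

Definition vanishes_at (f : form) (P : ppoint) : Prop :=
  forall v : 'rV[k]_3, v \in val P -> f.@[v 0] = 0.

Definition zeros (f : form) : set ppoint := [set P | vanishes_at f P].

(* The local ring O_P of the plane at P, inside the field of fractions of
   k[X_0, X_1, X_2]. *)
Definition local_ring (P : ppoint) : set ratfun :=
  [set phi | exists (d : nat) (a b : form),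
     [/\ a \is d.-homog, b \is d.-homog, ~ vanishes_at b P
       & phi = frac a / frac b]].

(* The ideal of O_P generated by local equations of the curves f = 0, g = 0. *)
Definition local_ideal (P : ppoint) (f g : form) : set ratfun :=
  [set phi | exists (d : nat) (a a' b : form),
     [/\ f * a \is d.-homog, g * a' \is d.-homog, b \is d.-homog,
         ~ vanishes_at b P & phi = frac (f * a + g * a') / frac b]].

(* dim_k O_P / (f, g) = m: there is a family of m elements of O_P that is a
   k-basis modulo the ideal (f, g). *)
Definition intersection_multiplicity (P : ppoint) (f g : form) (m : nat) :=
  exists e : 'I_m -> ratfun,
    (forall i, local_ring P (e i)) /\
    (forall phi, local_ring P phi ->
       exists! c : 'rV[k]_m,
         local_ideal P f g (phi - \sum_i frac (c 0 i)%:MP * e i)).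

Definition fermat_sextic : form := \sum_(i < 3) 'X_i ^+ 6.

Definition linear_subst (A : 'M[k]_3) (f : form) : form :=
  f \mPo [tuple \sum_(j < 3) A i j *: 'X_j | i < 3].

Definition hermitian_sextic (F : form) :=
  exists (A : 'M[k]_3) (c : k),
    [/\ A \in unitmx, c != 0 & F = c *: linear_subst A fermat_sextic].

(* Equation of the tangent line of F = 0 at the point spanned by v. *)
Definition tangent_form (F : form) (v : 'rV[k]_3) : form :=
  \sum_(i < 3) (mderiv i F).@[v 0] *: 'X_i.

Definition nonsingular_form (f : form) :=
  forall v : 'rV[k]_3, v != 0 -> f.@[v 0] = 0 ->
    exists i : 'I_3, (mderiv i f).@[v 0] != 0.

Definition weierstrass_points (F : form) : set ppoint :=
  [set P | zeros F P /\
     exists v : 'rV[k]_3, [/\ v \in val P, v != 0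
       & intersection_multiplicity P (tangent_form F v) F 6]].

Definition special_secants (F : form) : set pline :=
  [set L | exists P P' : ppoint,
     [/\ weierstrass_points F P, weierstrass_points F P', P <> P',
         on_line P L & on_line P' L]].

(* A conic is identified with its set of points; for non-singular conics over
   an algebraically closed field this determines the equation up to a nonzero
   scalar. *)
Definition tt_conics (F : form) : set (set ppoint) :=
  [set Q | exists q : form,
     [/\ q \is 2.-homog, nonsingular_form q, Q = zeros q,
         (Q `&` zeros F) #= `I_6
       & forall P, (Q `&` zeros F) P -> intersection_multiplicity P q F 2]].

Definition secants_of (F : form) (Q : set ppoint) : set pline :=
  [set L | special_secants F L /\
     exists P P' : ppoint,
       [/\ (Q `&` zeros F) P, (Q `&` zeros F) P', P <> P',
           on_line P L & on_line P' L]].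

Definition adjG (F : form) (Q Q' : set ppoint) :=
  [/\ Q <> Q', (Q `&` Q') #= `I_4
    & (secants_of F Q `&` secants_of F Q') #= `I_3].

Definition calD (F : form) : set (set (set ppoint)) :=
  components (tt_conics F) (adjG F).

Definition conics_meeting (F : form) (Q : set ppoint) (D' : set (set ppoint))
    (n : nat) : set (set ppoint) :=
  [set Q' | D' Q' /\ (Q `&` Q' `&` zeros F) #= `I_n].

Inductive ttype := alpha | beta | gamma.

(* [has_t F Q D' t] says that t(Q, D') = t; it is used only for Q not in D'. *)
Definition has_t (F : form) (Q : set ppoint) (D' : set (set ppoint))
    (t : ttype) : Prop :=
  let N := conics_meeting F Q D' in
  match t with
  | alpha => [/\ D' = N 2%N `|` N 0%N, N 2%N #= `I_3 & N 0%N #= `I_18]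
  | beta => [/\ D' = N 2%N `|` N 1%N `|` N 0%N,
                N 2%N #= `I_1, N 1%N #= `I_4 & N 0%N #= `I_16]
  | gamma => [/\ D' = N 1%N `|` N 0%N, N 1%N #= `I_6 & N 0%N #= `I_15]
  end.

Inductive TType := beta21 | gamma21 | alpha15gamma6 | alpha3gamma18.

(* [has_T F D D' t] says that T(D, D') = t; it is used only for D <> D'. *)
Definition has_T (F : form) (D D' : set (set ppoint)) (t : TType) : Prop :=
  let N s := [set Q | D Q /\ has_t F Q D' s] in
  match t with
  | beta21 => D = N beta
  | gamma21 => D = N gamma
  | alpha15gamma6 =>
      [/\ D = N alpha `|` N gamma, N alpha #= `I_15 & N gamma #= `I_6]
  | alpha3gamma18 =>
      [/\ D = N alpha `|` N gamma, N alpha #= `I_3 & N gamma #= `I_18]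
  end.

Definition adjH (F : form) (D D' : set (set ppoint)) :=
  D <> D' /\ has_T F D D' alpha15gamma6.

Definition adjH' (F : form) (D D' : set (set ppoint)) :=
  D <> D' /\ (has_T F D D' beta21 \/ has_T F D D' alpha15gamma6).

End Plane.

(* Main.v *)
From Stdlib Require Import Relation_Operators.
Require Import Defs.
From HB Require Import structures.
From mathcomp Require Import all_boot all_order all_algebra.
From mathcomp Require Import fraction mpoly.
From mathcomp Require Import all_classical.
From mathcomp Require Import ring zify.

(* By pulling the sextic back to the parameter (s : t) of a conic, one sees that it
   is totally tangent to the curve of a Hermitian form exactly when, in suitable
   coordinates, the form is J : x z ^ 5 - 2 y ^ 6 + z x ^ 5 and the conic is the standard
   one, on which J restricts to (s ^ 5 t - s t ^ 5) ^ 2.  So once one conic W is fixed,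
   the totally tangent conics are the images W N of the standard conic under the
   similitudes N of J, whose matrices may be taken over F_25, and any one of them may
   play the role of W.  Hence the neighbours of a single conic in G determine all of G.
   A common special secant supplies two points of the neighbour, and a conic with two
   prescribed points is one of the six images of the standard conic under a torus, so the
   neighbours are found by running over the pairs of isotropic points of F_25 ^ 3:
   the number of common points is read off a binary quartic.  A component of G consists
   of 21 conics whose contact hexads partition the 126 isotropic points, so the 150
   conics through one point represent the components, and the types T(D, D') and the
   assertions on H and H' become computations over F_25. *)

Set Implicit Arguments.
Unset Strict Implicit.
Unset Printing Implicit Defensive.

Import GRing.Theory.

Local Open Scope classical_set_scope.
Local Open Scope card_scope.
Local Open Scope ring_scope.

(** * Intersection multiplicities *)

(** The definitions make multiplicities dimensions of local rings, while the argument needs orders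
    of vanishing along a rational parametrization. The bridge is a pair of linear forms [Y0], [Y1]
    with [Y1 / Y0] the parameter: modulo the equation of the curve every form is, up to a power of
    [Y0], a form in [Y0] and [Y1]. It serves conics and tangent lines alike. Since [x -> x ^ 5] is
    additive, a Hermitian form with matrix [T] pulls back to a conic as the sum of the
    [T a b t ^ (a + 5 b)] with [a, b <= 2]. No exponent occurs twice, so [T] can be read off the
    pullback; and [t ^ 3], [t ^ 4], [t ^ 8], [t ^ 9] are absent, which among squares of monic
    quintics vanishing at 0 and 1 leaves only [(t ^ 5 - t) ^ 2]. This is why the six contact points
    form a copy of P^1(F_5). At the end the obstacle is size: all pairs among 150 components of 21
    conics have to be compared. Labelling the 126 points by the conics of one component reduces each
    type to the repetitions among six labels. *)

Section Congruence.
Variable R : comNzRingType.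

Definition eqmod (q a b : R) := exists u, a - b = q * u.

Lemma eqmod_refl q a : eqmod q a a.
Proof. by exists 0; rewrite subrr mulr0. Qed.

Lemma eqmod_sym q a b : eqmod q a b -> eqmod q b a.
Proof. by case=> u e; exists (- u); rewrite mulrN -e opprB. Qed.

Lemma eqmod_trans q a b c : eqmod q a b -> eqmod q b c -> eqmod q a c.
Proof.
by move=> [u e] [v e']; exists (u + v); rewrite mulrDr -e -e' addrA subrK.
Qed.

Lemma eqmodD q a b c d : eqmod q a b -> eqmod q c d -> eqmod q (a + c) (b + d).
Proof.
by move=> [u e] [v e']; exists (u + v); rewrite mulrDr -e -e' opprD addrACA.
Qed.

Lemma eqmodM q a b c d : eqmod q a b -> eqmod q c d -> eqmod q (a * c) (b * d).
Proof.
move=> [u e] [v e']; exists (u * c + b * v).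
by rewrite mulrDr mulrA -e mulrCA -e' mulrBl mulrBr addrA subrK.
Qed.

Lemma eqmod_sum q (I : Type) (r : seq I) (P : pred I) (E E' : I -> R) :
  (forall i, P i -> eqmod q (E i) (E' i)) ->
  eqmod q (\sum_(i <- r | P i) E i) (\sum_(i <- r | P i) E' i).
Proof.
move=> h; elim/big_rec2: _ => [|i x y Pi]; first exact: eqmod_refl.
exact/eqmodD/h.
Qed.

End Congruence.

Section Homogenize.
Variables (k : fieldType) (n : nat).
Local Notation form := {mpoly k[n]}.
Variables Y0 Y1 : form.

(** Coefficients of [p] beyond degree [N] are dropped, so this undoes dehomogenization only when
    [size p <= N.+1]; hence the size bounds below. *)
Definition homogenize (N : nat) (p : {poly k}) : form :=
  \sum_(i < N.+1) p`_i *: (Y0 ^+ (N - i) * Y1 ^+ i).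

Lemma homogenizeD N p r : homogenize N (p + r) = homogenize N p + homogenize N r.
Proof. by rewrite -big_split; apply: eq_bigr => i _; rewrite coefD scalerDl. Qed.

Lemma homogenizeZ N c p : homogenize N (c *: p) = c *: homogenize N p.
Proof. by rewrite scaler_sumr; apply: eq_bigr => i _; rewrite coefZ scalerA. Qed.

Lemma homogenize_sum N (I : Type) (r : seq I) (P : pred I) (E : I -> {poly k}) :
  homogenize N (\sum_(i <- r | P i) E i) = \sum_(i <- r | P i) homogenize N (E i).
Proof.
apply: (big_morph _ (homogenizeD N)).
by rewrite /homogenize big1 // => i _; rewrite coef0 scale0r.
Qed.

Lemma homogenizeXn N i : (i <= N)%N ->
  homogenize N 'X^i = Y0 ^+ (N - i) * Y1 ^+ i.
Proof.
move=> iN; rewrite /homogenize (bigD1 (Ordinal (iN : i < N.+1)%N)) //=.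
rewrite coefXn eqxx scale1r big1 ?addr0 // => j ji.
rewrite coefXn; case: eqP => [e|]; last by rewrite scale0r.
by case/eqP: ji; apply: val_inj.
Qed.

Lemma homogenize_mulXn N l (p : {poly k}) i : (size p <= N.+1)%N -> (i <= l)%N ->
  homogenize (N + l) (p * 'X^i) = homogenize N p * (Y0 ^+ (l - i) * Y1 ^+ i).
Proof.
move=> sp il; rewrite -{1}(coefK p) (poly_def (size p)).
rewrite (big_ord_widen _ (fun j => p`_j *: 'X^j) sp) mulr_suml homogenize_sum.
rewrite big_mkcond /= mulr_suml; apply: eq_bigr => j _.
case: ifP => [_|/negbT]; last first.
  by rewrite -leqNgt => /leq_sizeP->//; rewrite scale0r mul0r.
have jN : (j <= N)%N by rewrite -ltnS.
rewrite -scalerAl homogenizeZ -exprD homogenizeXn ?leq_add //.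
rewrite -scalerAl mulrACA -!exprD; congr (_ *: (_ ^+ _ * _)).
by rewrite subnDA -addnBAC // addnBA.
Qed.

Lemma homogenize_homog N p : Y0 \is 1.-homog -> Y1 \is 1.-homog ->
  homogenize N p \is N.-homog.
Proof.
move=> h0 h1; apply: rpred_sum => i _; apply: dhomogZ.
have := dhomogM (dhomogMn (N - i) h0) (dhomogMn i h1).
by rewrite !mul1n subnK // -ltnS.
Qed.

End Homogenize.

Section Multiplicity.
Variable k : closedFieldType.
Local Notation form := {mpoly k[3]}.
Local Notation frac := (@FracField.tofrac {mpoly k[3]}).

Definition pullback (phi : 'I_3 -> {poly k}) (a : form) : {poly k} :=
  mmap (@polyC k) phi a.

HB.instance Definition _ phi := GRing.RMorphism.copy (pullback phi)
  (mmap (@polyC k) phi).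

Lemma pullbackX phi j : pullback phi 'X_j = phi j.
Proof. by rewrite /pullback mmapX mmap1U. Qed.

Lemma pullbackZ phi c a : pullback phi (c *: a) = c *: pullback phi a.
Proof. by rewrite /pullback mmapZ mul_polyC. Qed.

Lemma horner_pullback phi a t :
  (pullback phi a).[t] = a.@[fun j => (phi j).[t]].
Proof.
rewrite /pullback /mmap horner_sum mevalE; apply: eq_bigr => m _.
rewrite hornerCM /mmap1 horner_prod; congr (_ * _).
by apply: eq_bigr => j _; rewrite horner_exp.
Qed.

(** Column [i] of [M] holds the coefficients of [t ^ i]: two columns parametrize a line, three a
    conic, in the chart where the first homogeneous parameter is 1. *)
Definition curve_param (e : nat) (M : 'M[k]_(3, e.+1)) (j : 'I_3) : {poly k} :=
  \sum_(i < e.+1) M j i *: 'X^i.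

Lemma size_curve_param e (M : 'M[k]_(3, e.+1)) j :
  (size (curve_param M j) <= e.+1)%N.
Proof.
apply: leq_trans (size_sum _ _ _) _; apply/bigmax_leqP => i _.
by apply: leq_trans (size_scale_leq _ _) _; rewrite size_polyXn ltn_ord.
Qed.

(* [Y1 / Y0] is a local parameter along the curve q = 0 whose pullback to the
   line is the coordinate. *)
Record parametrization (q : form) (e : nat) (M : 'M[k]_(3, e.+1))
    (Y0 Y1 : form) : Prop := Parametrization {
  param_homog0 : Y0 \is 1.-homog;
  param_homog1 : Y1 \is 1.-homog;
  param_eq0 : pullback (curve_param M) q = 0;
  param_Y0 : pullback (curve_param M) Y0 = 1;
  param_Y1 : pullback (curve_param M) Y1 = 'X;
  param_gen : forall j, eqmod q (Y0 ^+ e.-1 * 'X_j)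
    (\sum_(i < e.+1) M j i *: (Y0 ^+ (e - i) * Y1 ^+ i)) }.

Section Param.
Variables (q : form) (e : nat) (M : 'M[k]_(3, e.+1)) (Y0 Y1 : form).
Hypotheses (param : parametrization q M Y0 Y1).

Local Notation pb := (pullback (curve_param M)).
Local Notation hom := (homogenize Y0 Y1).

(** Each factor ['X_j] absorbs [Y0 ^+ e.-1] and becomes, by [param_gen], a form of degree [e] in
    [Y0] and [Y1]; the product of these forms is the homogenization of the product of the
    pullbacks. *)
Lemma param_monomial d (m : 'X_{1..3}) : mdeg m = d ->
  (size (pb 'X_[m]) <= (d * e).+1)%N /\
  eqmod q (Y0 ^+ (d * e.-1) * 'X_[m]) (hom (d * e) (pb 'X_[m])).
Proof.
elim: d m => [m /eqP|d IH m dm].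
  rewrite mdeg_eq0 => /eqP ->; rewrite !mul0n mpolyX0 rmorph1 size_poly1; split=> //.
  by rewrite mulr1 -(expr0 'X) homogenizeXn // mulr1 subn0; apply: eqmod_refl.
have [i mi] : exists i, m i != 0%N.
  case: (pickP (fun i => m i != 0%N)) => [i|h]; first by exists i.
  suff : mdeg m == 0%N by rewrite dm.
  rewrite mdeg_eq0; apply/eqP/mnmP => i; rewrite mnm0E.
  by apply/eqP; move: (h i) => /negbT; rewrite negbK.
have em : m = (m - U_(i) + U_(i))%MM by rewrite submK // lep1mP.
have /IH [sz eqm] : mdeg (m - U_(i))%MM = d.
  by move: dm; rewrite {1}em mdegD mdeg1 addn1 => -[].
rewrite em mpolyXD rmorphM /=. rewrite pullbackX; split.
  apply: leq_trans (size_polyMleq _ _) _.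
  by have := leq_add sz (size_curve_param M i); rewrite mulSn; lia.
have := eqmodM eqm (param_gen param i); move: sz; move: (pb _) => P sz.
rewrite mulrACA -exprD -mulSnr => h; apply: eqmod_trans h _.
rewrite [curve_param M i]/curve_param !mulr_sumr homogenize_sum mulSnr.
apply: eqmod_sum => l _.
rewrite -mul_polyC mulrCA mul_polyC -[in X in eqmod _ X _]mul_mpolyC mulrCA mul_mpolyC.
have le : (l <= e)%N by rewrite -ltnS.
by rewrite homogenizeZ (homogenize_mulXn _ _ sz le); apply: eqmod_refl.
Qed.

(** Modulo [q] a form is thus determined by its pullback, up to a power of [Y0]; as [Y0] pulls back
    to 1, it is invertible at the point of parameter 0. *)
Lemma param_form d a : a \is d.-homog ->
  (size (pb a) <= (d * e).+1)%N /\
  eqmod q (Y0 ^+ (d * e.-1) * a) (hom (d * e) (pb a)).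
Proof.
move=> /dhomogP ha; rewrite [a]mpolyE big_seq rmorph_sum; split.
  apply: leq_trans (size_sum _ _ _) _; apply/bigmax_leqP_seq => m _ /ha dm.
  rewrite /= pullbackZ; apply: leq_trans (size_scale_leq _ _) _.
  by case: (param_monomial dm).
rewrite mulr_sumr homogenize_sum; apply: eqmod_sum => m /ha dm.
rewrite /= pullbackZ homogenizeZ -scalerAr -!mul_mpolyC.
by apply: eqmodM; [apply: eqmod_refl | case: (param_monomial dm)].
Qed.

End Param.
End Multiplicity.

Lemma rVpoly_sum (R : nzRingType) m (c : 'rV[R]_m) :
  rVpoly c = \sum_(i < m) c 0 i *: 'X^i.
Proof.
rewrite {1}[c]row_sum_delta linear_sum; apply: eq_bigr => i _.
by rewrite linearZ /= rVpoly_delta.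
Qed.

Lemma expand_fraction (K : fieldType) (a b y : K) : b != 0 -> y != 0 ->
  a / b = (y * a) / (b * y).
Proof. by move=> b0 y0; field; rewrite b0 y0. Qed.

Lemma expand_product (K : fieldType) (b c u w z : K) :
  b != 0 -> u != 0 -> w != 0 ->
  c * (z / w) = b * (c * (u * z)) / (b * (u * w)).
Proof. by move=> b0 u0 w0; field; rewrite b0 u0 w0. Qed.

Section Vanishing.
Variable k : closedFieldType.
Local Notation form := {mpoly k[3]}.

Lemma meval_homogZ d (f : form) (c : k) (v : 'I_3 -> k) : f \is d.-homog ->
  f.@[fun j => c * v j] = c ^+ d * f.@[v].
Proof.
move=> /dhomogP hf; rewrite !mevalE mulr_sumr big_seq [RHS]big_seq.
apply: eq_bigr => m /hf dm; rewrite mulrCA; congr (_ * _).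
under eq_bigr do rewrite exprMn.
by rewrite big_split /= prodrXr -mdegE dm.
Qed.

Lemma vanishes_at_line d (f : form) (P : ppoint k) (v : 'rV[k]_3) :
  f \is d.-homog -> val P = <[v]>%VS -> vanishes_at f P <-> f.@[v 0] = 0.
Proof.
move=> hf eP; split=> [h|h w]; first by apply: h; rewrite eP memv_line.
rewrite eP => /vlineP[c ->].
rewrite (@meval_eq _ _ _ (fun j => c * v 0 j)); last by move=> j; rewrite mxE.
by rewrite (meval_homogZ _ _ hf) h mulr0.
Qed.

End Vanishing.

Section LocalIntersection.
Variable k : closedFieldType.
Local Notation form := {mpoly k[3]}.
Local Notation frac := (@FracField.tofrac {mpoly k[3]}).
Variables (q : form) (e : nat) (M : 'M[k]_(3, e.+1)) (Y0 Y1 : form).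
Hypotheses (param : parametrization q M Y0 Y1) (e_gt0 : (0 < e)%N).

Local Notation pb := (pullback (curve_param M)).
Local Notation hom := (homogenize Y0 Y1).

Lemma pullback_homogenize N (p : {poly k}) : (size p <= N.+1)%N ->
  pb (hom N p) = p.
Proof.
move=> sp; rewrite /homogenize rmorph_sum -[RHS](coefK p) poly_def.
rewrite [RHS](big_ord_widen _ (fun j => p`_j *: 'X^j) sp) [RHS]big_mkcond.
apply: eq_bigr => i _; rewrite /= pullbackZ rmorphM !rmorphXn /=.
rewrite (param_Y0 param) (param_Y1 param) expr1n mul1r.
case: ifP => // /negbT; rewrite -leqNgt => /leq_sizeP h.
by rewrite h ?leqnn ?scale0r.
Qed.

(** Divisibility of the pullback by ['X^m] is lifted to divisibility by [Y1 ^+ m] in the plane,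
    modulo [q] and up to a power of [Y0]. *)
Lemma param_order D a m (r : {poly k}) :
  a \is D.-homog -> pb a = 'X^m * r -> (size r <= (D * e).+1)%N /\
  eqmod q (Y0 ^+ (m + D * e.-1) * a) (hom (D * e) r * Y1 ^+ m).
Proof.
move=> ha pa; have [sa ea] := param_form param ha.
have sr : (size r <= (D * e).+1)%N.
  apply: leq_trans sa; rewrite pa; have [->|r0] := eqVneq r 0.
    by rewrite size_poly0.
  by rewrite size_monicM ?monicXn // size_polyXn; lia.
split=> //; rewrite exprD -mulrA.
apply: eqmod_trans (eqmodM (eqmod_refl q (Y0 ^+ m)) ea) _.
have := homogenize_mulXn Y0 Y1 sa (leq0n m).
rewrite expr0 mulr1 subn0 mulr1 mulrC => <-.
have := homogenize_mulXn Y0 Y1 sr (leqnn m).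
rewrite subnn expr0 mul1r => <-.
by rewrite pa mulrC; apply: eqmod_refl.
Qed.

Lemma pullback_at0 (v : 'rV[k]_3) (a : form) :
  (forall j, v 0 j = M j 0) -> (pb a).[0] = a.@[v 0].
Proof.
move=> hv; rewrite horner_pullback; apply: meval_eq => j.
rewrite hv horner_coef0 /curve_param coef_sum (bigD1 ord0) //=.
rewrite coefZ coefXn mulr1 big1 ?addr0 // => i i0.
by rewrite coefZ coefXn eq_sym -[0%N]/(val (@ord0 e)) val_eqE (negbTE i0) mulr0.
Qed.

Section AtPoint.
Variables (P : ppoint k) (v : 'rV[k]_3).
Hypotheses (eP : val P = <[v]>%VS) (hv : forall j, v 0 j = M j 0).

Lemma not_vanishes_pullback d b : b \is d.-homog ->
  ~ vanishes_at b P <-> (pb b).[0] != 0.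
Proof.
move=> hb; rewrite (pullback_at0 _ hv); have h := vanishes_at_line hb eP.
by split=> [n|/eqP n /h //]; apply/eqP => /h.
Qed.

Variables (E m : nat) (f : form) (h : {poly k}).
Hypotheses (hf : f \is E.-homog) (pf : pb f = 'X^m * h) (h0 : h.[0] != 0).

(** The cofactor [h] of [f] is invertible at the point. Modulo [q] and up to powers of [Y0], the
    products of [a] with the homogenized [h] and of [f] with the homogenized [r] both equal
    [h r Y1 ^ m]; hence [a] lies in the local ideal of [q] and [f]. *)
Lemma order_ideal D a r : a \is D.-homog -> pb a = 'X^m * r ->
  exists d b w u, [/\ b \is d.-homog, (pb b).[0] != 0,
    f * w \is (d + D).-homog, q * u \is (d + D).-homog
    & b * a = q * u + f * w].
Proof.
move=> ha pa; have [sr er] := param_order ha pa; have [sh eh] := param_order hf pf.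
have [H0 H1] := (param_homog0 param, param_homog1 param).
pose b := hom (E * e) h * Y0 ^+ (m + D * e.-1).
pose w := hom (D * e) r * Y0 ^+ (m + E * e.-1).
have : eqmod q (b * a) (f * w).
  rewrite /b /w -mulrA; apply: eqmod_trans (eqmodM (eqmod_refl _ _) er) _.
  rewrite [f * _]mulrC -[_ * _ * f]mulrA mulrCA.
  by apply/eqmodM/eqmod_sym/eh; apply: eqmod_refl.
case=> u eu; exists (E * e + (m + D * e.-1))%N, b, w, u.
have hb : b \is (E * e + (m + D * e.-1)).-homog.
  by have := dhomogM (homogenize_homog (E * e) h H0 H1)
    (dhomogMn (m + D * e.-1) H0); rewrite mul1n.
have hfw : f * w \is (E * e + (m + D * e.-1) + D).-homog.
  have := dhomogM hf (dhomogM (homogenize_homog (D * e) r H0 H1)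
    (dhomogMn (m + E * e.-1) H0)).
  rewrite mul1n; congr (_ \is _.-homog); case: (e) e_gt0 => // e' _ /=.
  by rewrite !mulnS; lia.
split.
- exact: hb.
- rewrite /b rmorphM rmorphXn /= (param_Y0 param) expr1n mulr1.
  by rewrite pullback_homogenize.
- exact: hfw.
- by rewrite -eu; apply: rpredB hfw; apply: dhomogM.
- by rewrite -eu subrK.
Qed.

(** Through the pullback, the local ring modulo [q] and [f] becomes [k[t]] modulo [t ^ m], with
    basis the classes of [(Y1 / Y0) ^ i] for [i < m]. *)
Theorem intersection_multiplicity_order : intersection_multiplicity P q f m.
Proof.
have [H0 H1] := (param_homog0 param, param_homog1 param).
have Y0n0 : Y0 != 0.
  apply/eqP => y0; have := param_Y0 param; rewrite y0 rmorph0.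
  by move/eqP; rewrite eq_sym oner_eq0.
have b0 b : (pb b).[0] != 0 -> b != 0.
  by apply: contraNneq => ->; rewrite rmorph0 /= horner0.
have hXn i (Y : form) : Y \is 1.-homog -> Y ^+ i \is i.-homog.
  by move=> hY; have := dhomogMn i hY; rewrite mul1n.
exists (fun i : 'I_m => frac (Y1 ^+ i) / frac (Y0 ^+ i)); split=> [i|phi].
  exists i, (Y1 ^+ i), (Y0 ^+ i); split; rewrite ?hXn //.
  apply/(not_vanishes_pullback (hXn i Y0 H0)).
  by rewrite rmorphXn /= (param_Y0 param) expr1n hornerC oner_eq0.
case=> d [a [b [ha hb /(not_vanishes_pullback hb) bv ->]]].
pose t (c : 'rV[k]_m) : form :=
  \sum_(i < m) c 0 i *: (Y0 ^+ (m - i) * Y1 ^+ i).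
pose A c := Y0 ^+ m * a - b * t c.
have pt c : pb (t c) = rVpoly c.
  rewrite /t rmorph_sum rVpoly_sum; apply: eq_bigr => i _.
  rewrite /= pullbackZ rmorphM !rmorphXn /= (param_Y0 param) (param_Y1 param).
  by rewrite expr1n mul1r.
have pA c : pb (A c) = pb a - pb b * rVpoly c.
  by rewrite /A rmorphB !rmorphM rmorphXn /= (param_Y0 param) expr1n mul1r pt.
have hA c : A c \is (d + m).-homog.
  rewrite /A; apply: rpredB; first by rewrite addnC; apply: dhomogM (hXn _ _ H0) ha.
  apply: dhomogM hb _; apply: rpred_sum => i _; apply: dhomogZ.
  have := dhomogM (hXn (m - i)%N _ H0) (hXn i _ H1).
  by rewrite subnK // ltnW.
have eA (c : 'rV[k]_m) : frac a / frac b - \sum_(i < m) frac (c 0 i)%:MP *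
    (frac (Y1 ^+ i) / frac (Y0 ^+ i)) = frac (A c) / frac (b * Y0 ^+ m).
  have nb : frac b != 0 by rewrite tofrac_eq0 b0.
  have ny : frac Y0 != 0 by rewrite tofrac_eq0.
  rewrite /A tofracB !tofracM tofracXn /t [in RHS]raddf_sum /=.
  rewrite mulrBl; congr (_ - _).
    by rewrite (expand_fraction _ nb (expf_neq0 m ny)).
  rewrite mulr_sumr mulr_suml; apply: eq_bigr => i _.
  rewrite -mul_mpolyC !tofracM !tofracXn.
  have -> : frac Y0 ^+ m = frac Y0 ^+ (m - i) * frac Y0 ^+ i.
    by rewrite -exprD subnK // ltnW.
  by rewrite (expand_product _ _ nb (expf_neq0 (m - i) ny) (expf_neq0 i ny)).
have cop (p : {poly k}) : p.[0] != 0 -> coprimep ('X^m) p.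
  move=> p0; apply: coprimep_expl; rewrite coprimep_sym.
  by rewrite -['X]subr0 -polyC0 coprimep_XsubC.
(* The coordinates of [a / b] are the first [m] coefficients of its power series: a Bezout relation
   inverts the denominator modulo ['X^m]. *)
have [c hc] : exists c, 'X^m %| pb (A c).
  have /Bezout_eq1_coprimepP[[u1 u2] /= eu] := cop _ bv.
  exists (poly_rV ((u2 * pb a) %% 'X^m)); rewrite pA poly_rV_K; last first.
    by rewrite -ltnS -(size_polyXn k m) ltn_modp monic_neq0 ?monicXn.
  set s := u2 * pb a.
  have -> : pb a - pb b * (s %% 'X^m) = 'X^m * (u1 * pb a + pb b * (s %/ 'X^m)).
    have -> : s %% 'X^m = s - s %/ 'X^m * 'X^m by rewrite {2}(divp_eq s 'X^m) addrC addKr.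
    by rewrite /s -{1}[pb a]mul1r -eu; ring.
  exact: dvdp_mulIl.
exists c; split.
  have [r er] : exists r, pb (A c) = 'X^m * r.
    by exists (pb (A c) %/ 'X^m); rewrite mulrC divpK.
  have [d' [B [w [u [hB Bv hw hu eBA]]]]] := order_ideal (hA c) er.
  exists (d' + (d + m))%N, u, w, (B * (b * Y0 ^+ m)).
  have hBb := dhomogM hB (dhomogM hb (hXn m _ H0)).
  split; [exact: hu | exact: hw | exact: hBb | |].
    apply/(not_vanishes_pullback hBb).
    rewrite !rmorphM rmorphXn /= (param_Y0 param) expr1n mulr1 hornerM.
    by rewrite mulf_neq0.
  rewrite eA -eBA [frac (B * A c)]tofracM [frac (B * _)]tofracM -mulf_div divff ?mul1r //.
  by rewrite tofrac_eq0 b0.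
(* Uniqueness: the pullback kills the [q] part of the ideal and makes its [f] part a multiple of
   ['X^m], so two coordinate polynomials of degree below [m] agree modulo ['X^m]. *)
move=> c' [d' [x [x' [b' [hx hx' hb' /(not_vanishes_pullback hb') bv' ]]]]].
have [bn0 b'n0] : b * Y0 ^+ m != 0 /\ b' != 0.
  by split; [apply: mulf_neq0; [apply: b0 | apply: expf_neq0] | apply: b0].
rewrite eA => /eqP; rewrite eqr_div ?tofrac_eq0 //.
rewrite -!tofracM tofrac_eq => /eqP /(congr1 pb).
rewrite [pb (A c' * _)]rmorphM [pb ((q * x + _) * _)]rmorphM /=.
rewrite [pb (b * _)]rmorphM [pb (q * x + _)]rmorphD /=.
rewrite [pb (q * _)]rmorphM [pb (f * _)]rmorphM /= (param_eq0 param) mul0r add0r pf => ex.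
have hc' : 'X^m %| pb (A c').
  rewrite -(Gauss_dvdpl _ (cop _ bv')) ex -!mulrA; exact: dvdp_mulIl.
have : 'X^m %| pb b * rVpoly (c - c').
  have -> : pb b * rVpoly (c - c') = pb (A c') - pb (A c).
    by rewrite !pA linearB /=; ring.
  by rewrite dvdp_sub.
rewrite (Gauss_dvdpr _ (cop _ bv)) => dv.
have : rVpoly (c - c') = 0.
  apply: contraTeq dv => n0; apply/negP => /(dvdp_leq n0).
  by rewrite size_polyXn leqNgt ltnS size_poly.
by move/(congr1 (@poly_rV _ m)); rewrite rVpolyK linear0 => /subr0_eq.
Qed.

End AtPoint.
End LocalIntersection.

(** * Uniqueness of the intersection multiplicity *)

Section MultiplicityUnique.
Variable k : closedFieldType.
Local Notation form := {mpoly k[3]}.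
Local Notation frac := (@FracField.tofrac {mpoly k[3]}).
Variables (P : ppoint k) (f g : form).
Local Notation ideal := (local_ideal P f g).

Lemma vanishes_atM d e (a b : form) : a \is d.-homog -> b \is e.-homog ->
  ~ vanishes_at a P -> ~ vanishes_at b P -> ~ vanishes_at (a * b) P.
Proof.
move=> ha hb na nb; have [v ev] : exists v : 'rV[k]_3, val P = <[v]>%VS.
  exists (vpick (val P)); apply/esym/eqP; rewrite eqEdim -memvE memv_pick /=.
  by rewrite (eqP (valP P)) dim_vline vpick0 -dimv_eq0 (eqP (valP P)).
rewrite (vanishes_at_line (dhomogM ha hb) ev) mevalM => /eqP.
rewrite mulf_eq0 => /orP[] /eqP.
- by move/(vanishes_at_line ha ev).
- by move/(vanishes_at_line hb ev).
Qed.

Lemma not_vanishes_neq0 (b : form) : ~ vanishes_at b P -> b != 0.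
Proof. by move=> nb; apply/eqP => b0; apply: nb => v _; rewrite b0 meval0. Qed.

Lemma local_ideal0 : ideal 0.
Proof.
exists 0%N, 0, 0, 1; rewrite !mulr0 addr0 rmorph0 mul0r; split=> //.
- exact: dhomog0.
- exact: dhomog0.
- exact: dhomog1.
move=> v1; have [v vP v0] : exists2 v : 'rV[k]_3, v \in val P & v != 0.
  exists (vpick (val P)); first exact: memv_pick.
  by rewrite vpick0 -dimv_eq0 (eqP (valP P)).
by have := v1 v vP; rewrite meval1 => /eqP; rewrite oner_eq0.
Qed.

Lemma add_fractions (K : fieldType) (x y z t : K) : y != 0 -> t != 0 ->
  x / y + z / t = (x * t + z * y) / (y * t).
Proof. by move=> y0 t0; field; rewrite y0 t0. Qed.

Lemma local_idealD phi psi : ideal phi -> ideal psi -> ideal (phi + psi).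
Proof.
move=> [d [a [a' [b [h1 h2 hb nb ->]]]]] [d' [c [c' [b' [h3 h4 hb' nb' ->]]]]].
exists (d + d')%N, (a * b' + c * b), (a' * b' + c' * b), (b * b'); split.
- rewrite mulrDr !mulrA; apply: rpredD; first exact: dhomogM.
  by rewrite addnC; apply: dhomogM.
- rewrite mulrDr !mulrA; apply: rpredD; first exact: dhomogM.
  by rewrite addnC; apply: dhomogM.
- exact: dhomogM.
- exact: vanishes_atM hb hb' nb nb'.
have n0 : frac b != 0 by rewrite tofrac_eq0 not_vanishes_neq0.
have n0' : frac b' != 0 by rewrite tofrac_eq0 not_vanishes_neq0.
rewrite (add_fractions _ _ n0 n0') -!tofracM -tofracD; congr (frac _ / _).
by rewrite !mulrDr !mulrDl !mulrA addrACA.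
Qed.

Lemma local_idealZ c phi : ideal phi -> ideal (frac c%:MP * phi).
Proof.
move=> [d [a [a' [b [h1 h2 hb nb ->]]]]].
have cz (x y : form) : x * (c *: y) = c *: (x * y).
  by rewrite -!mul_mpolyC mulrCA.
exists d, (c *: a), (c *: a'), b; split=> //.
- by rewrite cz; apply: dhomogZ.
- by rewrite cz; apply: dhomogZ.
by rewrite !cz -scalerDr -mul_mpolyC [frac (c%:MP * _)]tofracM mulrA.
Qed.

Lemma local_ideal_sum (I : Type) (r : seq I) (E : I -> {fraction form}) :
  (forall i, ideal (E i)) -> ideal (\sum_(i <- r) E i).
Proof.
move=> h; elim: r => [|i r IH]; first by rewrite big_nil; apply: local_ideal0.
by rewrite big_cons; apply: local_idealD.
Qed.

(** Each family is expressed in the other modulo the ideal. Substituting twice returns [e], so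
    uniqueness of coordinates gives [X *m Y = 1], and the rank yields [m <= m']. *)
Lemma intersection_multiplicity_leq m m' :
  intersection_multiplicity P f g m -> intersection_multiplicity P f g m' ->
  (m <= m')%N.
Proof.
move=> [e [eO eB]] [e' [e'O e'B]].
have /boolp.choice[A hA] : forall j, exists a : 'rV[k]_m,
    ideal (e' j - \sum_i frac (a 0 i)%:MP * e i).
  by move=> j; have [c [hc _]] := eB _ (e'O j); exists c.
have /boolp.choice[A' hA'] : forall i, exists a : 'rV[k]_m',
    ideal (e i - \sum_j frac (a 0 j)%:MP * e' j).
  by move=> i; have [c [hc _]] := e'B _ (eO i); exists c.
pose X := \matrix_(i < m, j < m') A' i 0 j; pose Y := \matrix_(j < m', i < m) A j 0 i.
suff XY : X *m Y = 1%:M by exact: mulmx1_min XY.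
apply/row_matrixP => i; have [c [_ uc]] := eB _ (eO i).
rewrite -(uc (row i (X *m Y))) ?(uc (row i 1%:M)) //.
  rewrite (bigD1 i) //= !mxE eqxx tofrac1 mul1r big1 ?addr0 ?subrr.
    exact: local_ideal0.
  by move=> l li; rewrite !mxE eq_sym (negbTE li) mpolyC0 tofrac0 mul0r.
have -> : e i - \sum_l frac (row i (X *m Y) 0 l)%:MP * e l =
   (e i - \sum_j frac (A' i 0 j)%:MP * e' j) +
   \sum_j frac (A' i 0 j)%:MP * (e' j - \sum_l frac (A j 0 l)%:MP * e l).
  rewrite [X in _ = _ + X](eq_bigr _ (fun j _ => mulrBr _ _ _)).
  rewrite sumrB addrA subrK; congr (_ - _).
  rewrite [RHS](eq_bigr _ (fun j _ => mulr_sumr _ _ _ _)).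
  rewrite exchange_big; apply: eq_bigr => l _.
  rewrite !mxE raddf_sum raddf_sum mulr_suml; apply: eq_bigr => j _.
  by rewrite !mxE mulrA -tofracM -mpolyCM.
apply: local_idealD => //; apply: local_ideal_sum => j; exact: local_idealZ.
Qed.

End MultiplicityUnique.

Lemma intersection_multiplicity_uniq (k : closedFieldType) (P : ppoint k) f g m m' :
  intersection_multiplicity P f g m -> intersection_multiplicity P f g m' ->
  m = m'.
Proof.
by move=> h h'; apply/eqP; rewrite eqn_leq !(@intersection_multiplicity_leq _ P f g).
Qed.

(** * Explicit matrices of size 3 *)

Section Dim3.
Definition o0 : 'I_3 := @Ordinal 3 0 isT.
Definition o1 : 'I_3 := @Ordinal 3 1 isT.
Definition o2 : 'I_3 := @Ordinal 3 2 isT.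

Lemma ord3P (P : 'I_3 -> Prop) : P o0 -> P o1 -> P o2 -> forall i, P i.
Proof.
move=> p0 p1 p2 [[|[|[|//]]] h].
- by rewrite (_ : Ordinal h = o0) //; apply: val_inj.
- by rewrite (_ : Ordinal h = o1) //; apply: val_inj.
- by rewrite (_ : Ordinal h = o2) //; apply: val_inj.
Qed.

Lemma sum3 (V : nmodType) (E : 'I_3 -> V) : \sum_(i < 3) E i = E o0 + E o1 + E o2.
Proof.
rewrite !big_ord_recl big_ord0 addr0 addrA; congr (E _ + E _ + E _).
- exact: val_inj.
- exact: val_inj.
- exact: val_inj.
Qed.

Variable R : comNzRingType.

Definition mx33 (a b c d e f g h i : R) : 'M[R]_3 :=
  \matrix_(x, y) nth 0 (nth [::] [:: [:: a; b; c]; [:: d; e; f]; [:: g; h; i]] x) y.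

Definition cv3 (a b c : R) : 'cV[R]_3 := \col_x nth 0 [:: a; b; c] x.

Lemma mx33_eta (M : 'M[R]_3) : M = mx33 (M o0 o0) (M o0 o1) (M o0 o2)
  (M o1 o0) (M o1 o1) (M o1 o2) (M o2 o0) (M o2 o1) (M o2 o2).
Proof.
apply/matrixP => i j; rewrite mxE.
by move: i j; apply: ord3P; apply: ord3P.
Qed.

Lemma cv3_eta (v : 'cV[R]_3) : v = cv3 (v o0 0) (v o1 0) (v o2 0).
Proof. by apply/colP; apply: ord3P; rewrite !mxE. Qed.

Lemma det_mx33 a b c d e f g h i : \det (mx33 a b c d e f g h i) =
  a * (e * i - f * h) - b * (d * i - f * g) + c * (d * h - e * g).
Proof.
have det2 (A : 'M[R]_2) : \det A =
    A ord0 ord0 * A ord_max ord_max - A ord0 ord_max * A ord_max ord0.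
  rewrite (expand_det_row _ ord0) !big_ord_recl big_ord0 addr0 /cofactor !det_mx11.
  rewrite !mxE /= expr0 expr1 mul1r mulN1r mulrN.
  by congr (_ * A _ _ - A _ _ * A _ _); apply: val_inj.
rewrite (expand_det_row _ o0) sum3 /cofactor !det2 !mxE /=.
by rewrite expr0 expr1 -signr_odd /= expr0; ring.
Qed.

Lemma mul_mx33 a b c d e f g h i a' b' c' d' e' f' g' h' i' :
  mx33 a b c d e f g h i *m mx33 a' b' c' d' e' f' g' h' i' =
  mx33 (a * a' + b * d' + c * g') (a * b' + b * e' + c * h') (a * c' + b * f' + c * i')
       (d * a' + e * d' + f * g') (d * b' + e * e' + f * h') (d * c' + e * f' + f * i')
       (g * a' + h * d' + i * g') (g * b' + h * e' + i * h') (g * c' + h * f' + i * i').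
Proof.
apply/matrixP => x y; rewrite !mxE sum3 !mxE.
by move: x y; apply: ord3P; apply: ord3P.
Qed.

Lemma mul_mx33_cv a b c d e f g h i x y z :
  mx33 a b c d e f g h i *m cv3 x y z =
  cv3 (a * x + b * y + c * z) (d * x + e * y + f * z) (g * x + h * y + i * z).
Proof. by apply/colP; apply: ord3P; rewrite !mxE sum3 !mxE. Qed.

Lemma tr_mx33 a b c d e f g h i :
  (mx33 a b c d e f g h i)^T = mx33 a d g b e h c f i.
Proof. by apply/matrixP => x y; rewrite !mxE; move: x y; apply: ord3P; apply: ord3P. Qed.

Lemma scale_mx33 x a b c d e f g h i : x *: mx33 a b c d e f g h i =
  mx33 (x * a) (x * b) (x * c) (x * d) (x * e) (x * f) (x * g) (x * h) (x * i).
Proof.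
by apply/matrixP => y z; rewrite !mxE; move: y z; apply: ord3P; apply: ord3P.
Qed.

Lemma scale_cv3 c x y z : c *: cv3 x y z = cv3 (c * x) (c * y) (c * z).
Proof. by apply/colP; apply: ord3P; rewrite !mxE. Qed.

Lemma map_mx33 (phi : R -> R) a b c d e f g h i :
  map_mx phi (mx33 a b c d e f g h i) = mx33 (phi a) (phi b) (phi c)
    (phi d) (phi e) (phi f) (phi g) (phi h) (phi i).
Proof. by apply/matrixP => x y; rewrite !mxE; move: x y; apply: ord3P; apply: ord3P. Qed.

End Dim3.

(** With [x = Y0] and [y = Y1], this reduces [Y0] times a linear form modulo the conic
    [y ^ 2 = x z], which is the condition [param_gen] for conics. *)
Lemma conic_reduction (R : comNzRingType) (x y z a b d : R) :
  x * (a * x + b * y + d * z) =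
  a * x ^+ 2 + b * (x * y) + d * y ^+ 2 + - d * (y ^+ 2 - x * z).
Proof. by ring. Qed.

(** * Points of the plane and frames *)

Section Points.
Variable k : closedFieldType.
Local Notation form := {mpoly k[3]}.

Lemma dim_point0 : \dim <[delta_mx 0 o0 : 'rV[k]_3]> == 1%N.
Proof.
rewrite dim_vline eqb1; apply/eqP => /rowP/(_ o0).
by rewrite !mxE /= => /eqP; rewrite oner_eq0.
Qed.

Definition point0 : ppoint k := Sub <[delta_mx 0%R o0]>%VS dim_point0.

(** Total on vectors: zero is sent to the arbitrary [point0], so statements that look inside [pt x]
    assume [x != 0]. *)
Definition pt (x : 'cV[k]_3) : ppoint k := insubd point0 <[x^T]>%VS.

Lemma tr_neq0 (x : 'cV[k]_3) : (x^T != 0) = (x != 0).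
Proof. by rewrite -(inj_eq (@trmx_inj _ _ _) x 0) trmx0. Qed.

Lemma val_pt x : x != 0 -> val (pt x) = <[x^T]>%VS.
Proof. by move=> x0; rewrite insubdK // unfold_in dim_vline tr_neq0 x0. Qed.

Lemma ptP P : exists2 x, x != 0 & P = pt x.
Proof.
have v0 : vpick (val P) != 0 by rewrite vpick0 -dimv_eq0 (eqP (valP P)).
exists (vpick (val P))^T; first by rewrite -tr_neq0 trmxK.
apply: val_inj; rewrite val_pt -?tr_neq0 trmxK //.
apply/esym/eqP; rewrite eqEdim -memvE memv_pick /=.
by rewrite (eqP (valP P)) dim_vline v0.
Qed.

Lemma pt_scale c x : c != 0 -> pt (c *: x) = pt x.
Proof.
move=> c0; rewrite /pt linearZ /=; congr (insubd _ _); apply/vspaceP => v.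
apply/vlineP/vlineP => -[d ->]; first by exists (d * c); rewrite scalerA.
by exists (d / c); rewrite scalerA mulfVK.
Qed.

Lemma eq_pt x y : x != 0 -> y != 0 -> pt x = pt y ->
  exists2 c, c != 0 & y = c *: x.
Proof.
move=> x0 y0 /(congr1 val); rewrite !val_pt // => e.
have : y^T \in <[x^T]>%VS by rewrite e memv_line.
case/vlineP=> c /(congr1 trmx); rewrite linearZ /= !trmxK => ey; exists c => //.
by apply: contraNneq y0 => c0; rewrite ey c0 scale0r.
Qed.

Lemma zeros_pt d (f : form) x : f \is d.-homog -> x != 0 ->
  zeros f (pt x) <-> f.@[fun j => x j 0] = 0.
Proof.
move=> hf x0; rewrite /zeros /= (vanishes_at_line hf (val_pt x0)).
by rewrite (@meval_eq _ _ _ (fun j => x j 0)) // => j; rewrite mxE.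
Qed.

Definition linform (u : 'rV[k]_3) : form := \sum_j u 0 j *: 'X_j.

Lemma linform_homog u : linform u \is 1.-homog.
Proof.
apply: rpred_sum => j _; apply: dhomogZ; rewrite dhomogX; apply/eqP.
exact: mdeg1.
Qed.

Lemma linformZ c u : linform (c *: u) = c *: linform u.
Proof. by rewrite scaler_sumr; apply: eq_bigr => j _; rewrite mxE scalerA. Qed.

Lemma linformD u v : linform (u + v) = linform u + linform v.
Proof. by rewrite -big_split; apply: eq_bigr => j _; rewrite mxE scalerDl. Qed.

Lemma linform_sum n (E : 'I_n -> 'rV[k]_3) :
  linform (\sum_i E i) = \sum_i linform (E i).
Proof.
apply: (big_morph _ linformD); rewrite /linform big1 // => j _.
by rewrite mxE scale0r.
Qed.

Lemma meval_linform u (x : 'cV[k]_3) : (linform u).@[fun j => x j 0] = (u *m x) 0 0.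
Proof. by rewrite raddf_sum mxE; apply: eq_bigr => j _; rewrite /= mevalZ mevalXU. Qed.

Lemma pullback_linform u e (C : 'M[k]_(3, e.+1)) :
  pullback (curve_param C) (linform u) = \sum_i (u *m C) 0 i *: 'X^i.
Proof.
rewrite rmorph_sum /=; under eq_bigr do rewrite pullbackZ pullbackX scaler_sumr.
rewrite exchange_big; apply: eq_bigr => i _; rewrite mxE scaler_suml.
by apply: eq_bigr => j _; rewrite scalerA.
Qed.

(** The coordinate functions of the basis formed by the columns of [M]. *)
Definition coord (M : 'M[k]_3) (i : 'I_3) : form := linform (row i (invmx M)).

Lemma coord_homog M i : coord M i \is 1.-homog.
Proof. exact: linform_homog. Qed.

Lemma meval_coord M i (x : 'cV[k]_3) :
  (coord M i).@[fun j => x j 0] = (invmx M *m x) i 0.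
Proof. by rewrite meval_linform -row_mul mxE. Qed.

Lemma coord_sum M j : M \in unitmx -> 'X_j = \sum_i M j i *: coord M i.
Proof.
move=> uM; under eq_bigr do rewrite -linformZ.
rewrite -linform_sum; have -> : \sum_i M j i *: row i (invmx M) = row j 1%:M.
  by rewrite -(mulmxV uM) row_mul mulmx_sum_row; apply: eq_bigr => i _; rewrite mxE.
rewrite /linform (bigD1 j) //= !mxE eqxx scale1r big1 ?addr0 // => i ij.
by rewrite !mxE eq_sym (negbTE ij) scale0r.
Qed.

Lemma pullback_coord M i : M \in unitmx ->
  pullback (curve_param (e := 2) M) (coord M i) = 'X^i.
Proof.
move=> uM; rewrite pullback_linform -row_mul mulVmx // (bigD1 i) //=.
rewrite !mxE eqxx scale1r big1 ?addr0 // => j ji.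
by rewrite !mxE eq_sym (negbTE ji) scale0r.
Qed.

(** The equation of the image under [M] of the conic [(s ^ 2, s t, t ^ 2)]: a frame [M] stands for a
    conic together with a parametrization. *)
Definition conic_form (M : 'M[k]_3) : form :=
  coord M o1 ^+ 2 - coord M o0 * coord M o2.

Lemma conic_form_homog M : conic_form M \is 2.-homog.
Proof.
apply: rpredB; first exact: dhomogMn (coord_homog _ _).
exact: dhomogM (coord_homog _ _) (coord_homog _ _).
Qed.

Lemma eqmod_line (c d : k) (q a : form) : c != 0 -> eqmod (c *: q) (a + d *: q) a.
Proof.
move=> c0; exists (d / c)%:MP; rewrite addrAC subrr add0r mulrC mul_mpolyC.
by rewrite scalerA mulfVK.
Qed.

Lemma conic_parametrization c M : c != 0 -> M \in unitmx ->
  parametrization (e := 2) (c *: conic_form M) M (coord M o0) (coord M o1).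
Proof.
move=> c0 uM; split; rewrite ?coord_homog ?pullback_coord //.
  rewrite pullbackZ /conic_form rmorphB rmorphXn rmorphM /= !pullback_coord //=.
  by rewrite expr1 mul1r subrr scaler0.
move=> j; rewrite (coord_sum j uM) !sum3 /= expr1 !expr0 !mul1r mulr1.
have -> : coord M o0 * (M j o0 *: coord M o0 + M j o1 *: coord M o1 + M j o2 *: coord M o2)
  = (M j o0 *: coord M o0 ^+ 2 + M j o1 *: (coord M o0 * coord M o1)
     + M j o2 *: coord M o1 ^+ 2) + (- M j o2) *: conic_form M.
  rewrite /conic_form -!mul_mpolyC mpolyCN.
  exact: conic_reduction.
exact: eqmod_line.
Qed.

End Points.

(** * Conics *)

Section QuadraticForms.
Variable k : closedFieldType.
Local Notation form := {mpoly k[3]}.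

Definition quad (S : 'M[k]_3) : form := \sum_i \sum_j S i j *: ('X_i * 'X_j).

Lemma quadD S T : quad (S + T) = quad S + quad T.
Proof.
rewrite -big_split; apply: eq_bigr => i _; rewrite -big_split.
by apply: eq_bigr => j _; rewrite mxE scalerDl.
Qed.

Lemma quadZ c S : quad (c *: S) = c *: quad S.
Proof.
rewrite scaler_sumr; apply: eq_bigr => i _; rewrite scaler_sumr.
by apply: eq_bigr => j _; rewrite mxE scalerA.
Qed.

Lemma quad_delta a b : quad (delta_mx a b) = 'X_a * 'X_b.
Proof.
rewrite /quad (bigD1 a) //= (bigD1 b) //= mxE !eqxx scale1r.
rewrite big1 ?addr0 => [|j jb]; last by rewrite mxE (negbTE jb) andbF scale0r.
rewrite big1 ?addr0 // => i ia; rewrite big1 // => j _.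
by rewrite mxE (negbTE ia) scale0r.
Qed.

Lemma mderiv_sum n (R : comNzRingType) l (I : Type) (r : seq I) (E : I -> {mpoly R[n]}) :
  mderiv l (\sum_(i <- r) E i) = \sum_(i <- r) mderiv l (E i).
Proof. by apply: big_morph; [apply: mderivD | apply: mderiv0]. Qed.

Lemma meval_sum n (R : comNzRingType) v (I : Type) (r : seq I) (E : I -> {mpoly R[n]}) :
  (\sum_(i <- r) E i).@[v] = \sum_(i <- r) (E i).@[v].
Proof. by apply: big_morph; [apply: mevalD | apply: meval0]. Qed.

Hypothesis two_neq0 : (2%:R : k) != 0.

(** Splitting the coefficient of [X_a X_b] evenly between the two symmetric positions requires
    division by 2. *)
Lemma homog2_quad q : q \is 2.-homog -> exists2 S : 'M[k]_3, S^T = S & q = quad S.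
Proof.
move=> /dhomogP hq; rewrite [q]mpolyE big_seq; elim/big_ind: _.
- exists 0; rewrite ?trmx0 // /quad big1 // => i _; rewrite big1 // => j _.
  by rewrite mxE scale0r.
- move=> _ _ [S tS ->] [T tT ->]; exists (S + T); last by rewrite quadD.
  by rewrite linearD /= tS tT.
move=> m /hq dm; suff [a [b ->]] : exists a b, m = (U_(a) + U_(b))%MM.
  exists (q@_(U_(a) + U_(b))%MM / 2%:R *: (delta_mx a b + delta_mx b a)).
    by rewrite linearZ /= linearD /= !trmx_delta addrC.
  rewrite quadZ quadD !quad_delta mpolyXD ['X_b * _]mulrC -mulr2n -scaler_nat.
  by rewrite scalerA mulfVK.
have inv (n : 'X_{1..3}) d : mdeg n = d.+1 ->
    exists a n', n = (n' + U_(a))%MM /\ mdeg n' = d.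
  move=> dn; case: (pickP (fun i => n i != 0%N)) => [a na|h].
    have en : n = (n - U_(a) + U_(a))%MM by rewrite submK // lep1mP.
    exists a, (n - U_(a))%MM; split=> //.
    by move: dn; rewrite {1}en mdegD mdeg1 addn1 => -[].
  suff : mdeg n == 0%N by rewrite dn.
  rewrite mdeg_eq0; apply/eqP/mnmP => i; rewrite mnm0E.
  by apply/eqP; move: (h i) => /negbT; rewrite negbK.
have [a [n [-> /inv [b [n' [-> /eqP]]]]]] := inv m 1%N dm.
by rewrite mdeg_eq0 => /eqP ->; exists b, a; rewrite add0m.
Qed.

Lemma quad_change S (M : 'M[k]_3) : M \in unitmx ->
  quad S = \sum_a \sum_b (M^T *m S *m M) a b *: (coord M a * coord M b).
Proof.
move=> uM; rewrite /quad.
transitivity (\sum_i \sum_j \sum_a \sum_b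
    (M i a * S i j * M j b) *: (coord M a * coord M b)).
  apply: eq_bigr => i _; apply: eq_bigr => j _.
  rewrite {1}(coord_sum i uM) {1}(coord_sum j uM) mulr_suml scaler_sumr.
  apply: eq_bigr => a _; rewrite mulr_sumr scaler_sumr; apply: eq_bigr => b _.
  rewrite -!mul_mpolyC !mpolyCM; move: (coord M a) (coord M b) => x y.
  by rewrite mulrACA !mulrA [(S i j)%:MP * _]mulrC.
rewrite (eq_bigr _ (fun i _ => exchange_big _ _ _ _ _ _)) exchange_big.
apply: eq_bigr => a _; rewrite (eq_bigr _ (fun i _ => exchange_big _ _ _ _ _ _)).
rewrite exchange_big; apply: eq_bigr => b _.
rewrite (eq_bigr _ (fun i _ => esym (scaler_suml _ _ _ _))) -scaler_suml.
congr (_ *: _); rewrite mxE exchange_big; apply: eq_bigr => j _.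
by rewrite mxE mulr_suml; apply: eq_bigr => i _; rewrite mxE.
Qed.

Lemma mderiv_quad S (x : 'rV[k]_3) l : S^T = S ->
  (mderiv l (quad S)).@[x 0] = 2%:R * (x *m S) 0 l.
Proof.
move=> tS; rewrite /quad mderiv_sum meval_sum.
transitivity (\sum_i \sum_j
    ((i == l)%:R * (S i j * x 0 j) + (j == l)%:R * (S i j * x 0 i))).
  apply: eq_bigr => i _; rewrite mderiv_sum meval_sum; apply: eq_bigr => j _.
  rewrite mderivZ mevalZ mderivM !mderivX !mnm1E mevalD !mevalM !mevalZ !mevalXU.
  have mu (a : 'I_3) : (a == l)%:R * 'X_[U_(a) - U_(l)].@[x 0] = (a == l)%:R.
    case: eqP => [->|_]; last by rewrite mul0r.
    rewrite (_ : (U_(l) - U_(l))%MM = 0%MM) ?mpolyX0 ?meval1 ?mulr1 //.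
    by apply/mnmP => i'; rewrite mnmBE subnn mnm0E.
  by rewrite !mu; ring.
rewrite (eq_bigr _ (fun i _ => big_split _ _ _ _ _)) big_split /= mxE.
have delta (E : 'I_3 -> k) : \sum_i (i == l)%:R * E i = E l.
  by rewrite (bigD1 l) //= eqxx mul1r big1 ?addr0 // => i /negbTE ->; rewrite mul0r.
rewrite mulr_natl mulr2n; congr (_ + _).
  rewrite (eq_bigr _ (fun i _ => esym (mulr_sumr _ _ _ _))) delta.
  by apply: eq_bigr => j _; rewrite -{1}tS mxE mulrC.
rewrite exchange_big (eq_bigr _ (fun i _ => esym (mulr_sumr _ _ _ _))) delta.
by apply: eq_bigr => j _; rewrite mulrC.
Qed.

Lemma meval_quad S (x : 'rV[k]_3) : (quad S).@[x 0] = (x *m S *m x^T) 0 0.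
Proof.
transitivity (\sum_i \sum_j S i j * (x 0 i * x 0 j)).
  rewrite /quad meval_sum; apply: eq_bigr => i _; rewrite meval_sum.
  by apply: eq_bigr => j _; rewrite mevalZ mevalM !mevalXU.
rewrite mxE exchange_big; apply: eq_bigr => j _ /=; rewrite !mxE mulr_suml.
by apply: eq_bigr => i _; rewrite mulrA [S i j * _]mulrC.
Qed.

(** A nonzero vector of the kernel of [S] would be a zero of [quad S] at which the gradient [2 x S]
    vanishes. *)
Lemma nonsingular_quad_unit S : S^T = S -> nonsingular_form (quad S) ->
  S \in unitmx.
Proof.
move=> tS ns; rewrite -row_free_unit -kermx_eq0; apply/eqP/row_matrixP => i.
rewrite row0; apply/eqP; apply: contraT => v0; set v := row i _ in v0.
have vS : v *m S = 0 by apply: sub_kermxP; apply: row_sub.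
have := ns v v0; rewrite meval_quad vS mul0mx mxE => /(_ erefl)[l].
by rewrite mderiv_quad // vS mxE mulr0 eqxx.
Qed.

End QuadraticForms.

Section Conics.
Variable k : closedFieldType.
Local Notation form := {mpoly k[3]}.
Hypothesis two_neq0 : (2%:R : k) != 0.

Definition veronese (s t : k) : 'cV[k]_3 := cv3 (s ^+ 2) (s * t) (t ^+ 2).

Definition conic_points (M : 'M[k]_3) : set (ppoint k) :=
  [set P | exists s t, (s != 0) || (t != 0) /\ P = pt (M *m veronese s t)].

Lemma veronese_neq0 s t : (s != 0) || (t != 0) -> veronese s t != 0.
Proof.
move=> st; apply/eqP => /colP v0; have := v0 o0; have := v0 o2; rewrite !mxE /=.
move/eqP; rewrite sqrf_eq0 => /eqP t0 /eqP; rewrite sqrf_eq0 => /eqP s0.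
by move: st; rewrite s0 t0 eqxx.
Qed.

Lemma mulmx_unit_neq0 (M : 'M[k]_3) (x : 'cV_3) : M \in unitmx -> x != 0 -> M *m x != 0.
Proof.
by move=> uM; apply: contraNneq => e; rewrite -(mulKmx uM x) e mulmx0.
Qed.

Lemma zeros_conic_form c M : c != 0 -> M \in unitmx ->
  zeros (c *: conic_form M) = conic_points M.
Proof.
move=> c0 uM; apply/seteqP; split=> P.
  have [x x0 ->] := ptP P.
  rewrite (zeros_pt (dhomogZ c (conic_form_homog M)) x0) mevalZ /conic_form.
  rewrite expr2 mevalB !mevalM !meval_coord -expr2 => /eqP.
  rewrite mulf_eq0 (negbTE c0) subr_eq0 /= => /eqP.
  have -> : x = M *m (invmx M *m x) by rewrite mulKVmx.
  have : invmx M *m x != 0 by apply: mulmx_unit_neq0; rewrite ?unitmx_inv.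
  move: (invmx M *m x) => y y0; rewrite mulKmx // => e.
  have [z0|z0] := eqVneq (y o0 0) 0.
    have z1 : y o1 0 = 0 by apply/eqP; rewrite -sqrf_eq0 e z0 mul0r.
    have z2 : y o2 0 != 0.
      apply: contraNneq y0 => z2; apply/eqP/colP.
      by apply: ord3P; rewrite mxE.
    exists 0, 1; rewrite oner_eq0 orbT; split=> //.
    rewrite -[RHS](pt_scale _ z2) scalemxAr /veronese scale_cv3 [y]cv3_eta z0 z1 !mxE /=.
    by rewrite expr0n /= mul0r expr1n !mulr0 mulr1.
  exists 1, (y o1 0 / y o0 0); rewrite oner_eq0; split=> //.
  rewrite -[RHS](pt_scale _ z0) scalemxAr /veronese scale_cv3; congr (pt (_ *m _)).
  rewrite {1}[y]cv3_eta expr1n mul1r mulr1; congr cv3; first by rewrite mulrC mulfVK.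
  by rewrite expr_div_n e; field.
case=> s [t [st ->]].
have v0 := mulmx_unit_neq0 uM (veronese_neq0 st).
rewrite (zeros_pt (dhomogZ c (conic_form_homog M)) v0) mevalZ /conic_form.
rewrite expr2 mevalB !mevalM !meval_coord -expr2 mulKmx // !mxE /=; ring.
Qed.

(* The matrix of the substitution (s, t) |-> (a s + b t, c s + d t) on binary
   quadratic forms. *)
Definition sym2 (a b c d : k) : 'M[k]_3 :=
  mx33 (a ^+ 2) (2%:R * a * b) (b ^+ 2) (a * c) (a * d + b * c) (b * d)
       (c ^+ 2) (2%:R * c * d) (d ^+ 2).

Lemma sym2_veronese a b c d s t :
  sym2 a b c d *m veronese s t = veronese (a * s + b * t) (c * s + d * t).
Proof. by rewrite mul_mx33_cv; congr cv3; ring. Qed.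

Lemma det_sym2 a b c d : \det (sym2 a b c d) = (a * d - b * c) ^+ 3.
Proof. by rewrite det_mx33; ring. Qed.

Lemma sym2_unit a b c d : a * d - b * c != 0 -> sym2 a b c d \in unitmx.
Proof. by move=> h; rewrite unitmxE det_sym2 unitfE expf_neq0. Qed.

Lemma subst2_neq0 (a b c d s t : k) : a * d - b * c != 0 -> (s != 0) || (t != 0) ->
  (a * s + b * t != 0) || (c * s + d * t != 0).
Proof.
move=> h; apply: contraLR; rewrite !negb_or !negbK => /andP[/eqP e1 /eqP e2].
have es : (a * d - b * c) * s = d * (a * s + b * t) - b * (c * s + d * t) by ring.
have et : (a * d - b * c) * t = a * (c * s + d * t) - c * (a * s + b * t) by ring.
move: es et; rewrite e1 e2 !mulr0 subr0 => /eqP es /eqP et.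
by move: es et; rewrite !mulf_eq0 (negbTE h) /= => -> ->.
Qed.

(** A change of the parameter [(s : t)] moves points along the conic. The converse inclusion uses
    the adjugate substitution, at the cost of the scalar [(a d - b c) ^ 2]. *)
Lemma conic_points_sym2 (M : 'M[k]_3) (a b c d : k) : a * d - b * c != 0 ->
  conic_points (M *m sym2 a b c d) = conic_points M.
Proof.
move=> h; apply/seteqP; split=> _ [s [t [st ->]]].
  exists (a * s + b * t), (c * s + d * t); rewrite -mulmxA sym2_veronese; split=> //.
  exact: subst2_neq0.
exists (d * s - b * t), (- c * s + a * t); rewrite -mulmxA sym2_veronese; split.
  by rewrite -[- (b * t)]mulNr; apply: subst2_neq0 => //; rewrite mulrNN [d * a]mulrC.
have n0 : (a * d - b * c) ^+ 2 != 0 by rewrite expf_neq0.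
rewrite -[LHS](pt_scale _ n0) scalemxAr /veronese scale_cv3.
congr pt; congr mulmx; congr cv3; ring.
Qed.

Lemma conic_reparam (R : comNzRingType) (x y z a b c d : R) :
  (a * c * x + (a * d + b * c) * y + b * d * z) ^+ 2
  - (a ^+ 2 * x + 2%:R * a * b * y + b ^+ 2 * z)
    * (c ^+ 2 * x + 2%:R * c * d * y + d ^+ 2 * z)
  = (a * d - b * c) ^+ 2 * (y ^+ 2 - x * z).
Proof. by ring. Qed.

Lemma conic_rescale (R : comNzRingType) (l x y z : R) :
  (l * y) ^+ 2 - l * x * (l * z) = l ^+ 2 * (y ^+ 2 - x * z).
Proof. by ring. Qed.

Lemma conic_polar (R : comNzRingType) (x y z : R) :
  - (x * z) + (y * y) *+ 2 + - (z * x) = (y ^+ 2 - x * z) *+ 2.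
Proof. by ring. Qed.

Lemma coord_mul (M N : 'M[k]_3) i : M \in unitmx -> N \in unitmx ->
  coord M i = \sum_l N i l *: coord (M *m N) l.
Proof.
move=> uM uN; under eq_bigr do rewrite -linformZ.
rewrite -linform_sum /coord; congr linform.
have -> : invmx M = N *m invmx (M *m N).
  have uMN : M *m N \in unitmx by rewrite unitmx_mul uM.
  by rewrite -[RHS](mulKmx uM) (mulmxA M) mulmxV // mulmx1.
by rewrite row_mul mulmx_sum_row; apply: eq_bigr => l _; rewrite mxE.
Qed.

Lemma conic_form_sym2 (M : 'M[k]_3) (a b c d : k) : M \in unitmx -> a * d - b * c != 0 ->
  conic_form M = (a * d - b * c) ^+ 2 *: conic_form (M *m sym2 a b c d).
Proof.
move=> uM h; rewrite /conic_form !(coord_mul _ uM (sym2_unit h)) !sum3 !mxE /=.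
move: (coord _ o0) (coord _ o1) (coord _ o2) => x y z.
have := conic_reparam x y z a%:MP b%:MP c%:MP d%:MP.
rewrite -!mul_mpolyC !(mpolyCM, mpolyCD, mpolyCB, rmorphXn) /=.
by rewrite !mpolyC1 !expr2 mulr2n mpolyCN mpolyCM; apply.
Qed.

Lemma conic_pointsZ (l : k) (M : 'M[k]_3) : l != 0 -> conic_points (l *: M) = conic_points M.
Proof.
by move=> l0; apply/seteqP; split=> _ [s [t [st ->]]]; exists s, t; split=> //;
  rewrite -scalemxAl pt_scale.
Qed.


Definition conic_matrix : 'M[k]_3 := mx33 0 0 (-1) 0 2%:R 0 (-1) 0 0.

(** Twice the form has a Gram matrix congruent to [conic_matrix], of determinant [- 2], so the
    gradient vanishes only at 0. *)
Lemma conic_form_nonsingular (c : k) (M : 'M[k]_3) : c != 0 -> M \in unitmx ->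
  nonsingular_form (c *: conic_form M).
Proof.
move=> c0 uM v v0 _.
pose S := (c / 2%:R) *: ((invmx M)^T *m conic_matrix *m invmx M).
have tC : conic_matrix^T = conic_matrix by rewrite tr_mx33.
have eq_S : c *: conic_form M = quad S.
  suff e2 : quad ((invmx M)^T *m conic_matrix *m invmx M) = 2%:R *: conic_form M.
    by rewrite /S quadZ e2 scalerA mulfVK.
  rewrite (quad_change _ uM).
  have -> : M^T *m ((invmx M)^T *m conic_matrix *m invmx M) *m M = conic_matrix.
    by rewrite !mulmxA -trmx_mul mulVmx // trmx1 mul1mx -mulmxA mulVmx // mulmx1.
  rewrite !sum3 !mxE /= !scale0r !scaleN1r !scaler_nat ?addr0 ?add0r.
  exact: conic_polar.
have tS : S^T = S by rewrite linearZ /= !trmx_mul trmxK tC mulmxA.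
have uS : S \in unitmx.
  rewrite unitmxZ ?unitfE ?mulf_neq0 ?invr_eq0 //.
  rewrite !unitmx_mul unitmx_tr unitmx_inv uM /= andbT unitmxE det_mx33 unitfE.
  by rewrite (_ : _ + _ = - 2%:R) ?oppr_eq0 //; ring.
have : v *m S != 0.
  by apply: contraNneq v0 => e; rewrite -[v](mulmxK uS) e mul0mx.
case/rV0Pn => i vi; exists i; rewrite eq_S mderiv_quad //.
by rewrite mulf_neq0.
Qed.

End Conics.

(** * Normal form of a conic with two marked points *)

Section ConicNormalForm.
Variable k : closedFieldType.
Local Notation form := {mpoly k[3]}.
Hypothesis two_neq0 : (2%:R : k) != 0.

(** Independence makes some minor of order 2 nonzero; the standard basis vector of the remaining
    index then completes the pair. *)
Lemma basis_completion (u0 u1 u2 w0 w1 w2 : k) :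
  (u0 != 0) || (u1 != 0) || (u2 != 0) ->
  (forall c, ~ [/\ w0 = c * u0, w1 = c * u1 & w2 = c * u2]) ->
  exists f0 f1 f2, mx33 u0 f0 w0 u1 f1 w1 u2 f2 w2 \in unitmx.
Proof.
move=> u_n0 indep.
have [c0|c0] := eqVneq (u1 * w2 - u2 * w1) 0; last first.
  exists 1, 0, 0; rewrite unitmxE det_mx33 unitfE -oppr_eq0.
  by rewrite (_ : - _ = u1 * w2 - u2 * w1) //; ring.
have [c1|c1] := eqVneq (u0 * w2 - u2 * w0) 0; last first.
  exists 0, 1, 0; rewrite unitmxE det_mx33 unitfE.
  by rewrite (_ : _ + _ = u0 * w2 - u2 * w0) //; ring.
have [c2|c2] := eqVneq (u0 * w1 - u1 * w0) 0; last first.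
  exists 0, 0, 1; rewrite unitmxE det_mx33 unitfE -oppr_eq0.
  by rewrite (_ : - _ = u0 * w1 - u1 * w0) //; ring.
move/subr0_eq: c0 => c0; move/subr0_eq: c1 => c1; move/subr0_eq: c2 => c2.
case/orP: u_n0 => [/orP[]|] h.
- case: (indep (w0 / u0)); split; first by rewrite mulfVK.
    by apply: (mulfI h); rewrite c2; field.
  by apply: (mulfI h); rewrite c1; field.
- case: (indep (w1 / u1)); split; last by apply: (mulfI h); rewrite c0; field.
    by apply: (mulfI h); rewrite -c2; field.
  by rewrite mulfVK.
case: (indep (w2 / u2)); split; last by rewrite mulfVK.
  by apply: (mulfI h); rewrite -c1; field.
by apply: (mulfI h); rewrite -c0; field.
Qed.

Lemma conic_matrix_expand (R : comNzRingType) (b x y z : R) :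
  b * (x * z) + - ((1 + 1) * b) * (y * y) + b * (z * x) =
  - ((1 + 1) * b) * (y ^+ 2 - x * z).
Proof. by ring. Qed.

Lemma quad_conic (M S : 'M[k]_3) b : M \in unitmx ->
  M^T *m S *m M = mx33 0 0 b 0 (- (2%:R * b)) 0 b 0 0 ->
  quad S = (- (2%:R * b)) *: conic_form M.
Proof.
move=> uM e; rewrite (quad_change _ uM) e !sum3 !mxE /= !scale0r ?addr0 ?add0r.
rewrite /conic_form -!mul_mpolyC mpolyCN mpolyCM -[2%:R]/(1 + 1) mpolyCD mpolyC1.
exact: conic_matrix_expand.
Qed.

(** The two points give isotropic vectors spanning a hyperbolic plane of the polar form. They become
    the outer columns of [M], and the middle column is the pole of the line joining them, rescaled
    by a square root. *)
Lemma conic_normal_form (q : form) (x y : 'cV[k]_3) :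
  q \is 2.-homog -> nonsingular_form q -> x != 0 -> y != 0 -> pt x <> pt y ->
  zeros q (pt x) -> zeros q (pt y) ->
  exists (M : 'M[k]_3) c, [/\ M \in unitmx, c != 0, q = c *: conic_form M,
    M *m veronese 1 0 = x & M *m veronese 0 1 = y].
Proof.
move=> hq ns x0 y0 xy.
have [S tS eq_q] := homog2_quad two_neq0 hq.
rewrite (zeros_pt hq x0) (zeros_pt hq y0) => qx qy.
have uS : S \in unitmx by apply: (nonsingular_quad_unit tS); rewrite -eq_q.
have qE (z : 'cV[k]_3) : q.@[fun j => z j 0] = (z^T *m S *m z) 0 0.
  rewrite eq_q (@meval_eq _ _ _ (z^T 0)); last by move=> j; rewrite mxE.
  by rewrite meval_quad trmxK.
move: qx qy; rewrite !qE => qx qy.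
have [f0 [f1 [f2 uB]]] : exists f0 f1 f2,
    mx33 (x o0 0) f0 (y o0 0) (x o1 0) f1 (y o1 0) (x o2 0) f2 (y o2 0) \in unitmx.
  apply: basis_completion.
    apply: contraR x0; rewrite !negb_or !negbK => /andP[/andP[/eqP h0 /eqP h1] /eqP h2].
    by apply/eqP/colP; apply: ord3P; rewrite mxE.
  move=> c [h0 h1 h2]; apply: xy.
  have ey : y = c *: x by apply/colP; apply: ord3P; rewrite mxE.
  by rewrite ey pt_scale //; apply: contraNneq y0 => c0; rewrite ey c0 scale0r.
set B := mx33 _ _ _ _ _ _ _ _ _ in uB.
pose T := B^T *m S *m B.
have tT : T^T = T by rewrite /T !trmx_mul trmxK tS mulmxA.
have Bx : B *m veronese 1 0 = x.
  by rewrite [RHS]cv3_eta mul_mx33_cv; congr cv3; ring.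
have By : B *m veronese 0 1 = y.
  by rewrite [RHS]cv3_eta mul_mx33_cv; congr cv3; ring.
have Tdiag (i : 'I_3) (z : 'cV[k]_3) : B *m delta_mx i 0 = z ->
    (z^T *m S *m z) 0 0 = T i i.
  move=> <-; rewrite trmx_mul trmx_delta.
  have -> : delta_mx (0 : 'I_1) i *m B^T *m S *m (B *m delta_mx i (0 : 'I_1)) =
      delta_mx 0 i *m T *m delta_mx i 0 by rewrite /T !mulmxA.
  by rewrite -rowE -colE !mxE.
have v10 : veronese 1 0 = delta_mx o0 0 :> 'cV[k]_3.
  by apply/colP; apply: ord3P; rewrite !mxE /= ?expr1n ?mulr0 ?expr0n.
have v01 : veronese 0 1 = delta_mx o2 0 :> 'cV[k]_3.
  by apply/colP; apply: ord3P; rewrite !mxE /= ?expr1n ?mul0r ?expr0n.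
have T00 : T o0 o0 = 0 by rewrite -(Tdiag _ x) ?qx // -v10.
have T22 : T o2 o2 = 0 by rewrite -(Tdiag _ y) ?qy // -v01.
have Tsym i j : T i j = T j i by rewrite -{1}tT mxE.
pose a := T o0 o1; pose b := T o0 o2; pose d := T o1 o1; pose c := T o1 o2.
have eT : T = mx33 0 a b a d c b c 0.
  by rewrite [T]mx33_eta T00 T22 (Tsym o1 o0) (Tsym o2 o0) (Tsym o2 o1).
have uT : T \in unitmx by rewrite !unitmx_mul unitmx_tr uB uS.
have detT : b * (2%:R * a * c - b * d) != 0.
  move: uT; rewrite unitmxE eT det_mx33 unitfE; congr (_ != 0); ring.
move: detT; rewrite mulf_eq0 negb_or => /andP[b0 d'0].
(* [d'] is the value of the form at the pole [(- c / b, 1, - a / b)] of the chord; [l] rescales the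
   pole so that this value becomes [- 2 b]. *)
pose d' := d - 2%:R * a * c / b.
have nd' : d' != 0.
  apply: contraNneq d'0 => e; rewrite -(mulr0 (- b)) -e /d'; apply/eqP; field.
  exact: b0.
have [l el] : exists l, l ^+ 2 = - (2%:R * b) / d'.
  have [l hl] := @solve_monicpoly k 2 (fun i => if i == 0%N then - (2%:R * b) / d' else 0) isT.
  by exists l; rewrite hl !big_ord_recl big_ord0 /= expr0 mulr1 mul0r !addr0.
have l0 : l != 0.
  rewrite -sqrf_eq0 el mulf_neq0 ?invr_eq0 // oppr_eq0 mulf_neq0 //.
pose L := mx33 1 (- (c / b) * l) 0 0 l 0 0 (- (a / b) * l) 1.
have uL : L \in unitmx.
  by rewrite unitmxE det_mx33 unitfE (_ : _ + _ = l) //; ring.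
exists (B *m L), (- (2%:R * b)); split.
- by rewrite unitmx_mul uB.
- by rewrite oppr_eq0 mulf_neq0.
- rewrite eq_q; apply: quad_conic; first by rewrite unitmx_mul uB.
  rewrite trmx_mul -!mulmxA (mulmxA S) (mulmxA B^T) (mulmxA B^T S) -/T eT.
  rewrite mulmxA tr_mx33 !mul_mx33.
  have -> : - (2%:R * b) = l ^+ 2 * d' by rewrite el mulfVK.
  by rewrite /d'; congr mx33; field.
- by rewrite -mulmxA (_ : L *m _ = veronese 1 0) // mul_mx33_cv; congr cv3; ring.
- by rewrite -mulmxA (_ : L *m _ = veronese 0 1) // mul_mx33_cv; congr cv3; ring.
Qed.

End ConicNormalForm.

Lemma meval_exp n (R : comNzRingType) v (p : {mpoly R[n]}) m :
  (p ^+ m).@[v] = p.@[v] ^+ m.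
Proof. by elim: m => [|m IH]; rewrite ?expr0 ?meval1 // !exprS mevalM IH. Qed.

(** * Hermitian curves *)

Section Hermitian.
Variable k : closedFieldType.
Hypothesis char_k : 5%N \in [pchar k].
Local Notation form := {mpoly k[3]}.

Lemma five_eq0 : 5%:R = 0 :> k.
Proof. exact: pcharf0. Qed.

(** Identities valid only in characteristic 5 are reduced to [ring] by exhibiting the multiple [z]
    of 5 by which the integral identity fails. *)
Lemma eq_mod5 (x y z : k) : x = y + 5%:R * z -> x = y.
Proof. by rewrite five_eq0 mul0r addr0. Qed.

Lemma two_neq0 : 2%:R != 0 :> k.
Proof.
apply/eqP => e; have := oner_neq0 k.
have -> : 1 = 5%:R - 2%:R * 2%:R :> k by ring.
by rewrite five_eq0 e mul0r subr0 eqxx.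
Qed.

Local Notation frob := (map_mx (pFrobenius_aut char_k)).

Lemma frobE x : pFrobenius_aut char_k x = x ^+ 5.
Proof. by []. Qed.

(* On the conic (s ^ 2, s t, t ^ 2) this form is the square of s ^ 5 t - s t ^ 5. *)
Definition herm_mx : 'M[k]_3 := mx33 0 0 1 0 (- 2%:R) 0 1 0 0.

Lemma herm_mx_sym : herm_mx^T = herm_mx.
Proof. by rewrite tr_mx33. Qed.

Lemma herm_mx_unit : herm_mx \in unitmx.
Proof.
rewrite unitmxE det_mx33 unitfE (_ : _ + _ = 2%:R) ?two_neq0 //; ring.
Qed.

Lemma frob_nat n : (n%:R : k) ^+ 5 = n%:R.
Proof. by rewrite -(frobE n%:R) rmorph_nat. Qed.

Lemma frob_herm_mx : frob herm_mx = herm_mx.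
Proof.
rewrite map_mx33; congr mx33; rewrite ?rmorph0 ?rmorph1 //.
by rewrite rmorphN rmorph_nat.
Qed.

Lemma frob_scale n m c (A : 'M[k]_(n, m)) : frob (c *: A) = c ^+ 5 *: frob A.
Proof. exact: map_mxZ. Qed.

Lemma pchar_poly5 : 5%N \in [pchar {poly k}].
Proof. by rewrite pchar_poly. Qed.

Variable W : 'M[k]_3.
Hypothesis uW : W \in unitmx.

Definition herm_form : form :=
  \sum_i \sum_j herm_mx i j *: (coord W i * coord W j ^+ 5).

Lemma herm_form_homog : herm_form \is 6.-homog.
Proof.
apply: rpred_sum => i _; apply: rpred_sum => j _; apply: dhomogZ.
have := dhomogMn 5 (coord_homog W j); rewrite mul1n => h.
exact: (dhomogM (coord_homog W i) h).
Qed.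

Lemma meval_herm_form (y : 'cV[k]_3) : herm_form.@[fun j => (W *m y) j 0] =
  (y^T *m herm_mx *m frob y) 0 0.
Proof.
transitivity (\sum_i \sum_j herm_mx i j * (y i 0 * y j 0 ^+ 5)).
  rewrite /herm_form meval_sum; apply: eq_bigr => i _; rewrite meval_sum.
  apply: eq_bigr => j _; rewrite mevalZ mevalM; congr (_ * (_ * _)).
    by rewrite meval_coord mulKmx.
  by rewrite meval_exp meval_coord mulKmx.
rewrite mxE exchange_big; apply: eq_bigr => j _ /=; rewrite !mxE mulr_suml.
by apply: eq_bigr => i _; rewrite !mxE mulrA [_ * y i 0]mulrC.
Qed.

Lemma pullback_coordM e (D : 'M[k]_(3, e.+1)) i :
  pullback (curve_param (W *m D)) (coord W i) = \sum_a D i a *: 'X^a.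
Proof.
rewrite pullback_linform; apply: eq_bigr => a _.
by rewrite -row_mul mulmxA mulVmx // mul1mx mxE.
Qed.

(** Raising to the fifth power is additive: it acts on the coefficients and multiplies the exponents
    by 5. For [e = 2] the exponents [a + 5 b] are pairwise distinct, so the matrix can be recovered
    from the pullback. *)
Lemma pullback_herm_form e (D : 'M[k]_(3, e.+1)) :
  pullback (curve_param (W *m D)) herm_form =
  \sum_a \sum_b (D^T *m herm_mx *m frob D) a b *: 'X^(a + 5 * b).
Proof.
have d5 j : (\sum_b D j b *: 'X^b) ^+ 5 = \sum_b (D j b) ^+ 5 *: 'X^(5 * b) :> {poly k}.
  rewrite -(pFrobenius_autE pchar_poly5) rmorph_sum; apply: eq_bigr => b _.
  by rewrite /= pFrobenius_autE exprZn -exprM mulnC.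
transitivity (\sum_i \sum_j \sum_a \sum_b
    (D i a * herm_mx i j * (D j b) ^+ 5) *: 'X^(a + 5 * b) : {poly k}).
  rewrite rmorph_sum; apply: eq_bigr => i _; rewrite /= rmorph_sum; apply: eq_bigr => j _.
  rewrite /= pullbackZ rmorphM rmorphXn /= !pullback_coordM d5.
  rewrite mulr_suml scaler_sumr; apply: eq_bigr => a _.
  rewrite mulr_sumr scaler_sumr; apply: eq_bigr => b _.
  by rewrite -scalerAl -scalerAr !scalerA -exprD; congr (_ *: _); ring.
under eq_bigr do rewrite exchange_big.
rewrite exchange_big; apply: eq_bigr => a _ /=.
under eq_bigr do rewrite exchange_big.
rewrite exchange_big; apply: eq_bigr => b _ /=.
under eq_bigr do rewrite -scaler_suml.
rewrite -scaler_suml; congr (_ *: _); rewrite mxE exchange_big; apply: eq_bigr => j _.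
rewrite !mxE mulr_suml; apply: eq_bigr => i _.
by rewrite !mxE.
Qed.

End Hermitian.

(** * Similitudes of the Hermitian form *)

Section Similitudes.
Variable k : closedFieldType.
Hypothesis char_k : 5%N \in [pchar k].
Local Notation form := {mpoly k[3]}.
Local Notation frob := (map_mx (pFrobenius_aut char_k)).
Local Notation J := (herm_mx k).

(** The multiplier is asked to lie in the prime field, which forces the entries of [N] into F_25 by
    [frob_herm]. *)
Definition similitude (N : 'M[k]_3) := exists g : k,
  [/\ g != 0, g ^+ 5 = g & N^T *m J *m frob N = g *: J].

Lemma similitude_eq_unit g (N : 'M[k]_3) : g != 0 -> N^T *m J *m frob N = g *: J ->
  N \in unitmx.
Proof.
move=> g0 e; have : N^T *m J *m frob N \in unitmx.
  by rewrite e unitmxZ ?unitfE // herm_mx_unit.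
by rewrite !unitmx_mul unitmx_tr => /andP[/andP[]].
Qed.

Lemma similitude_unit N : similitude N -> N \in unitmx.
Proof. by case=> g [g0 _]; apply: similitude_eq_unit. Qed.

Lemma similitude1 : similitude 1%:M.
Proof.
exists 1; rewrite oner_neq0 expr1n; split=> //.
by rewrite trmx1 mul1mx map_mx1 mulmx1 scale1r.
Qed.

Lemma similitudeM N N' : similitude N -> similitude N' -> similitude (N *m N').
Proof.
move=> [g [g0 g5 e]] [g' [g'0 g'5 e']]; exists (g * g').
rewrite mulf_neq0 // exprMn g5 g'5; split=> //.
rewrite trmx_mul map_mxM !mulmxA -(mulmxA N'^T) -(mulmxA N'^T) e.
by rewrite -scalemxAr -scalemxAl e' scalerA.
Qed.

Lemma similitudeV N : similitude N -> similitude (invmx N).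
Proof.
move=> sN; have uN := similitude_unit sN; case: sN => g [g0 g5 e].
exists g^-1; rewrite invr_neq0 // exprVn g5; split=> //.
have eJ : J = g^-1 *: (N^T *m J *m frob N) by rewrite e scalerA mulVf ?scale1r.
rewrite {1}eJ -scalemxAr -scalemxAl !mulmxA -trmx_mul mulmxV // trmx1 mul1mx.
by rewrite -mulmxA -map_mxM mulmxV // map_mx1 mulmx1.
Qed.

(** A substitution over F_5 multiplies [s ^ 5 t - s t ^ 5] by its determinant, whence the
    multiplier. These similitudes preserve the standard conic. *)
Lemma similitude_sym2 (a b c d : k) :
  a ^+ 5 = a -> b ^+ 5 = b -> c ^+ 5 = c -> d ^+ 5 = d -> a * d - b * c != 0 ->
  similitude (sym2 a b c d).
Proof.
move=> ha hb hc hd h; exists ((a * d - b * c) ^+ 2); rewrite expf_neq0 //; split=> //.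
  by rewrite -exprM mulnC exprM -(frobE char_k) rmorphB !rmorphM /= !frobE ha hb hc hd.
pose phi : {rmorphism k -> k} := pFrobenius_aut char_k.
have -> : frob (sym2 a b c d) = sym2 a b c d.
  have [fa fb fc fd] : [/\ phi a = a, phi b = b, phi c = c & phi d = d] by [].
  rewrite (map_mx33 phi); congr mx33;
    by rewrite ?rmorphD ?rmorphM ?rmorph_nat ?rmorphXn /= -?/(phi _) ?fa ?fb ?fc ?fd.
rewrite tr_mx33 !mul_mx33 scale_mx33; congr mx33; ring.
Qed.

(** As [J] is symmetric and both [J] and [g] are fixed by Frobenius, the Frobenius image of the
    relation and its transpose have the same right-hand side; cancelling on the left identifies [N]
    with its second Frobenius image. *)
Lemma frob_herm N g : g != 0 -> g ^+ 5 = g -> N^T *m J *m frob N = g *: J ->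
  frob (frob N) = N.
Proof.
move=> g0 g5 e; have uN := similitude_eq_unit g0 e.
have ufN : frob N \in unitmx by rewrite map_unitmx.
have e1 : (frob N)^T *m J *m frob (frob N) = g *: J.
  have := congr1 (map_mx (pFrobenius_aut char_k)) e.
  by rewrite !map_mxM map_trmx frob_scale frob_herm_mx g5.
have e2 : (frob N)^T *m J *m N = g *: J.
  have := congr1 trmx e.
  by rewrite !trmx_mul trmxK linearZ /= herm_mx_sym mulmxA.
apply: (can_inj (@mulKmx _ _ _ ((frob N)^T *m J) _)); last by rewrite e1 e2.
by rewrite unitmx_mul unitmx_tr ufN herm_mx_unit.
Qed.

Variable W : 'M[k]_3.
Hypothesis uW : W \in unitmx.

Lemma pullback_conic N g : N^T *m J *m frob N = g *: J ->
  pullback (curve_param (e := 2) (W *m N)) (herm_form W) =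
  'X^2 * (g *: ('X^4 - 1) ^+ 2).
Proof.
move=> e; rewrite (pullback_herm_form char_k uW) e !sum3 !mxE /=.
rewrite !mulr0 !scale0r !mulr1 !addr0 !add0r -!mul_polyC.
rewrite polyCM polyCN -[2%:R]/(1 + 1) polyCD polyC1.
move: g%:P => G; ring.
Qed.

Definition inj23 : 'M[k]_(3, 2) := \matrix_(i, j) (i == j :> nat)%:R.

(** The line spanned by the first two columns of the frame is tangent to the conic at parameter 0.
    Only the middle entry of [J] survives on it, so the form becomes [- 2 g t ^ 6]. *)
Lemma pullback_line N g : N^T *m J *m frob N = g *: J ->
  pullback (curve_param (e := 1) (W *m N *m inj23)) (herm_form W) =
  'X^6 * (- (2%:R * g))%:P.
Proof.
move=> e; rewrite -mulmxA (pullback_herm_form char_k uW).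
have -> : (N *m inj23)^T *m J *m frob (N *m inj23) = g *: (inj23^T *m J *m inj23).
  have -> : frob (N *m inj23) = frob N *m inj23.
    by rewrite map_mxM; congr mulmx; apply/matrixP => i j; rewrite !mxE rmorph_nat.
  by rewrite trmx_mul !mulmxA -(mulmxA inj23^T N^T) -(mulmxA inj23^T _ (frob N)) e
    -scalemxAr -scalemxAl.
rewrite !big_ord_recl !big_ord0 !mxE !sum3 !mxE !sum3 !mxE /=.
rewrite ?(mulr0, mul0r, addr0, add0r, scale0r, mulr1, mul1r).
rewrite -mul_polyC mulrC; congr (_ * _%:P); ring.
Qed.

Lemma line_parametrization c M : c != 0 -> M \in unitmx ->
  parametrization (e := 1) (c *: coord M o2) (M *m inj23) (coord M o0) (coord M o1).
Proof.
move=> c0 uM.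
have pb l : pullback (curve_param (e := 1) (M *m inj23)) (coord M l) =
    \sum_(i < 2) (inj23 l i) *: 'X^i.
  rewrite (pullback_coordM uM); apply: eq_bigr => i _; by [].
split; rewrite ?coord_homog //.
- rewrite pullbackZ pb !big_ord_recl big_ord0 !mxE /= !scale0r !addr0.
  exact: scaler0.
- by rewrite pb !big_ord_recl big_ord0 !mxE /= scale0r !addr0 scale1r.
- by rewrite pb !big_ord_recl big_ord0 !mxE /= scale0r scale1r add0r addr0.
move=> j; rewrite (coord_sum j uM) sum3 expr0 mul1r !big_ord_recl big_ord0 addr0 /=.
have -> : (M *m inj23) j ord0 = M j o0.
  by rewrite mxE sum3 !mxE /= mulr1 !mulr0 !addr0.
have -> : (M *m inj23) j (lift ord0 ord0) = M j o1.
  by rewrite mxE sum3 !mxE /= mulr1 !mulr0 addr0 add0r.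
rewrite expr0 mulr1 expr1 expr0 mul1r; exact: eqmod_line.
Qed.

End Similitudes.

(** * From the Fermat sextic to the form [J] *)

Section NormalForm.
Variable k : closedFieldType.
Hypothesis char_k : 5%N \in [pchar k].
Local Notation form := {mpoly k[3]}.
Local Notation frob := (map_mx (pFrobenius_aut char_k)).
Local Notation J := (herm_mx k).

Lemma root_exists (a : k) n : (0 < n)%N -> exists x, x ^+ n = a.
Proof.
move=> n0; have [x hx] := @solve_monicpoly k n (fun i => if i == 0%N then a else 0) n0.
exists x; rewrite hx; case: n n0 {hx} => // n _.
rewrite big_ord_recl big1 /= ?addr0 ?expr0 ?mulr1 // => i _.
by rewrite mul0r.
Qed.

Lemma fermat_herm : exists N0 : 'M[k]_3,
  N0 \in unitmx /\ N0^T *m frob N0 = J.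
Proof.
have [b hb] := root_exists (- 2%:R) (isT : (0 < 6)%N).
(* The outer columns [(1, 2, 0)] and [(3, 4, 0)] are isotropic for the Fermat form with product 1,
   and the middle column has norm [b ^ 6 = - 2]. The numbers instantiated below are the multiples of
   5 by which the integral identities fail. *)
pose N0 := mx33 1 0 3%:R 2%:R 0 4%:R 0 b 0 : 'M[k]_3.
have e : N0^T *m frob N0 = J.
  pose phi : {rmorphism k -> k} := pFrobenius_aut char_k.
  rewrite (map_mx33 phi) tr_mx33 mul_mx33 !rmorph_nat rmorph0 rmorph1.
  have -> : phi b = b ^+ 5 by [].
  rewrite /herm_mx -hb; congr mx33; apply: (eq_mod5 char_k).
  - by instantiate (1 := 1); ring.
  - by instantiate (1 := 0); ring.
  - by instantiate (1 := 2%:R); ring.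
  - by instantiate (1 := 0); ring.
  - by instantiate (1 := 0); ring.
  - by instantiate (1 := 0); ring.
  - by instantiate (1 := 2%:R); ring.
  - by instantiate (1 := 0); ring.
  - by instantiate (1 := 5%:R); ring.
exists N0; split=> //; have := herm_mx_unit char_k; rewrite -e unitmx_mul unitmx_tr.
by case/andP.
Qed.

Lemma hermitian_normal_form F : hermitian_sextic F ->
  exists (W : 'M[k]_3) c, [/\ W \in unitmx, c != 0 & F = c *: herm_form W].
Proof.
case=> A [c [uA c0 ->]]; have [N0 [uN0 e]] := fermat_herm.
exists (invmx A *m N0), c; split=> //; first by rewrite unitmx_mul unitmx_inv uA.
congr (_ *: _); set W := invmx A *m N0.
have uW : W \in unitmx by rewrite unitmx_mul unitmx_inv uA.
pose l i := linform (row i A).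
have el i : l i = \sum_a N0 i a *: coord W a.
  rewrite /l; under eq_bigr do rewrite -linformZ.
  rewrite -linform_sum; congr linform.
  have -> : A = N0 *m invmx W.
    have -> : N0 = A *m W by rewrite mulKVmx.
    by rewrite -mulmxA mulmxV // mulmx1.
  by rewrite row_mul mulmx_sum_row; apply: eq_bigr => a _; rewrite mxE.
have char_form : 5%N \in [pchar form].
  by rewrite inE /= -mpolyC_nat (five_eq0 char_k) mpolyC0 eqxx.
have el5 i : l i ^+ 5 = \sum_b (N0 i b) ^+ 5 *: coord W b ^+ 5.
  rewrite el -(pFrobenius_autE char_form) rmorph_sum; apply: eq_bigr => b _.
  by rewrite /= pFrobenius_autE exprZn.
have -> : linear_subst A (fermat_sextic k) = \sum_i l i * l i ^+ 5.
  rewrite /linear_subst /fermat_sextic raddf_sum; apply: eq_bigr => i _.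
  rewrite /= rmorphXn /= comp_mpolyXU -exprS; congr (_ ^+ 6).
  rewrite (nth_map i) ?size_enum_ord // nth_ord_enum.
  by apply: eq_bigr => j _; rewrite mxE.
transitivity (\sum_i \sum_a \sum_b
   (N0 i a * N0 i b ^+ 5) *: (coord W a * coord W b ^+ 5)).
  apply: eq_bigr => i _; rewrite el5 el mulr_suml; apply: eq_bigr => a _.
  rewrite mulr_sumr; apply: eq_bigr => b _.
  move: (N0 i b ^+ 5) (coord W b ^+ 5) => n z.
  by rewrite -!mul_mpolyC mpolyCM mulrACA.
rewrite exchange_big; apply: eq_bigr => a _ /=.
rewrite exchange_big; apply: eq_bigr => b _ /=.
rewrite -scaler_suml -e mxE; congr (_ *: _).
by apply: eq_bigr => i _; rewrite !mxE.
Qed.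

End NormalForm.

Lemma mderiv_exp n (R : comNzRingType) i (p : {mpoly R[n]}) m :
  mderiv i (p ^+ m.+1) = (p ^+ m * mderiv i p) *+ m.+1.
Proof.
elim: m => [|m IH]; first by rewrite expr1 expr0 mul1r.
by rewrite exprS mderivM IH mulrnAr mulrA -exprS mulrC [RHS]mulrS.
Qed.

(** * Tangent lines and Weierstrass points *)

Section HermitianCurve.
Variable k : closedFieldType.
Hypothesis char_k : 5%N \in [pchar k].
Local Notation form := {mpoly k[3]}.
Local Notation frob := (map_mx (pFrobenius_aut char_k)).
Local Notation J := (herm_mx k).
Variables (W : 'M[k]_3) (c : k).
Hypotheses (uW : W \in unitmx) (c0 : c != 0).
Local Notation F := (c *: herm_form W).

Lemma hermF_homog : F \is 6.-homog.
Proof. exact/dhomogZ/herm_form_homog. Qed.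

Lemma veronese10 : veronese 1 0 = delta_mx o0 0 :> 'cV[k]_3.
Proof. by apply/colP; apply: ord3P; rewrite !mxE /= ?expr1n ?mulr0 ?expr0n. Qed.

Lemma frob_veronese s t : frob (veronese s t) = veronese (s ^+ 5) (t ^+ 5).
Proof. by apply/colP; apply: ord3P; rewrite !mxE /= frobE; ring. Qed.

Lemma herm_conic N g s t : N^T *m J *m frob N = g *: J ->
  let y := N *m veronese s t in
  (y^T *m J *m frob y) 0 0 = g * (s ^+ 5 * t - s * t ^+ 5) ^+ 2.
Proof.
move=> e y; have -> : y^T *m J *m frob y =
    g *: ((veronese s t)^T *m (J *m veronese (s ^+ 5) (t ^+ 5))).
  rewrite /y trmx_mul map_mxM frob_veronese !mulmxA -(mulmxA _ N^T) -(mulmxA _ _ (frob N)).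
  by rewrite e -scalemxAr -!scalemxAl.
by rewrite mul_mx33_cv mxE mxE sum3 !mxE /=; ring.
Qed.

Lemma zerosF (x : 'cV[k]_3) : W *m x != 0 ->
  zeros F (pt (W *m x)) <-> (x^T *m J *m frob x) 0 0 = 0.
Proof.
move=> x0; rewrite (zeros_pt hermF_homog x0) mevalZ (meval_herm_form char_k uW).
by split=> [/eqP|->]; rewrite ?mulr0 // mulf_eq0 (negbTE c0) => /eqP.
Qed.

(** Fifth powers have zero derivative, so differentiation acts only on the linear factor of each
    term and the gradient is read off [J *m frob y]. *)
Lemma tangent_formF (y : 'cV[k]_3) : tangent_form F (W *m y)^T =
  c *: \sum_a (J *m frob y) a 0 *: coord W a.
Proof.
have dZ i a : mderiv i (coord W a) = (invmx W a i)%:MP.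
  rewrite mderiv_sum (bigD1 i) //= mderivZ mderivX mnm1E eqxx scale1r.
  rewrite (_ : (U_(i) - U_(i))%MM = 0%MM); last by apply/mnmP => j; rewrite mnmBE subnn mnm0E.
  rewrite mpolyX0 big1 ?addr0 => [|j ji].
    by rewrite mxE -mul_mpolyC mulr1.
  by rewrite mderivZ mderivX mnm1E (negbTE ji) scale0r scaler0.
have d5 i b : mderiv i (coord W b ^+ 5) = 0.
  by rewrite mderiv_exp -mulr_natr -mpolyC_nat (five_eq0 char_k) mpolyC0 mulr0.
have dF i : (mderiv i F).@[(W *m y)^T 0] =
    c * \sum_a \sum_b J a b * (invmx W a i * y b 0 ^+ 5).
  rewrite mderivZ mevalZ mderiv_sum meval_sum; congr (_ * _); apply: eq_bigr => a _.
  rewrite mderiv_sum meval_sum; apply: eq_bigr => b _.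
  rewrite mderivZ mevalZ mderivM d5 mulr0 addr0 mevalM dZ mevalC meval_exp.
  rewrite (@meval_eq _ _ _ (fun j => (W *m y) j 0)) => [|j]; last by rewrite mxE.
  by rewrite meval_coord mulKmx.
rewrite /tangent_form (eq_bigr _ (fun i _ => congr1 (fun z => z *: 'X_i) (dF i))).
rewrite (eq_bigr _ (fun i _ => esym (scalerA _ _ _))) -scaler_sumr; congr (_ *: _).
transitivity (\sum_i \sum_a ((J *m frob y) a 0 * invmx W a i) *: 'X_i : form).
  apply: eq_bigr => i _; rewrite scaler_suml; apply: eq_bigr => a _; congr (_ *: _).
  by rewrite mxE mulr_suml; apply: eq_bigr => b _; rewrite !mxE frobE; ring.
rewrite exchange_big; apply: eq_bigr => a _ /=.
rewrite /coord /linform scaler_sumr; apply: eq_bigr => i _.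
by rewrite [row _ _ _ _]mxE scalerA.
Qed.

Lemma tangent_conic N g : N^T *m J *m frob N = g *: J -> g != 0 ->
  tangent_form F (W *m (N *m veronese 1 0))^T = (c * g) *: coord (W *m N) o2.
Proof.
move=> e g0; have uN := similitude_eq_unit g0 e.
rewrite tangent_formF -scalerA; congr (_ *: _).
under eq_bigr do rewrite (coord_mul _ uW uN) scaler_sumr.
rewrite exchange_big /=.
transitivity (\sum_l (N^T *m J *m frob N *m veronese 1 0) l 0 *: coord (W *m N) l).
  apply: eq_bigr => l _; under eq_bigr do rewrite scalerA.
  rewrite -scaler_suml; congr (_ *: _).
  rewrite map_mxM frob_veronese expr1n expr0n /= -!mulmxA [RHS]mxE.
  by apply: eq_bigr => a _; rewrite [N^T _ _]mxE mulrC.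
rewrite e -scalemxAl veronese10 -colE sum3 !mxE /=.
by rewrite !mulr0 mulr1 !scale0r !add0r.
Qed.

(** In the frame [W *m N] the tangent at the point of parameter 0 is the line of [pullback_line], on
    which the sextic vanishes to order 6. *)
Lemma weierstrass_conic N : similitude char_k N ->
  weierstrass_points F (pt (W *m (N *m veronese 1 0))).
Proof.
case=> g [g0 g5 e]; have uN := similitude_eq_unit g0 e.
have v0 : N *m veronese 1 0 != 0.
  by apply: mulmx_unit_neq0 => //; apply: veronese_neq0; rewrite oner_eq0.
have Wv0 : W *m (N *m veronese 1 0) != 0 by apply: mulmx_unit_neq0.
split; first by apply/(zerosF Wv0); rewrite (herm_conic _ _ e); ring.
exists (W *m (N *m veronese 1 0))^T.
rewrite val_pt // memv_line tr_neq0 Wv0; split=> //.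
have uM : W *m N \in unitmx by rewrite unitmx_mul uW.
have cg0 : c * g != 0 by rewrite mulf_neq0.
rewrite (tangent_conic e g0).
apply: (intersection_multiplicity_order (line_parametrization cg0 uM) isT
  (val_pt Wv0) _ hermF_homog (h := (- (2%:R * (c * g)))%:P)).
- move=> j; rewrite veronese10 mulmxA -colE [LHS]mxE [LHS]mxE [RHS]mxE sum3 ![inj23 _ _ _]mxE.
  by rewrite /= mulr1 !mulr0 !addr0.
- rewrite pullbackZ (pullback_line uW e) -mul_polyC mulrCA -polyCM.
  by congr (_ * _%:P); ring.
- by rewrite hornerC oppr_eq0 mulf_neq0 // (two_neq0 char_k).
Qed.

End HermitianCurve.

(** * Finite cardinalities *)

Section Cardinality.
Local Open Scope nat_scope.

Lemma card_image_seq (I : eqType) (T : Type) (s : seq I) (f : I -> T) :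
  uniq s -> {in s &, injective f} -> f @` [set` s] #= `I_(size s).
Proof.
elim: s => [|i s IH] /=.
  by move=> _ _; rewrite set_nil image_set0 II0 card_eq0.
move=> /andP[i_s us] fi; apply/eq_cardSP; exists (f i).
  by exists i; rewrite //= mem_head.
have -> : f @` [set` i :: s] `\ f i = f @` [set` s].
  apply/seteqP; split=> [_ [[j js <-] /= nji]|_ [j js <-]].
    by move: js; rewrite /= inE => /orP[/eqP e|js]; [case: nji; rewrite e | exists j].
  split=> [|/= e]; first by exists j; rewrite //= inE js orbT.
  have := fi j i; rewrite !inE js eqxx orbT => /(_ isT isT e) ji.
  by move: i_s; rewrite -ji js.
apply: IH => // j l js ls; apply: fi; by rewrite inE ?js ?ls orbT.
Qed.

Lemma card_enum (T : Type) (x0 : T) (A : set T) n : A #= `I_n ->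
  exists p : nat -> T, (forall i j, i < n -> j < n -> p i = p j -> i = j) /\
    forall x, A x <-> exists2 i, i < n & x = p i.
Proof.
elim: n A => [|n IH] A.
  rewrite II0 card_eq0 => /eqP ->; exists (fun=> x0); split=> // x.
  by split=> // -[].
case/eq_cardSP=> x Ax /IH[p [pi pA]].
exists (fun i => if i == n then x else p i); split.
  have npx l : l < n -> p l <> x.
    move=> ln e; have /pA[_ n1] : exists2 i, i < n & p l = p i by exists l.
    exact: (n1 e).
  have lt_n l : l < n.+1 -> l != n -> l < n by move=> h ln; rewrite ltn_neqAle ln -ltnS.
  move=> i j hi hj.
  case: (eqVneq i n) => [->|ni]; case: (eqVneq j n) => [->|nj] //= e.
  - by case: (npx j (lt_n _ hj nj)).
  - by case: (npx i (lt_n _ hi ni)).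
  - exact: pi (lt_n _ hi ni) (lt_n _ hj nj) e.
move=> y; split.
  move=> Ay; have [->|yx] := EM (y = x); first by exists n; rewrite ?eqxx.
  have /pA[i ltin ->] : (A `\ x) y by split.
  by exists i; [exact: ltnW | rewrite ltn_eqF].
case=> i; rewrite ltnS leq_eqVlt; case: (eqVneq i n) => [_ _ ->//|_ /= ltin ->].
by have /pA[] : exists2 j, j < n & p i = p j by exists i.
Qed.

Lemma card_eq_unique (T : Type) (A : set T) m n : A #= `I_m -> A #= `I_n -> m = n.
Proof.
by move=> h h'; apply/card_eq_II; apply: card_eq_trans h'; rewrite card_eq_sym.
Qed.

End Cardinality.

(** * The points of P^1(F_5) on a conic *)

Section RationalPoints.
Variable k : closedFieldType.
Hypothesis char_k : 5%N \in [pchar k].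

Lemma fixed_frob (x : k) : x ^+ 5 = x -> exists2 n, (n < 5)%N & x = n%:R.
Proof.
move=> e; suff : x * (x - 1) * (x - 2%:R) * (x - 3%:R) * (x - 4%:R) == 0.
  rewrite !mulf_eq0 !subr_eq0 => /orP[/orP[/orP[/orP[]|]|]|] /eqP ->.
  - by exists 0%N.
  - by exists 1%N.
  - by exists 2%N.
  - by exists 3%N.
  - by exists 4%N.
(* The product of the five factors is [x ^ 5 - x] up to the displayed multiple of 5. *)
apply/eqP; rewrite (_ : _ * _ = (x ^+ 5 - x) + 5%:R *
  (- 2%:R * x ^+ 4 + 7%:R * x ^+ 3 - 10%:R * x ^+ 2 + 5%:R * x)); last by ring.
by rewrite e subrr (five_eq0 char_k) mul0r addr0.
Qed.

Lemma nat_inj5 m n : (m < 5)%N -> (n < 5)%N -> m%:R = n%:R :> k -> m = n.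
Proof.
wlog mn : m n / (m <= n)%N => [hw|] hm hn e.
  by case: (leqP m n) => [/hw|/ltnW/hw h]; [apply | apply/esym/h].
have : (5 %| n - m)%N by rewrite (dvdn_pcharf char_k) natrB // e subrr.
by move=> /dvdnP[q]; lia.
Qed.

Lemma conic_point_eq (M : 'M[k]_3) s t s' t' : M \in unitmx ->
  (s != 0) || (t != 0) -> (s' != 0) || (t' != 0) ->
  pt (M *m veronese s t) = pt (M *m veronese s' t') <-> s * t' = s' * t.
Proof.
move=> uM n n'; split.
  have v0 := mulmx_unit_neq0 uM (veronese_neq0 n).
  have v0' := mulmx_unit_neq0 uM (veronese_neq0 n').
  move=> /(eq_pt v0 v0')[l l0]; rewrite scalemxAr => /(can_inj (mulKmx uM)).
  rewrite scale_cv3 => /colP e.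
  have := e o0; have := e o1; have := e o2; rewrite !mxE /= => e2 e1 e0.
  apply/eqP; rewrite -subr_eq0 -sqrf_eq0.
  have -> : (s * t' - s' * t) ^+ 2 =
    s ^+ 2 * t' ^+ 2 - 2%:R * (s * t) * (s' * t') + s' ^+ 2 * t ^+ 2 by ring.
  by rewrite e2 e1 e0; apply/eqP; ring.
move=> e.
have [l [l0 -> ->]] : exists l, [/\ l != 0, s' = l * s & t' = l * t].
  have [s0|s0] := eqVneq s 0.
    have t0 : t != 0 by move: n; rewrite s0 eqxx.
    have s'0 : s' = 0.
      by move/eqP: e; rewrite s0 mul0r eq_sym mulf_eq0 (negbTE t0) orbF => /eqP.
    have t'0 : t' != 0 by move: n'; rewrite s'0 eqxx.
    by exists (t' / t); rewrite mulf_neq0 ?invr_eq0 // s'0 s0 mulr0 mulfVK.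
  have s'0 : s' != 0.
    apply: contraTneq n' => s'0; move/eqP: e; rewrite s'0 mul0r mulf_eq0 (negbTE s0) /=.
    by move/eqP ->; rewrite eqxx.
  exists (s' / s); rewrite mulf_neq0 ?invr_eq0 // mulfVK //; split=> //.
  by apply: (mulfI s0); rewrite e; field.
have l20 : l ^+ 2 != 0 by rewrite expf_neq0.
rewrite -[LHS](pt_scale _ l20) scalemxAr scale_cv3.
by congr (pt (_ *m cv3 _ _ _)); ring.
Qed.

(** The points of P^1(F_5): slopes 0 to 4 and, from index 5 on, infinity. *)
Definition line5 (i : nat) : k * k := if (i < 5)%N then (1, i%:R) else (0, 1).

Lemma line5_neq0 i : ((line5 i).1 != 0) || ((line5 i).2 != 0).
Proof. by rewrite /line5; case: ifP; rewrite /= oner_neq0 ?orbT. Qed.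

Lemma line5_fixed i : (line5 i).1 ^+ 5 = (line5 i).1 /\ (line5 i).2 ^+ 5 = (line5 i).2.
Proof. by rewrite /line5; case: ifP; rewrite /= ?expr1n ?expr0n ?(frob_nat char_k). Qed.

Definition hexad (M : 'M[k]_3) (i : nat) : ppoint k :=
  pt (M *m veronese (line5 i).1 (line5 i).2).

Lemma line5_inj i j : (i < 6)%N -> (j < 6)%N ->
  (line5 i).1 * (line5 j).2 = (line5 j).1 * (line5 i).2 -> i = j.
Proof.
move=> hi hj; rewrite /line5; case: ltnP => i5; case: ltnP => j5 /=.
- by rewrite !mul1r => /esym /(nat_inj5 i5 j5).
- by rewrite mul0r mulr1 => /eqP; rewrite oner_eq0.
- by rewrite mul0r mulr1 => /esym /eqP; rewrite oner_eq0.
by lia.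
Qed.

Lemma hexad_inj M : M \in unitmx -> {in iota 0 6 &, injective (hexad M)}.
Proof.
move=> uM i j; rewrite !mem_iota => /andP[_ hi] /andP[_ hj].
by move/(conic_point_eq uM (line5_neq0 i) (line5_neq0 j)); apply: line5_inj.
Qed.

End RationalPoints.

Lemma prod_square_dvdp (K : fieldType) (rs : seq K) (p : {poly K}) : uniq rs ->
  (forall r, r \in rs -> ('X - r%:P) ^+ 2 %| p) ->
  (\prod_(r <- rs) ('X - r%:P)) ^+ 2 %| p.
Proof.
elim: rs => [|r rs IH] /=; first by rewrite big_nil expr1n dvd1p.
move=> /andP[r_rs u] h; rewrite big_cons exprMn Gauss_dvdp.
  by rewrite h ?mem_head // IH // => x xs; rewrite h // inE xs orbT.
apply: coprimep_expl; apply: coprimep_expr; rewrite coprimep_sym coprimep_XsubC.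
by rewrite root_prod_XsubC.
Qed.

Lemma mem_iota0 n m : [set` iota 0 m] n <-> (n < m)%N.
Proof. by rewrite -[[set` _] n]/(is_true (n \in iota 0 m)) mem_iota. Qed.

(** * Totally tangent conics *)

Section TangentConics.
Variable k : closedFieldType.
Hypothesis char_k : 5%N \in [pchar k].
Local Notation form := {mpoly k[3]}.
Local Notation frob := (map_mx (pFrobenius_aut char_k)).
Local Notation J := (herm_mx k).
Variables (W : 'M[k]_3) (c : k).
Hypotheses (uW : W \in unitmx) (c0 : c != 0).
Local Notation F := (c *: herm_form W).

(** The restriction [g (s ^ 5 t - s t ^ 5) ^ 2] vanishes exactly on P^1(F_5). *)
Lemma conic_zerosF N : similitude char_k N ->
  conic_points (W *m N) `&` zeros F = hexad (W *m N) @` [set` iota 0 6].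
Proof.
case=> g [g0 g5 e]; have uN := similitude_eq_unit g0 e.
have uM : W *m N \in unitmx by rewrite unitmx_mul uW.
have zE s t : (s != 0) || (t != 0) ->
    zeros F (pt (W *m N *m veronese s t)) <-> s ^+ 5 * t = s * t ^+ 5.
  move=> st; have v0 := mulmx_unit_neq0 uN (veronese_neq0 st).
  have v0' := mulmx_unit_neq0 uW v0.
  rewrite -mulmxA (zerosF char_k uW c0 v0') (herm_conic _ _ e); split=> [/eqP|->].
    by rewrite mulf_eq0 (negbTE g0) sqrf_eq0 subr_eq0 => /eqP.
  by rewrite subrr expr0n mulr0.
apply/seteqP; split=> [_ [[s [t [st ->]]] /(zE _ _ st) h]|_ [i /= hi <-]].
  have [s0|s0] := eqVneq s 0.
    exists 5%N; first by apply/mem_iota0.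
    apply/(conic_point_eq uM (line5_neq0 k 5) st).
    by rewrite /= s0 !mul0r.
  have [n n5 en] : exists2 n, (n < 5)%N & t / s = n%:R.
    apply: (fixed_frob char_k); rewrite expr_div_n.
    have s50 : s ^+ 5 != 0 by rewrite expf_neq0.
    by apply/eqP; rewrite eqr_div // mulrC -h mulrC.
  exists n; first by apply/mem_iota0; lia.
  apply/(conic_point_eq uM (line5_neq0 k n) st).
  by rewrite /line5 n5 mul1r -en mulrC mulfVK.
have [h1 h2] := line5_fixed char_k i.
split; first by exists (line5 k i).1, (line5 k i).2; rewrite line5_neq0.
by apply/(zE _ _ (line5_neq0 k i)); rewrite h1 h2.
Qed.

(** PGL_2(5) is 2-transitive on P^1(F_5): the substitution whose columns are the two chosen points
    brings them to parameters 0 and infinity without changing the conic. *)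
Lemma conic_move2 N i j : similitude char_k N -> (i < 6)%N -> (j < 6)%N -> i != j ->
  exists S : 'M[k]_3, [/\ similitude char_k S,
    conic_points (W *m (N *m S)) = conic_points (W *m N),
    exists2 d, d != 0 & conic_form (W *m N) = d *: conic_form (W *m (N *m S)),
    pt (W *m (N *m S *m veronese 1 0)) = hexad (W *m N) i
    & pt (W *m (N *m S *m veronese 0 1)) = hexad (W *m N) j].
Proof.
move=> sN hi hj ij; have uN := similitude_unit sN.
have uM : W *m N \in unitmx by rewrite unitmx_mul uW.
have [a5 c5] := line5_fixed char_k i; have [b5 d5] := line5_fixed char_k j.
set a := (line5 k i).1 in a5; set c' := (line5 k i).2 in c5.
set b := (line5 k j).1 in b5; set d := (line5 k j).2 in d5.
have det : a * d - b * c' != 0.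
  by rewrite subr_eq0; apply: contra_neq ij => /(line5_inj char_k hi hj).
exists (sym2 a b c' d); split.
- exact: similitude_sym2.
- by rewrite mulmxA conic_points_sym2.
- exists ((a * d - b * c') ^+ 2); first by rewrite expf_neq0.
  by rewrite mulmxA -conic_form_sym2.
- by rewrite -mulmxA sym2_veronese !mulr1 !mulr0 !addr0 mulmxA.
- by rewrite -mulmxA sym2_veronese !mulr1 !mulr0 !add0r mulmxA.
Qed.

Lemma tt_conic_similitude N : similitude char_k N ->
  tt_conics F (conic_points (W *m N)).
Proof.
move=> sN; have uN := similitude_unit sN.
have uM : W *m N \in unitmx by rewrite unitmx_mul uW.
exists (conic_form (W *m N)); rewrite -[conic_form _]scale1r; split.
- exact/dhomogZ/conic_form_homog.
- exact: (conic_form_nonsingular (two_neq0 char_k) (oner_neq0 _) uM).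
- by rewrite (zeros_conic_form (oner_neq0 _) uM).
- rewrite conic_zerosF //; apply: card_image_seq; first exact: iota_uniq.
  exact: hexad_inj.
move=> P; rewrite conic_zerosF // => -[i /mem_iota0 hi <-].
(* Any second index serves: 0, or 1 when [i] is 0. *)
have [j [hj ij]] : exists j, (j < 6)%N /\ i != j.
  by exists (i == 0%N : nat); split; case: (i) => // -[].
have [S [sS _ [d d0 ->] <- _]] := conic_move2 sN hi hj ij.
rewrite scale1r; have := similitudeM sN sS; set N' := N *m S => sN'.
have uN' := similitude_unit sN'; have uM' : W *m N' \in unitmx by rewrite unitmx_mul uW.
case: sN' => g [g0 _ e].
have v0 : W *m (N' *m veronese 1 0) != 0.
  by do 2!apply: mulmx_unit_neq0 => //; apply: veronese_neq0; rewrite oner_neq0.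
apply: (intersection_multiplicity_order (conic_parametrization d0 uM') isT
  (val_pt v0) _ (hermF_homog _ _) (h := c *: (g *: ('X^4 - 1) ^+ 2))).
- move=> l; rewrite veronese10 mulmxA -colE [LHS]mxE [LHS]mxE.
  by congr (fun_of_matrix _ _ _); apply: val_inj.
- by rewrite pullbackZ (pullback_conic uW e) scalerAr.
- rewrite !hornerZ horner_exp hornerD hornerN hornerXn hornerC expr0n /= sub0r.
  by rewrite sqrrN expr1n mulr1 mulf_neq0.
Qed.

End TangentConics.

(** * Classification of the totally tangent conics *)

Section Classification.
Variable k : closedFieldType.
Hypothesis char_k : 5%N \in [pchar k].
Local Notation form := {mpoly k[3]}.
Local Notation frob := (map_mx (pFrobenius_aut char_k)).
Local Notation J := (herm_mx k).

(** The listed exponents are those up to 10 that are not [a + 5 b] with [a, b <= 2]. Coefficients 9,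
    8 and 4 of the square successively annihilate those of [t ^ 4], [t ^ 3] and [t ^ 2] in [g], and
    the root 1 fixes that of [t]. *)
Lemma monic_quintic_coefs (g : {poly k}) (x : k) :
  size g = 6%N -> g \is monic -> g.[0] = 0 -> g.[1] = 0 -> x != 0 ->
  (forall i, i \in [:: 3; 4; 8; 9]%N -> x * (g ^+ 2)`_i = 0) ->
  g = 'X^5 - 'X.
Proof.
move=> sg mg g0 g1 x0 h.
have z i : i \in [:: 3; 4; 8; 9]%N -> \sum_(j < i.+1) g`_j * g`_(i - j) = 0.
  by move=> hi; have /eqP := h i hi; rewrite expr2 coefM mulf_eq0 (negbTE x0) => /eqP.
have c5 : g`_5 = 1 by move/monicP: mg; rewrite /lead_coef sg.
have c0 : g`_0 = 0 by rewrite -horner_coef0.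
have chi i : (5 < i)%N -> g`_i = 0 by move=> hi; apply: nth_default; rewrite sg.
have two0 := two_neq0 char_k.
have c4 : g`_4 = 0.
  have := z 9%N isT.
  rewrite !big_ord_recl big_ord0 /= /bump /= ?add1n ?subSS ?subn0 (chi 9%N) // (chi 8%N) //.
  rewrite (chi 7%N) // (chi 6%N) // c5.
  rewrite !(mul0r, mulr0, add0r, addr0, mul1r, mulr1) -mulr2n -mulr_natl => /eqP.
  by rewrite mulf_eq0 (negbTE two0) => /eqP.
have c3 : g`_3 = 0.
  have := z 8%N isT; rewrite !big_ord_recl big_ord0 /= /bump /= ?add1n ?subSS  ?subn0 (chi 8%N) //.
  rewrite (chi 7%N) // (chi 6%N) // c5 c4.
  rewrite !(mul0r, mulr0, add0r, addr0, mul1r, mulr1) -mulr2n -mulr_natl => /eqP.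
  by rewrite mulf_eq0 (negbTE two0) => /eqP.
have c2 : g`_2 = 0.
  have := z 4%N isT; rewrite !big_ord_recl big_ord0 /= /bump /= ?add1n ?subSS ?subn0 c4 c3 c0.
  rewrite !(mul0r, mulr0, add0r, addr0, mul1r, mulr1) => /eqP.
  by rewrite mulf_eq0 orbb => /eqP.
have c1 : g`_1 = - 1.
  move: g1; rewrite (horner_coef_wide _ (n := 6)) ?sg //.
  rewrite !big_ord_recl big_ord0 /= /bump /= ?add1n ?subSS ?subn0 c0 c2 c3 c4 c5 !expr1n.
  rewrite !(mul0r, add0r, addr0, mulr1) => /eqP; rewrite addr_eq0 => /eqP ->.
  by rewrite ?addr0.
apply/polyP => i; rewrite coefB coefXn coefX.
do 6?[case: i => [|i]; rewrite /= ?(c0, c1, c2, c3, c4, c5) ?subr0 ?sub0r //].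
by rewrite chi // subrr.
Qed.

Lemma pullback_shift e (C C' : 'M[k]_(3, e.+1)) r (f : form) :
  (forall j, curve_param C' j = curve_param C j \Po ('X + r%:P)) ->
  pullback (curve_param C') f = pullback (curve_param C) f \Po ('X + r%:P).
Proof.
move=> h; rewrite /pullback /mmap [RHS]rmorph_sum; apply: eq_bigr => m _ /=.
rewrite comp_polyM comp_polyC; congr (_ * _).
by rewrite /mmap1 rmorph_prod; apply: eq_bigr => j _; rewrite h rmorphXn.
Qed.

Variables (W : 'M[k]_3) (c : k).
Hypotheses (uW : W \in unitmx) (c0 : c != 0).
Local Notation F := (c *: herm_form W).

Lemma order_of_multiplicity (q : form) d M (P : ppoint k) m n (h : {poly k}) :
  d != 0 -> M \in unitmx -> q = d *: conic_form M -> P = pt (M *m veronese 1 0) ->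
  intersection_multiplicity P q F n ->
  pullback (curve_param (e := 2) M) F = 'X^m * h -> h.[0] != 0 -> m = n.
Proof.
move=> d0 uM -> -> im pf h0; apply: intersection_multiplicity_uniq im.
have v0 : M *m veronese 1 0 != 0.
  by apply: mulmx_unit_neq0 => //; apply: veronese_neq0; rewrite oner_neq0.
apply: (intersection_multiplicity_order (conic_parametrization d0 uM) isT
  (val_pt v0) _ (hermF_homog _ _) pf h0).
move=> l; rewrite veronese10 -colE [LHS]mxE [LHS]mxE.
by congr (fun_of_matrix _ _ _); apply: val_inj.
Qed.

(** Orders are compared with multiplicities at parameter 0 only; the shift [t -> t + r], a
    reparametrization of the conic, brings the root there. *)
Lemma double_root (q : form) d M r (P : ppoint k) :
  d != 0 -> M \in unitmx -> q = d *: conic_form M -> P = pt (M *m veronese 1 r) ->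
  intersection_multiplicity P q F 2 ->
  pullback (curve_param (e := 2) M) F != 0 ->
  ('X - r%:P) ^+ 2 %| pullback (curve_param (e := 2) M) F.
Proof.
move=> d0 uM eq_q eP im; set p := pullback _ _ => p0.
have [m [h nh ep]] := multiplicity_XsubC p r.
have det : 1 * 1 - 0 * r != 0 :> k by rewrite mulr1 mul0r subr0 oner_neq0.
have uM' : M *m sym2 1 0 r 1 \in unitmx by rewrite unitmx_mul uM sym2_unit.
suff <- : m = 2%N by rewrite ep; apply: dvdp_mulIr.
apply: (order_of_multiplicity (q := q) (P := P) d0 uM' _ _ im (h := h \Po ('X + r%:P))).
- rewrite eq_q (conic_form_sym2 uM det) mulr1 mul0r subr0 expr1n scale1r.
  by [].
- rewrite eP -mulmxA sym2_veronese !mulr1 !mulr0 !addr0.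
  by [].
- rewrite (pullback_shift (C := M) (r := r)).
    rewrite -/p ep comp_polyM rmorphXn /= comp_polyB comp_polyX comp_polyC addrK.
    by rewrite mulrC.
  move=> j; rewrite /curve_param !sum3 !mxE /= !sum3 !mxE /= !expr0 !expr1.
  rewrite !comp_polyD !comp_polyZ comp_Xn_poly !comp_polyC comp_polyX.
  rewrite -!mul_polyC !polyCD !polyCM; ring.
- by rewrite horner_comp hornerD hornerX hornerC add0r; move: nh; rewrite p0.
Qed.

Lemma coef_pullback_herm (D : 'M[k]_3) n :
  (pullback (curve_param (e := 2) (W *m D)) F)`_n =
  c * \sum_a \sum_b (D^T *m J *m frob D) a b * (n == (a + 5 * b)%N)%:R.
Proof.
rewrite pullbackZ coefZ (pullback_herm_form char_k uW) coef_sum; congr (_ * _).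
apply: eq_bigr => a _; rewrite coef_sum; apply: eq_bigr => b _.
by rewrite coefZ coefXn.
Qed.

(** The entries of the invertible Gram matrix are coefficients of the pullback at distinct
    exponents. *)
Lemma pullback_herm_neq0 (D : 'M[k]_3) : D \in unitmx ->
  pullback (curve_param (e := 2) (W *m D)) F != 0.
Proof.
move=> uD; apply/eqP => p0; set T := D^T *m J *m frob D.
have : T \in unitmx by rewrite !unitmx_mul unitmx_tr uD herm_mx_unit //= map_unitmx.
suff -> : T = 0 by rewrite unitmxE det0 unitr0.
apply/matrixP => a b; rewrite [RHS]mxE.
have : (pullback (curve_param (e := 2) (W *m D)) F)`_(a + 5 * b)%N = 0 by rewrite p0 coef0.
rewrite coef_pullback_herm -/T => /eqP; rewrite mulf_eq0 (negbTE c0) /= => /eqP <-.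
by move: a b; apply: ord3P; apply: ord3P;
  rewrite !sum3 /= !(mulr0, mulr1, addr0, add0r).
Qed.

(** Exchanging [s] and [t] brings infinity to parameter 0. The two lowest coefficients of the new
    pullback are the entries of [T] attached to [t ^ 12] and [t ^ 11], so their vanishing lowers the
    degree to 10. *)
Lemma double_infinity (q : form) d (D : 'M[k]_3) (P : ppoint k) :
  d != 0 -> D \in unitmx -> q = d *: conic_form (W *m D) ->
  P = pt (W *m D *m veronese 0 1) ->
  intersection_multiplicity P q F 2 ->
  (D^T *m J *m frob D) o2 o2 = 0 /\ (D^T *m J *m frob D) o1 o2 = 0.
Proof.
move=> d0 uD eq_q eP im; set T := _ *m frob D.
have uM : W *m D \in unitmx by rewrite unitmx_mul uW.
have det : 0 * 0 - 1 * 1 != 0 :> k by rewrite mul0r mulr1 sub0r oppr_eq0 oner_neq0.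
pose S := sym2 0 1 1 0 : 'M[k]_3; have uS : S \in unitmx by apply: sym2_unit.
have uDS : D *m S \in unitmx by rewrite unitmx_mul uD.
have uM' : W *m (D *m S) \in unitmx by rewrite unitmx_mul uW.
have [m [h nh ep]] := multiplicity_XsubC (pullback (curve_param (e := 2) (W *m (D *m S))) F) 0.
move: nh ep; rewrite (pullback_herm_neq0 uDS) implyTb => nh ep.
have m2 : m = 2%N.
  apply: (order_of_multiplicity (q := q) (P := P) (M := W *m (D *m S)) d0 uM' _ _ im (h := h)).
  - rewrite eq_q mulmxA (conic_form_sym2 uM det) mul0r mulr1 sub0r sqrrN expr1n scale1r.
    by [].
  - rewrite eP mulmxA -(mulmxA (W *m D)) sym2_veronese.
    by rewrite !mul0r !mul1r !addr0.
  - by rewrite ep subr0 mulrC.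
  - by move: nh.
have S_E : S = mx33 0 0 1 0 1 0 1 0 0 by congr mx33; ring.
have frobS : frob S = S.
  by rewrite S_E (map_mx33 (pFrobenius_aut char_k)) rmorph0 rmorph1.
have T'E : (D *m S)^T *m J *m frob (D *m S) = S^T *m T *m S.
  by rewrite trmx_mul map_mxM frobS !mulmxA.
have coef_lt n : (n < 2)%N ->
    \sum_a \sum_b (S^T *m T *m S) a b * (n == (a + 5 * b)%N)%:R = 0.
  move=> n2; apply: (mulfI c0); rewrite mulr0 -T'E -coef_pullback_herm ep m2 subr0.
  by rewrite coefMXn n2.
move: (coef_lt 0%N isT) (coef_lt 1%N isT); rewrite S_E; move: T {T'E coef_lt} => T.
rewrite [T in X in X -> _](mx33_eta T) [T in X in _ -> X -> _](mx33_eta T).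
move: (T o0 o0) (T o0 o1) (T o0 o2) (T o1 o0) (T o1 o1) (T o1 o2).
move: (T o2 o0) (T o2 o1) (T o2 o2) => x y z x1 y1 z1 x2 y2 z2.
rewrite tr_mx33 !mul_mx33 !sum3 !mxE /=.
by rewrite !(mul0r, mulr0, mulr1, mul1r, add0r, addr0).
Qed.

End Classification.

Section Classification2.
Variable k : closedFieldType.
Hypothesis char_k : 5%N \in [pchar k].
Local Notation form := {mpoly k[3]}.
Local Notation frob := (map_mx (pFrobenius_aut char_k)).
Local Notation J := (herm_mx k).
Variables (W : 'M[k]_3) (c : k).
Hypotheses (uW : W \in unitmx) (c0 : c != 0).
Local Notation F := (c *: herm_form W).

(** [(t ^ 5 - t) ^ 2 = t ^ 10 - 2 t ^ 6 + t ^ 2], and 10, 6, 2 are the exponents [a + 5 b] of the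
    nonzero entries of [J]. *)
Lemma similitude_of_pullback (D : 'M[k]_3) (x : k) : D \in unitmx ->
  pullback (curve_param (e := 2) (W *m D)) F = x *: ('X^5 - 'X) ^+ 2 ->
  D^T *m J *m frob D = (x / c) *: J.
Proof.
move=> uD ep; set T := D^T *m J *m frob D; apply: (scalerI c0).
rewrite scalerA mulrCA mulfV // mulr1.
have cT (a b : 'I_3) : c * T a b = (x *: ('X^5 - 'X) ^+ 2)`_(a + 5 * b)%N.
  rewrite -ep (coef_pullback_herm char_k _ uW) -/T; congr (_ * _).
  by move: a b; apply: ord3P; apply: ord3P;
    rewrite !sum3 /= !(mulr0, mulr1, addr0, add0r).
have e2 : ('X^5 - 'X) ^+ 2 = 'X^10 - 2%:R *: 'X^6 + 'X^2 :> {poly k}.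
  by rewrite -mul_polyC polyC_natr; ring.
apply/matrixP => a b; rewrite mxE cT coefZ e2 !coefD coefN coefZ !coefXn mxE.
rewrite mxE; move: a b; apply: ord3P; apply: ord3P => /=; congr (_ * _);
  by rewrite ?(mulr0, mulr1, addr0, add0r, subr0, sub0r, oppr0).
Qed.

(** Degree at most 10 and divisibility by the square of a monic quintic leave a scalar multiple of
    that square, which [monic_quintic_coefs] identifies. *)
Lemma pullback_double_quintic (D : 'M[k]_3) (rs : seq k) : D \in unitmx ->
  uniq rs -> size rs = 5%N -> 0 \in rs -> 1 \in rs ->
  (forall r, r \in rs -> ('X - r%:P) ^+ 2 %| pullback (curve_param (e := 2) (W *m D)) F) ->
  (D^T *m J *m frob D) o2 o2 = 0 -> (D^T *m J *m frob D) o1 o2 = 0 ->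
  exists2 x, x != 0 &
    pullback (curve_param (e := 2) (W *m D)) F = x *: ('X^5 - 'X) ^+ 2.
Proof.
move=> uD urs srs rs0 rs1 dbl T22 T12; set p := pullback _ _ in dbl *.
have p0 : p != 0 by apply: pullback_herm_neq0.
pose g := \prod_(r <- rs) ('X - r%:P).
have mg : g \is monic by apply: monic_prod_XsubC.
have sg : size g = 6%N by rewrite size_prod_XsubC srs.
have /dvdpP[u eu] : g ^+ 2 %| p by apply: prod_square_dvdp.
have sp : (size p <= 11)%N.
  apply/leq_sizeP => n hn; rewrite /p (coef_pullback_herm char_k _ uW).
  rewrite big1 ?mulr0 // => a _; rewrite big1 // => b _; move: T22 T12.
  move: (_ *m frob D) => T T22 T12; have z i : (i < 11)%N -> T a b * (n == i)%:R = 0.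
    by move=> hi; rewrite gtn_eqF ?mulr0 // (leq_trans hi).
  by move: a b z; apply: ord3P; apply: ord3P => z; rewrite ?T22 ?T12 ?mul0r //; apply: z.
have u0 : u != 0 by apply: contraNneq p0 => u0; rewrite eu u0 mul0r.
have mg2 : g ^+ 2 \is monic by apply: monic_exp.
have sg2 : size (g ^+ 2) = 11%N.
  by rewrite expr2 size_monicM ?monic_neq0 // sg.
have su : (size u <= 1)%N.
  move: sp; rewrite eu mulrC size_monicM // sg2.
  by move: (size u) => n; clear; lia.
have [x ex] : exists x, u = x%:P by exists u`_0; apply: size1_polyC.
have x0 : x != 0 by apply: contraNneq u0 => x0; rewrite ex x0.
have ep : p = x *: g ^+ 2 by rewrite eu ex mul_polyC.
exists x => //; rewrite ep; congr (_ *: _ ^+ 2).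
apply: (monic_quintic_coefs char_k sg mg _ _ x0).
- by apply/rootP; rewrite root_prod_XsubC.
- by apply/rootP; rewrite root_prod_XsubC.
move=> i hi; rewrite -coefZ -ep /p (coef_pullback_herm char_k _ uW) !sum3 /=.
move: hi; rewrite !inE => /or4P[] /eqP ->;
  by rewrite /= !mulr0 !addr0 mulr0.
Qed.

(** Two contact points are put at parameters 0 and infinity and a third at 1. The double contacts
    then determine the pullback up to a scalar, and with it the Gram matrix of the form in this
    frame. *)
Theorem tt_conic_classification Q : tt_conics F Q ->
  exists2 N, similitude char_k N & Q = conic_points (W *m N).
Proof.
case=> q [hq ns eQ card6 im].
have [p [p_inj pP]] := card_enum (point0 k) card6.
have pQ i : (i < 6)%N -> (Q `&` zeros F) (p i) by move=> hi; apply/pP; exists i.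
have zq i : (i < 6)%N -> zeros q (p i) by move=> /pQ[]; rewrite {1}eQ.
have pn i j : (i < 6)%N -> (j < 6)%N -> i != j -> p i <> p j.
  by move=> hi hj /eqP ij /(p_inj _ _ hi hj).
have [x x0 ex] := ptP (p 0%N); have [y y0 ey] := ptP (p 1%N).
have xy : pt x <> pt y by rewrite -ex -ey; apply: pn.
have zx : zeros q (pt x) by rewrite -ex; apply: zq.
have zy : zeros q (pt y) by rewrite -ey; apply: zq.
have [M0 [d [uM0 d0 eq_q M0x M0y]]] :=
  conic_normal_form (two_neq0 char_k) hq ns x0 y0 xy zx zy.
have QM0 : Q = conic_points M0 by rewrite eQ eq_q zeros_conic_form.
have [s [t [st e2]]] : conic_points M0 (p 2%N) by rewrite -QM0; case: (pQ 2%N isT).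
have n10 : (1 != 0 :> k) || (0 != 0 :> k) by rewrite oner_neq0.
have n01 : (0 != 0 :> k) || (1 != 0 :> k) by rewrite oner_neq0 orbT.
have s0 : s != 0.
  apply/eqP => s0; apply: (pn 2%N 1%N) => //; rewrite e2 ey -M0y.
  by apply/(conic_point_eq uM0 st n01); rewrite s0 !mul0r.
have t0 : t != 0.
  apply/eqP => t0; apply: (pn 2%N 0%N) => //; rewrite e2 ex -M0x.
  by apply/(conic_point_eq uM0 st n10); rewrite t0 !mulr0.
(* Rescaling the parameter by [l] sends the third contact point to 1. *)
pose l := t / s; have l0 : l != 0 by rewrite mulf_neq0 ?invr_eq0.
have det : 1 * l - 0 * 0 != 0 :> k by rewrite mul1r mul0r subr0.
pose D := invmx W *m (M0 *m sym2 1 0 0 l).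
have WD : W *m D = M0 *m sym2 1 0 0 l by rewrite mulKVmx.
have uD : D \in unitmx by rewrite !unitmx_mul unitmx_inv uW uM0 sym2_unit.
have uM : W *m D \in unitmx by rewrite unitmx_mul uW.
have QD : Q = conic_points (W *m D) by rewrite WD conic_points_sym2.
pose d' := d * (1 * l - 0 * 0) ^+ 2.
have d'0 : d' != 0 by rewrite mulf_neq0 ?expf_neq0.
have q_D : q = d' *: conic_form (W *m D).
  by rewrite eq_q WD (conic_form_sym2 uM0 det) scalerA.
have MD (a b : k) : W *m D *m veronese a b = M0 *m veronese a (l * b).
  by rewrite WD -mulmxA sym2_veronese !mul1r !mul0r addr0 add0r.
have P1 : p 1%N = pt (W *m D *m veronese 0 1).
  by rewrite ey -M0y MD; apply/(conic_point_eq uM0) => //; rewrite ?mulr1 ?mul0r ?l0 ?orbT.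
have param i : (i < 6)%N -> i != 1%N -> exists r, p i = pt (W *m D *m veronese 1 r).
  move=> hi i1; have [s' [t' [st' ei]]] : conic_points (W *m D) (p i).
    by rewrite -QD; case: (pQ i hi).
  have s'0 : s' != 0.
    apply/eqP => s'0; apply: (pn i 1%N) => //; rewrite ei P1.
    by apply/(conic_point_eq uM st' n01); rewrite s'0 !mul0r.
  exists (t' / s'); rewrite ei; apply/(conic_point_eq uM st'); rewrite ?oner_neq0 //.
  by rewrite mul1r mulrC mulfVK.
have /boolp.choice[r hr] : forall i, exists r, (i < 6)%N -> i != 1%N ->
    p i = pt (W *m D *m veronese 1 r).
  move=> i; have [hi|] := boolP (i < 6)%N; last by exists 0.
  have [->|i1] := eqVneq i 1%N; first by exists 0.
  by have [r hr] := param i hi i1; exists r.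
have n1 z : (1 != 0 :> k) || (z != 0 :> k) by rewrite oner_neq0.
have r0 : r 0%N = 0.
  have := hr 0%N isT isT; rewrite ex -M0x -[in LHS](mulr0 l) -MD.
  by move/(conic_point_eq uM (n1 _) (n1 _)); rewrite !mul1r.
have r2 : r 2%N = 1.
  have : p 2%N = pt (W *m D *m veronese 1 1).
    rewrite e2 MD; apply/(conic_point_eq uM0 st (n1 _)).
    by rewrite mulr1 mul1r /l mulrC mulfVK.
  rewrite (hr 2%N isT isT) => /(conic_point_eq uM (n1 _) (n1 _)).
  by rewrite !mul1r.
pose idx := [:: 0; 2; 3; 4; 5]%N.
have idxP i : i \in idx -> (i < 6)%N /\ i != 1%N.
  by rewrite !inE => /or4P[|||/orP[]] /eqP ->.
have r_inj : {in idx &, injective r}.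
  move=> i j /idxP[hi i1] /idxP[hj j1] e; apply: p_inj => //.
  by rewrite (hr i) // (hr j) // e.
have imD i : (i < 6)%N -> intersection_multiplicity (p i) q F 2.
  by move=> hi; apply: im; apply: pQ.
have [T22 T12] := double_infinity char_k uW c0 d'0 uD q_D P1 (imD 1%N isT).
have [z z0 ez] : exists2 z, z != 0 &
    pullback (curve_param (e := 2) (W *m D)) F = z *: ('X^5 - 'X) ^+ 2.
  apply: (pullback_double_quintic (rs := map r idx)) => //.
  - by rewrite map_inj_in_uniq.
  - by rewrite /= r0 mem_head.
  - by rewrite /= r2 !inE eqxx orbT.
  move=> _ /mapP[i /idxP[hi i1] ->].
  apply: (double_root d'0 uM q_D (hr i hi i1) (imD i hi)).
  exact: pullback_herm_neq0.
have eT := similitude_of_pullback uD ez.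
(* The multiplier [z / c] need not lie in F_5. Scaling [D] by [m] multiplies it by [m ^ 6], so a
   sixth root normalizes it to 1. *)
have [m hm] := root_exists (z / c)^-1 (isT : (0 < 6)%N).
have m0 : m != 0.
  apply: contraTneq (oner_neq0 k) => m0; rewrite negbK.
  move/eqP: hm; rewrite m0 expr0n /= eq_sym invr_eq0 mulf_eq0 (negbTE z0) /=.
  by rewrite invr_eq0 (negbTE c0).
exists (m *: D); last by rewrite QD -scalemxAr conic_pointsZ.
exists 1; rewrite oner_neq0 expr1n; split=> //.
rewrite linearZ /= frob_scale -!scalemxAl -scalemxAr scalerA eT scalerA -exprS hm.
by rewrite mulVf // mulf_neq0 ?invr_eq0.
Qed.

End Classification2.

(** * Coordinates over F_25 *)

(** An enumerated type lets the finite checks evaluate the field operations by pattern matching. *)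
Inductive F5 := f0 | f1 | f2 | f3 | f4.

Definition succ5 x := match x with f0 => f1 | f1 => f2 | f2 => f3 | f3 => f4 | f4 => f0 end.
Definition pred5 x := match x with f0 => f4 | f1 => f0 | f2 => f1 | f3 => f2 | f4 => f3 end.
Definition opp5 x := match x with f0 => f0 | f1 => f4 | f2 => f3 | f3 => f2 | f4 => f1 end.
Definition double5 x := match x with f0 => f0 | f1 => f2 | f2 => f4 | f3 => f1 | f4 => f3 end.
Definition inv5 x := match x with f2 => f3 | f3 => f2 | _ => x end.
Definition add5 x y := match x with
  f0 => y | f1 => succ5 y | f2 => succ5 (succ5 y) | f3 => pred5 (pred5 y) | f4 => pred5 y end.
Definition mul5 x y := match x with
  f0 => f0 | f1 => y | f2 => double5 y | f3 => opp5 (double5 y) | f4 => opp5 y end.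
Definition eq5 x y := match x, y with
  f0, f0 | f1, f1 | f2, f2 | f3, f3 | f4, f4 => true | _, _ => false end.

(* [(a, b)] stands for [a + b * theta] with [theta ^ 2 = 2]. *)
Definition F25 : Type := F5 * F5.
Definition nat5 (x : F5) : F25 := (x, f0).
Definition zero25 : F25 := (f0, f0).
Definition one25 : F25 := (f1, f0).
Definition add25 (x y : F25) : F25 :=
  let: (a, b) := x in let: (c, d) := y in (add5 a c, add5 b d).
Definition opp25 (x : F25) : F25 := let: (a, b) := x in (opp5 a, opp5 b).
Definition mul25 (x y : F25) : F25 :=
  let: (a, b) := x in let: (c, d) := y in
  (add5 (mul5 a c) (double5 (mul5 b d)), add5 (mul5 a d) (mul5 b c)).
(** The Frobenius map, because [theta ^ 5 = 4 theta = - theta]. *)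
Definition conj25 (x : F25) : F25 := let: (a, b) := x in (a, opp5 b).
Definition inv25 (x : F25) : F25 := let: (a, b) := x in
  let n := inv5 (add5 (mul5 a a) (opp5 (double5 (mul5 b b)))) in
  (mul5 a n, opp5 (mul5 b n)).
Definition eq25 (x y : F25) := let: (a, b) := x in let: (c, d) := y in
  if eq5 a c then eq5 b d else false.
Definition all5 := [:: f0; f1; f2; f3; f4].
Definition all25 : seq F25 := [seq (a, b) | a <- all5, b <- all5].

Definition vec : Type := F25 * F25 * F25.
Definition mat : Type := vec * vec * vec.
Definition dot (u v : vec) := let: (u0, u1, u2) := u in let: (v0, v1, v2) := v in
  add25 (add25 (mul25 u0 v0) (mul25 u1 v1)) (mul25 u2 v2).
Definition matv (A : mat) (v : vec) : vec :=
  let: (r0, r1, r2) := A in (dot r0 v, dot r1 v, dot r2 v).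
Definition trm (A : mat) : mat :=
  let: ((a, b, c), (d, e, f), (g, h, i)) := A in ((a, d, g), (b, e, h), (c, f, i)).
Definition mulm (A B : mat) : mat :=
  let: (c0, c1, c2) := trm B in
  let r u : vec := (dot u c0, dot u c1, dot u c2) in
  let: (r0, r1, r2) := A in (r r0, r r1, r r2).
Definition mapm (f : F25 -> F25) (A : mat) : mat :=
  let: ((a, b, c), (d, e, g), (h, i, j)) := A in
  ((f a, f b, f c), (f d, f e, f g), (f h, f i, f j)).
Definition diagm a b c : mat :=
  ((a, zero25, zero25), (zero25, b, zero25), (zero25, zero25, c)).
Definition idm := diagm one25 one25 one25.
Definition hermm : mat :=
  ((zero25, zero25, one25), (zero25, (f3, f0), zero25), (one25, zero25, zero25)).

Definition eqv (u v : vec) := let: (u0, u1, u2) := u in let: (v0, v1, v2) := v in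
  if eq25 u0 v0 then if eq25 u1 v1 then eq25 u2 v2 else false else false.

Lemma eq5P : Equality.axiom eq5.
Proof. by case; case; constructor. Qed.
HB.instance Definition _ := hasDecEq.Build F5 eq5P.

Lemma eq25E (x y : F25) : eq25 x y = (x == y).
Proof.
case: x y => [a b] [c d]; rewrite /= xpair_eqE.
by rewrite -[eq5 a c]/(a == c) -[eq5 b d]/(b == d); case: (a == c).
Qed.

Lemma eqvE (u v : vec) : eqv u v = (u == v).
Proof.
case: u v => [[a b] c] [[d e] f] /=; rewrite !eq25E.
by rewrite !xpair_eqE; case: (a == d); case: (b == e).
Qed.

Section Embedding.
Variable k : closedFieldType.
Hypothesis char_k : 5%N \in [pchar k].
Variable theta : k.
Hypothesis theta2 : theta ^+ 2 = 2%:R.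

Definition nat_of5 (x : F5) : nat :=
  match x with f0 => 0 | f1 => 1 | f2 => 2 | f3 => 3 | f4 => 4 end.
Definition e5 x : k := (nat_of5 x)%:R.

Lemma natr_mod5 n : (n %% 5)%:R = n%:R :> k.
Proof.
by rewrite {2}(divn_eq n 5) natrD natrM (five_eq0 char_k) mulr0 add0r.
Qed.

Lemma e5D x y : e5 (add5 x y) = e5 x + e5 y.
Proof. by rewrite /e5 -natrD -[RHS]natr_mod5; congr _%:R; case: x; case: y. Qed.

Lemma e5M x y : e5 (mul5 x y) = e5 x * e5 y.
Proof. by rewrite /e5 -natrM -[RHS]natr_mod5; congr _%:R; case: x; case: y. Qed.

Lemma e5_double x : e5 (double5 x) = 2%:R * e5 x.
Proof. by rewrite /e5 -natrM -[RHS]natr_mod5; congr _%:R; case: x. Qed.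

Lemma e5N x : e5 (opp5 x) = - e5 x.
Proof.
apply/eqP; rewrite -addr_eq0 -e5D; apply/eqP.
by case: x.
Qed.

Lemma e5V x : e5 x != 0 -> e5 (inv5 x) * e5 x = 1.
Proof.
case: x => [|_|_|_|_]; rewrite ?eqxx // -e5M //=; exact: mulr1n.
Qed.

Lemma e5_frob x : e5 x ^+ 5 = e5 x.
Proof. exact: frob_nat. Qed.

Lemma e5_eq0 x : (e5 x == 0) = (x == f0).
Proof.
apply/eqP/eqP => [|->] //; rewrite -[RHS]/(e5 f0) => e.
have : nat_of5 x = nat_of5 f0 by apply: (nat_inj5 char_k) e; case: (x).
by case: x {e}.
Qed.

Definition e25 (x : F25) : k := e5 x.1 + e5 x.2 * theta.

Lemma e25_0 : e25 zero25 = 0.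
Proof. by rewrite /e25 /= mul0r addr0. Qed.

Lemma e25_1 : e25 one25 = 1.
Proof. by rewrite /e25 /= mul0r addr0. Qed.

Lemma e25_nat x : e25 (nat5 x) = e5 x.
Proof. by rewrite /e25 /= mul0r addr0. Qed.

Lemma e25D x y : e25 (add25 x y) = e25 x + e25 y.
Proof. by case: x y => [a b] [c d]; rewrite /e25 /= !e5D; ring. Qed.

Lemma e25N x : e25 (opp25 x) = - e25 x.
Proof. by case: x => [a b]; rewrite /e25 /= !e5N; ring. Qed.

Lemma e25M x y : e25 (mul25 x y) = e25 x * e25 y.
Proof.
case: x y => [a b] [c d]; rewrite /e25 /= !(e5D, e5_double, e5M) -theta2; ring.
Qed.

Lemma theta5 : theta ^+ 5 = - theta.
Proof.
have -> : theta ^+ 5 = (theta ^+ 2) ^+ 2 * theta by ring.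
rewrite theta2; apply: (@eq_mod5 _ char_k _ _ theta); ring.
Qed.

Lemma e25_frob x : e25 x ^+ 5 = e25 (conj25 x).
Proof.
case: x => [a b]; rewrite -(frobE char_k) rmorphD rmorphM /= !frobE.
by rewrite theta5 !e5_frob /e25 /= e5N; ring.
Qed.

(** 2 is not a square modulo 5, so the norm [a ^ 2 - 2 b ^ 2] is anisotropic. *)
Lemma norm5_eq0 a b : add5 (mul5 a a) (opp5 (double5 (mul5 b b))) = f0 ->
  (a, b) = zero25.
Proof. by case: a; case: b. Qed.

Lemma e25V x : x != zero25 -> e25 (inv25 x) * e25 x = 1.
Proof.
case: x => [a b] x0; set n := add5 (mul5 a a) (opp5 (double5 (mul5 b b))).
have n0 : e5 n != 0 by rewrite e5_eq0; apply: contra_neq x0 => /norm5_eq0.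
rewrite -(e5V n0) /e25 /= -/n {3}/n !(e5D, e5N, e5_double, e5M) -theta2; ring.
Qed.

Lemma e25_eq0 x : (e25 x == 0) = (x == zero25).
Proof.
apply/eqP/eqP => [e|->]; last exact: e25_0.
apply/eqP; apply: contraTT (oner_neq0 k) => /e25V <-.
by rewrite e mulr0 negbK.
Qed.

Lemma e25_inj : injective e25.
Proof.
move=> x y e; have : e25 (add25 x (opp25 y)) == 0 by rewrite e25D e25N e subrr.
rewrite e25_eq0 => /eqP; case: x y {e} => [a b] [c d] [].
by case: a; case: c => //; case: b; case: d.
Qed.

Lemma e25_inv x : x != zero25 -> e25 (inv25 x) = (e25 x)^-1.
Proof.
move=> x0; have e0 : e25 x != 0 by rewrite e25_eq0.
by apply: (mulIf e0); rewrite e25V // mulVf.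
Qed.

Lemma all25P x : x \in all25.
Proof. by case: x => [[] []]. Qed.

(* A polynomial of degree 25 has no other roots than the 25 elements of F_25. *)
Lemma e25_surj (x : k) : (x ^+ 5) ^+ 5 = x -> exists y, x = e25 y.
Proof.
move=> hx; pose p : {poly k} := 'X^25 - 'X.
have sp : size p = 26%N.
  by rewrite /p size_polyDl ?size_polyXn // size_polyN size_polyX.
have p0 : p != 0 by rewrite -size_poly_eq0 sp.
have rp y : (y ^+ 5) ^+ 5 = y -> root p y.
  by move=> e; rewrite /root /p !hornerE subr_eq0 -{2}e -exprM.
have [/mapP[y _ ->]|nx] := boolP (x \in map e25 all25); first by exists y.
have : (size (x :: map e25 all25) < size p)%N.
  apply: (max_poly_roots p0).
    apply/allP => y; rewrite inE => /orP[/eqP ->|/mapP[z _ ->]]; first exact: rp.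
    by apply: rp; rewrite !e25_frob; case: z => [[] []].
  by rewrite cons_uniq nx (map_inj_uniq e25_inj).
by rewrite sp.
Qed.

Definition ev (v : vec) : 'cV[k]_3 :=
  let: (x, y, z) := v in cv3 (e25 x) (e25 y) (e25 z).

Definition em (A : mat) : 'M[k]_3 :=
  let: ((a, b, c), (d, e, f), (g, h, i)) := A in
  mx33 (e25 a) (e25 b) (e25 c) (e25 d) (e25 e) (e25 f) (e25 g) (e25 h) (e25 i).

Lemma ev_inj : injective ev.
Proof.
move=> [[x y] z] [[x' y'] z'] /colP e; have := e o0; have := e o1; have := e o2.
by rewrite !mxE /= => /e25_inj -> /e25_inj -> /e25_inj ->.
Qed.

Lemma ev_surj (x : 'cV[k]_3) : (forall i, (x i 0 ^+ 5) ^+ 5 = x i 0) ->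
  exists v, x = ev v.
Proof.
move=> h; have [a ea] := e25_surj (h o0); have [b eb] := e25_surj (h o1).
have [d ed] := e25_surj (h o2); exists (a, b, d).
by rewrite [LHS]cv3_eta ea eb ed.
Qed.

Lemma em_matv A v : ev (matv A v) = em A *m ev v.
Proof.
case: A v => [[[[a b] c] [[d e] f]] [[g h] i]] [[x y] z].
by rewrite mul_mx33_cv /= !(e25D, e25M).
Qed.

Lemma em_mulm A B : em (mulm A B) = em A *m em B.
Proof.
case: A B => [[[[a b] c] [[d e] f]] [[g h] i]] [[[[a' b'] c'] [[d' e'] f']] [[g' h'] i']].
by rewrite mul_mx33 /= !(e25D, e25M).
Qed.

Lemma em_trm A : em (trm A) = (em A)^T.
Proof. by case: A => [[[[a b] c] [[d e] f]] [[g h] i]]; rewrite tr_mx33. Qed.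

Lemma em_conj A : em (mapm conj25 A) = map_mx (pFrobenius_aut char_k) (em A).
Proof.
case: A => [[[[a b] c] [[d e] f]] [[g h] i]].
by rewrite (map_mx33 (pFrobenius_aut char_k)) /= !frobE !e25_frob.
Qed.

Lemma em_hermm : em hermm = herm_mx k.
Proof.
rewrite /= !e25_0 !e25_1; congr mx33; rewrite (e25_nat f3); apply/eqP.
by rewrite -subr_eq0 opprK -[2%:R]/(e5 f2) -e5D.
Qed.

Lemma em_idm : em idm = 1%:M.
Proof.
rewrite /= !e25_0 !e25_1; apply/matrixP => i j; rewrite !mxE.
by move: i j; apply: ord3P; apply: ord3P.
Qed.

Lemma dotE u v : e25 (dot u v) = ((ev u)^T *m ev v) 0 0.
Proof.
case: u v => [[u0 u1] u2] [[v0 v1] v2].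
by rewrite mxE sum3 !mxE /= !(e25D, e25M).
Qed.

End Embedding.

(** * Isotropic points over F_25 *)

Definition isz (x : F25) := eq25 x zero25.

(** The representative with last nonzero coordinate 1. The zero vector is sent to [(1, 0, 0)], hence
    the nonzero hypotheses in its specification. *)
Definition normv (v : vec) : vec := let: (x, y, z) := v in
  if isz z then if isz y then (one25, zero25, zero25)
    else (mul25 (inv25 y) x, one25, zero25)
  else (mul25 (inv25 z) x, mul25 (inv25 z) y, one25).

Definition zerov : vec := (zero25, zero25, zero25).
Definition conjv (v : vec) : vec :=
  let: (x, y, z) := v in (conj25 x, conj25 y, conj25 z).
Definition herm25 (v : vec) := dot v (matv hermm (conjv v)).

Definition inf25 : vec := (one25, zero25, zero25).
(** On the line [z = 0] the form is [- 2 y ^ 6], so [inf25] is the only isotropic point outside this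
    affine chart. *)
Definition affine25 : seq vec :=
  [seq v <- [seq (a, b, one25) | b <- all25, a <- all25] | isz (herm25 v)].
Definition points25 := inf25 :: affine25.

(** The contact points of the standard conic, in the order of [line5]. *)
Definition base6 : seq vec :=
  rcons [seq (one25, nat5 t, nat5 (mul5 t t)) | t <- all5] (zero25, zero25, one25).
Definition six (A : mat) : seq vec := [seq normv (matv A v) | v <- base6].

Definition eqm (A B : mat) : bool :=
  let: (a, b, c) := A in let: (a', b', c') := B in [&& eqv a a', eqv b b' & eqv c c'].
Definition hermitian25 (A : mat) : mat := mulm (trm A) (mulm hermm (mapm conj25 A)).
Definition simil25 (A : mat) : bool :=
  has (fun g => eqm (hermitian25 A) (mapm (mul25 (nat5 g)) hermm)) [:: f1; f2; f3; f4].

Section Frames.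
Variable k : closedFieldType.
Hypothesis char_k : 5%N \in [pchar k].
Variable theta : k.
Hypothesis theta2 : theta ^+ 2 = 2%:R.
Local Notation e25 := (e25 theta).
Local Notation ev := (ev theta).
Local Notation em := (em theta).
Local Notation frob := (map_mx (pFrobenius_aut char_k)).
Local Notation J := (herm_mx k).

Lemma iszE x : isz x = (e25 x == 0).
Proof. by rewrite /isz eq25E (e25_eq0 char_k theta2). Qed.

Lemma ev_eq0 v : (ev v == 0) = (v == zerov).
Proof.
have e0 : ev zerov = 0.
  by apply/colP; apply: ord3P; rewrite !mxE /= e25_0.
by rewrite -(inj_eq (ev_inj char_k theta2)) e0.
Qed.

Lemma normvE v : v != zerov -> exists2 d : k, d != 0 & ev (normv v) = d *: ev v.
Proof.
case: v => [[x y] z] v0 /=; rewrite !iszE.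
case: ifPn => [/eqP z0|z0]; last first.
  have nz : z != zero25 by rewrite -(e25_eq0 char_k theta2).
  exists (e25 z)^-1; first by rewrite invr_eq0.
  rewrite /= scale_cv3 !(e25M char_k theta2) // (e25_inv char_k theta2) // e25_1.
  by rewrite mulVf.
case: ifPn => [/eqP y0|y0]; last first.
  have ny : y != zero25 by rewrite -(e25_eq0 char_k theta2).
  exists (e25 y)^-1; first by rewrite invr_eq0.
  rewrite /= scale_cv3 !(e25M char_k theta2) // (e25_inv char_k theta2) // e25_1 e25_0.
  by rewrite mulVf // z0 mulr0.
have x0 : e25 x != 0.
  apply: contraNneq v0 => x0; rewrite -ev_eq0; apply/eqP/colP.
  by apply: ord3P; rewrite !mxE /= ?x0 ?y0 ?z0.
exists (e25 x)^-1; first by rewrite invr_eq0.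
by rewrite /= scale_cv3 e25_1 e25_0 mulVf // y0 z0 !mulr0.
Qed.

Lemma normv_eq u v c : c != 0 -> ev v = c *: ev u -> normv v = normv u.
Proof.
case: u v => [[x y] z] [[x' y'] z'] c0; rewrite scale_cv3 => /colP e.
have := e o0; have := e o1; have := e o2; rewrite !mxE /= => ez ey ex {e}.
rewrite !iszE ez mulf_eq0 (negbTE c0) ey mulf_eq0 (negbTE c0) /=.
have quo a b a' b' : e25 b != 0 -> e25 a' = c * e25 a -> e25 b' = c * e25 b ->
    mul25 (inv25 b') a' = mul25 (inv25 b) a.
  move=> b0 ea eb; apply: (e25_inj char_k theta2).
  have b'0 : e25 b' != 0 by rewrite eb mulf_neq0.
  rewrite !(e25M char_k theta2) !(e25_inv char_k theta2) -?(e25_eq0 char_k theta2) //.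
  by rewrite ea eb; field; rewrite b0 c0.
case: ifPn => [z0|z0]; last by rewrite (quo x z x' z') // (quo y z y' z').
by case: ifPn => // y0; rewrite (quo x y x' y').
Qed.

Lemma normvK v : v != zerov -> normv (normv v) = normv v.
Proof. by move=> /normvE[d d0 e]; apply: normv_eq e. Qed.

Lemma normv_neq0 v : v != zerov -> normv v != zerov.
Proof.
move=> v0; have [d d0 e] := normvE v0; rewrite -ev_eq0 e scaler_eq0 negb_or d0.
by rewrite ev_eq0.
Qed.

Definition normal v := (normv v == v) && (v != zerov).

Lemma evE x y z : ev (x, y, z) = cv3 (e25 x) (e25 y) (e25 z).
Proof. by []. Qed.

Lemma ev_base6 i : (i < 6)%N ->
  ev (nth zerov base6 i) = veronese (line5 k i).1 (line5 k i).2.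
Proof.
have h t : ev (one25, nat5 t, nat5 (mul5 t t)) = veronese 1 (e5 k t).
  by rewrite evE e25_1 !e25_nat (e5M char_k) /veronese expr1n mul1r.
case: i => [|[|[|[|[|[|//]]]]]] _.
- exact: (h f0).
- exact: (h f1).
- exact: (h f2).
- exact: (h f3).
- exact: (h f4).
change (ev (zero25, zero25, one25) = veronese 0 1).
by rewrite evE e25_0 e25_1 /veronese expr1n expr0n mul0r.
Qed.

Definition ptv (W : 'M[k]_3) v : ppoint k := pt (W *m ev v).

Lemma ptv_norm W v : v != zerov -> ptv W (normv v) = ptv W v.
Proof. by case/normvE=> d d0 e; rewrite /ptv e -scalemxAr pt_scale. Qed.

Lemma ptv_inj W u v : W \in unitmx -> normal u -> normal v ->
  ptv W u = ptv W v -> u = v.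
Proof.
move=> uW /andP[/eqP nu u0] /andP[/eqP nv v0] e.
have Wu : W *m ev u != 0 by apply: mulmx_unit_neq0; rewrite ?ev_eq0.
have Wv : W *m ev v != 0 by apply: mulmx_unit_neq0; rewrite ?ev_eq0.
have [c c0] := eq_pt Wu Wv e; rewrite scalemxAr => /(can_inj (mulKmx uW)) ev_v.
by rewrite -nu -nv (normv_eq c0 ev_v).
Qed.

Lemma matv_neq0 A v : em A \in unitmx -> v != zerov -> matv A v != zerov.
Proof.
move=> uA; rewrite -!ev_eq0 (em_matv char_k theta2).
exact: mulmx_unit_neq0.
Qed.

Lemma base6_neq0 i : (i < 6)%N -> nth zerov base6 i != zerov.
Proof. by case: i => [|[|[|[|[|[|//]]]]]]. Qed.

Lemma normal_six A v : em A \in unitmx -> v \in six A -> normal v.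
Proof.
move=> uA /mapP[u /(nthP zerov)[i hi <-] ->].
have n0 := matv_neq0 uA (base6_neq0 hi).
by rewrite /normal normvK // eqxx normv_neq0.
Qed.

Lemma hexad_six W A i : em A \in unitmx -> (i < 6)%N ->
  hexad (W *m em A) i = ptv W (nth zerov (six A) i).
Proof.
move=> uA hi; rewrite (nth_map zerov) // ptv_norm ?matv_neq0 ?base6_neq0 //.
by rewrite /ptv (em_matv char_k theta2) ev_base6 // mulmxA.
Qed.

Lemma hexad_image W A : em A \in unitmx ->
  hexad (W *m em A) @` [set` iota 0 6] = ptv W @` [set` six A].
Proof.
move=> uA; apply/seteqP; split=> [_ [i /mem_iota0 hi <-]|_ [v vA <-]].
  by exists (nth zerov (six A) i); [apply: mem_nth | rewrite -hexad_six].
have /(nthP zerov)[i hi <-] : v \in six A := vA.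
by exists i; [apply/mem_iota0 | rewrite hexad_six].
Qed.

Lemma six_uniq A : em A \in unitmx -> uniq (six A).
Proof.
move=> uA; apply/(uniqP zerov) => i j hi hj e.
by apply: (hexad_inj char_k uA); rewrite ?mem_iota // -[em A]mul1mx !hexad_six // e.
Qed.

Lemma em_scale x A : em (mapm (mul25 x) A) = e25 x *: em A.
Proof.
case: A => [[[[a b] d] [[f g] h]] [[i j] l]].
by rewrite scale_mx33 /= !(e25M char_k theta2).
Qed.

Lemma simil25P A : simil25 A -> similitude char_k (em A).
Proof.
case/hasP=> g g14; case e1 : (hermitian25 A) => [[r0 r1] r2]; rewrite /eqm.
case e2 : (mapm _ _) => [[s0 s1] s2] /and3P[]; rewrite !eqvE => /eqP h0 /eqP h1 /eqP h2.
have e : hermitian25 A = mapm (mul25 (nat5 g)) hermm by rewrite e1 e2 h0 h1 h2.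
have g0 : e5 k g != 0.
  by rewrite (e5_eq0 char_k); apply: contraTneq g14 => ->.
exists (e5 k g); split; [exact: g0 | exact: (e5_frob char_k) |].
rewrite -mulmxA -(em_hermm char_k theta) -(em_trm theta) -(em_conj char_k theta2).
rewrite -!(em_mulm char_k theta2) -/(hermitian25 A) e.
by rewrite em_scale e25_nat.
Qed.

End Frames.

(** * Similitudes moving the isotropic points *)

Definition origin25 : vec := (zero25, zero25, one25).

(* The unitary transvection fixing [inf25] and mapping [origin25] to [v]. *)
Definition unip (v : vec) : mat := let: (a, b, _) := v in
  ((one25, mul25 (f2, f0) (conj25 b), a), (zero25, one25, b), (zero25, zero25, one25)).
(** [diag(1, b, b ^ 6)]: up to scalars, these are the similitudes fixing the points [inf25] and
    [origin25], as [similitude_diag] shows; the multiplier is the norm [b ^ 6]. *)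
Definition torus b : mat :=
  diagm one25 b (mul25 b (mul25 b (mul25 b (mul25 b (mul25 b b))))).
Definition flip : mat :=
  ((zero25, zero25, one25), (zero25, one25, zero25), (one25, zero25, zero25)).
(** A similitude taking [inf25] to the isotropic point [v]; for such [v] a zero last coordinate
    means that [v] is the point [inf25] itself. *)
Definition transport (v : vec) : mat := let: (_, _, z) := v in
  if isz z then idm else mulm (unip v) flip.

(* Representatives of the quotient of the multiplicative groups of F_25 and F_5. *)
Definition reps25 : seq F25 := (f0, f1) :: [seq (f1, x) | x <- all5].

Opaque affine25.

Lemma points25P v : v \in points25 -> v = inf25 \/ v \in affine25.
Proof. by rewrite /points25; move: affine25 => s; rewrite in_cons => /predU1P. Qed.

Lemma unip_check : all (fun w => [&& simil25 (unip w),
  eqv (matv (unip w) inf25) inf25 & eqv (matv (unip w) origin25) w]) affine25.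
Proof. by vm_compute. Qed.

Lemma transport_check : all (fun p => simil25 (transport p) &&
  eqv (normv (matv (transport p) inf25)) p) points25.
Proof. by vm_compute. Qed.

Lemma torus_check : all (fun b => simil25 (torus b)) reps25.
Proof. by vm_compute. Qed.

Lemma reps25_check : all (fun b => isz b || has (fun g =>
  has (fun r => eq25 b (mul25 (nat5 g) r)) reps25) [:: f1; f2; f3; f4]) all25.
Proof. by vm_compute. Qed.

Section Decomposition.
Variable k : closedFieldType.
Hypothesis char_k : 5%N \in [pchar k].
Variable theta : k.
Hypothesis theta2 : theta ^+ 2 = 2%:R.
Local Notation e25 := (e25 theta).
Local Notation ev := (ev theta).
Local Notation em := (em theta).
Local Notation frob := (map_mx (pFrobenius_aut char_k)).
Local Notation J := (herm_mx k).

Lemma ev_inf25 : ev inf25 = veronese 1 0.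
Proof. by rewrite evE e25_0 e25_1 /veronese expr1n expr0n mulr0. Qed.

Lemma ev_origin25 : ev origin25 = veronese 0 1.
Proof. by rewrite evE e25_0 e25_1 /veronese expr1n expr0n mul0r. Qed.

Lemma herm25E v : e25 (herm25 v) = ((ev v)^T *m J *m frob (ev v)) 0 0.
Proof.
have -> : frob (ev v) = ev (conjv v).
  case: v => [[x y] z]; apply/colP; apply: ord3P; rewrite !mxE /= frobE;
    exact: e25_frob.
rewrite /herm25 (dotE char_k theta2) (em_matv char_k theta2) (em_hermm char_k).
by rewrite mulmxA.
Qed.

Lemma isotropic_point (x : 'cV[k]_3) : frob (frob x) = x -> x != 0 ->
  (x^T *m J *m frob x) 0 0 = 0 ->
  exists p, [/\ p \in points25 & exists2 l, l != 0 & x = l *: ev p].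
Proof.
move=> rx x0 hx; have [v ex] : exists v, x = ev v.
  apply: (ev_surj char_k theta2) => i; move/matrixP/(_ i 0): rx.
  by rewrite !mxE !frobE.
have v0 : v != zerov by rewrite -(ev_eq0 char_k theta2) -ex.
have [d d0 ed] := normvE char_k theta2 v0.
have ex' : x = d^-1 *: ev (normv v) by rewrite ed scalerA mulVf // scale1r.
exists (normv v); split; last by exists d^-1; rewrite ?invr_eq0.
have : e25 (herm25 (normv v)) = 0.
  rewrite herm25E ed -ex linearZ /= frob_scale -!scalemxAl -scalemxAr scalerA.
  by rewrite mxE hx mulr0.
move/eqP; rewrite (e25_eq0 char_k theta2) => h0.
have {ed ex ex' v0}:= normv_neq0 char_k theta2 v0.
case: v h0 => [[a b] z]; rewrite /normv; case: ifPn => [_|_] h0 _; last first.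
  rewrite in_cons mem_filter /isz eq25E h0 andTb; apply/orP; right.
  exact: (allpairs_f (fun b a => (a, b, one25)) (all25P _) (all25P _)).
move: h0; case: ifPn => [_ _|_ h0]; first exact: mem_head.
by move: (mul25 _ a) h0 => -[[] []].
Qed.

Lemma affine_unip w : w \in affine25 -> [/\ similitude char_k (em (unip w)),
  em (unip w) *m veronese 1 0 = veronese 1 0 & em (unip w) *m veronese 0 1 = ev w].
Proof.
move=> /(allP unip_check)/and3P[/(simil25P char_k theta2) s].
rewrite !eqvE => /eqP h1 /eqP h2; split=> //.
- by rewrite -{1}ev_inf25 -(em_matv char_k theta2) h1 ev_inf25.
- by rewrite -ev_origin25 -(em_matv char_k theta2) h2.
Qed.

Lemma points_transport p : p \in points25 -> similitude char_k (em (transport p)) /\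
  exists2 l, l != 0 & em (transport p) *m veronese 1 0 = l *: ev p.
Proof.
move=> /(allP transport_check)/andP[/(simil25P char_k theta2) s].
rewrite eqvE => /eqP h; split=> //.
have uT := similitude_unit s.
have n0 : matv (transport p) inf25 != zerov by apply: (matv_neq0 char_k theta2).
have [d d0] := normvE char_k theta2 n0; rewrite h (em_matv char_k theta2) ev_inf25 => e.
by exists d^-1; rewrite ?invr_eq0 // e scalerA mulVf // scale1r.
Qed.

Lemma reps25P b : b != zero25 -> exists g r,
  [/\ r \in reps25, e5 k g != 0 & e25 b = e5 k g * e25 r].
Proof.
move=> b0; have /orP[] := allP reps25_check b (all25P b).
  by rewrite /isz eq25E (negbTE b0).
case/hasP=> g g14 /hasP[r rr]; rewrite eq25E => /eqP eb; exists g, r; split=> //.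
  by rewrite (e5_eq0 char_k); apply: contraTneq g14 => ->.
by rewrite eb (e25M char_k theta2) e25_nat.
Qed.

Lemma similitude_frob N : similitude char_k N -> frob (frob N) = N.
Proof. by case=> g [g0 g5]; apply: frob_herm. Qed.

Lemma similitude_isotropic N (x : 'cV[k]_3) : similitude char_k N ->
  (x^T *m J *m frob x) 0 0 = 0 -> ((N *m x)^T *m J *m frob (N *m x)) 0 0 = 0.
Proof.
case=> g [g0 _ e] hx; rewrite trmx_mul map_mxM.
have -> : x^T *m N^T *m J *m (frob N *m frob x) =
    x^T *m (N^T *m J *m frob N) *m frob x by rewrite !mulmxA.
by rewrite e -scalemxAr -scalemxAl mxE hx mulr0.
Qed.

Lemma isotropic10 : ((veronese 1 0 : 'cV[k]_3)^T *m J *m frob (veronese 1 0)) 0 0 = 0.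
Proof.
have e : (1%:M : 'M[k]_3)^T *m J *m frob 1%:M = 1 *: J.
  by rewrite trmx1 mul1mx map_mx1 mulmx1 scale1r.
by have := herm_conic 1 0 e; rewrite /= mul1mx => ->; ring.
Qed.

Lemma isotropic01 : ((veronese 0 1 : 'cV[k]_3)^T *m J *m frob (veronese 0 1)) 0 0 = 0.
Proof.
have e : (1%:M : 'M[k]_3)^T *m J *m frob 1%:M = 1 *: J.
  by rewrite trmx1 mul1mx map_mx1 mulmx1 scale1r.
by have := herm_conic 0 1 e; rewrite /= mul1mx => ->; ring.
Qed.

(** Preservation of [J] clears the outer entries of the middle column, and comparing the two
    remaining kinds of entries gives [n11 ^ 6 = m l ^ 5], the origin of the exponent 6 in
    [torus]. *)
Lemma similitude_diag N l m : similitude char_k N -> l != 0 ->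
  N *m veronese 1 0 = l *: veronese 1 0 -> N *m veronese 0 1 = m *: veronese 0 1 ->
  exists2 b, (b != 0) && ((b ^+ 5) ^+ 5 == b) &
    N = l *: mx33 1 0 0 0 b 0 0 0 (b ^+ 6).
Proof.
move=> sN l0; have := similitude_frob sN; case: sN => g [g0 _].
rewrite [N]mx33_eta /veronese !mul_mx33_cv !scale_cv3.
move: (N o0 o0) (N o0 o1) (N o0 o2) (N o1 o0) (N o1 o1) (N o1 o2).
move: (N o2 o0) (N o2 o1) (N o2 o2) => n20 n21 n22 n00 n01 n02 n10 n11 n12.
rewrite !(map_mx33 (pFrobenius_aut char_k)) tr_mx33 !mul_mx33 scale_mx33 => eT rat.
move=> /colP c0 /colP c2.
have := c0 o0; have := c0 o1; have := c0 o2; have := c2 o0; have := c2 o1; have := c2 o2.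
rewrite !mxE /= !expr0n !expr1n /= !(mulr0, mul0r, mulr1, addr0, add0r).
move=> {c0 c2} e22 e12 e02 e20 e10 e00; subst.
move/matrixP: eT => eT; move/matrixP: rat => rat.
have := eT o0 o1; have := eT o2 o1; have := eT o1 o1; have := eT o2 o0.
have := rat o0 o0; have := rat o1 o1.
rewrite !mxE /= !frobE !(mulr0, mul0r, mulr1, mul1r, addr0, add0r).
move=> {eT rat} r11 rl e20 e11 e21 e01.
have m0 : m != 0 by apply: contraNneq g0 => m0; rewrite -e20 m0 mul0r.
have n01_0 : n01 = 0.
  by move/eqP: e21; rewrite mulf_eq0 (negbTE m0) expf_eq0 => /eqP.
have n21_0 : n21 = 0.
  by move/eqP: e01; rewrite mulf_eq0 (negbTE l0) expf_eq0 => /eqP.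
have e6 : n11 ^+ 6 = m * l ^+ 5.
  have n20 : - 2%:R != 0 :> k by rewrite oppr_eq0 (two_neq0 char_k).
  apply: (mulIf n20); rewrite e20 -e11 n01_0 n21_0; ring.
have n11_0 : n11 != 0.
  apply: contraNneq g0 => n0; rewrite -e20 -e6 n0 expr0n //.
exists (n11 / l).
  by rewrite mulf_neq0 ?invr_eq0 //= !expr_div_n r11 rl.
rewrite scale_mx33 n01_0 n21_0 expr_div_n e6; congr mx33; rewrite ?mulr0 ?mulr1 //.
- by rewrite mulrC mulfVK.
- by field.
Qed.

(** A factor of [b] in F_5 only rescales the parameter of the conic, so representatives of the units
    of F_25 modulo those of F_5 suffice. *)
Lemma torus_diag b r g : r \in reps25 -> b = e5 k g * e25 r -> e5 k g != 0 ->
  mx33 1 0 0 0 b 0 0 0 (b ^+ 6) = em (torus r) *m sym2 1 0 0 (e5 k g).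
Proof.
move=> rr -> g0; have g5 := e5_frob char_k g.
rewrite [RHS]mul_mx33 e25_0 e25_1 !(e25M char_k theta2).
move: (e25 r) (e5 k g) g5 {g0} => x y y5.
have y6 : y ^+ 6 = y ^+ 2 by rewrite exprS y5 -expr2.
rewrite exprMn y6; congr mx33; ring.
Qed.

(** The image of [(1 : 0)] gives [p], that of [(0 : 1)] gives [w] after transport back, and what
    remains fixes both points: a torus element up to a scalar and a reparametrization. A conic with
    two marked contact points thus runs over finite lists. *)
Lemma similitude_decomposition W N : W \in unitmx -> similitude char_k N ->
  exists p w b, [/\ p \in points25, w \in affine25 & b \in reps25] /\
  [/\ exists2 l, l != 0 & N *m veronese 1 0 = l *: ev p,
     exists2 l, l != 0 & N *m veronese 0 1 = l *: ev (matv (transport p) w)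
   & conic_points (W *m N) =
       conic_points (W *m em (mulm (transport p) (mulm (unip w) (torus b))))].
Proof.
move=> uW sN; have uN := similitude_unit sN.
have n10 : veronese 1 0 != 0 :> 'cV[k]_3 by apply: veronese_neq0; rewrite oner_neq0.
have n01 : veronese 0 1 != 0 :> 'cV[k]_3 by apply: veronese_neq0; rewrite oner_neq0 orbT.
have fv s t : s ^+ 5 = s -> t ^+ 5 = t -> frob (veronese s t) = veronese s t.
  by move=> hs ht; rewrite frob_veronese hs ht.
have v10 := fv 1 0 (expr1n _ _) (expr0n _ _).
have v01 := fv 0 1 (expr0n _ _) (expr1n _ _).
have iso N' s t : similitude char_k N' -> veronese s t != 0 :> 'cV[k]_3 ->
    frob (veronese s t) = veronese s t ->
    ((veronese s t)^T *m J *m frob (veronese s t)) 0 0 = 0 ->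
    exists p, [/\ p \in points25 & exists2 l, l != 0 & N' *m veronese s t = l *: ev p].
  move=> sN' v0 fr h; apply: isotropic_point.
  - by rewrite !map_mxM !fr similitude_frob.
  - by apply: mulmx_unit_neq0 => //; apply: similitude_unit sN'.
  - exact: similitude_isotropic.
have [p [pp [l l0 Np]]] := iso N 1 0 sN n10 v10 isotropic10.
have [sK [l1 l10 Kp]] := points_transport pp; set K := em (transport p) in sK Kp.
have uK := similitude_unit sK.
have sN1 := similitudeM (similitudeV sK) sN; set N1 := invmx K *m N in sN1.
have N1_10 : N1 *m veronese 1 0 = (l / l1) *: veronese 1 0.
  rewrite /N1 -mulmxA Np -[ev p](scalerK l10) -Kp.
  by rewrite !(scalemxAr, scalerA) -!scalemxAr mulKmx.
have ll0 : l / l1 != 0 by rewrite mulf_neq0 ?invr_eq0.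
have [w [wp [m m0 N1w]]] := iso N1 0 1 sN1 n01 v01 isotropic01.
(* If [w] were [inf25], the invertible [N1] would send two independent vectors to proportional
   ones. *)
have wa : w \in affine25.
  have [ew|] := points25P wp; last exact.
  exfalso.
  have : N1 *m ((l / l1) *: veronese 0 1 - m *: veronese 1 0) = 0.
    by rewrite mulmxBr -!scalemxAr N1w N1_10 ew ev_inf25 !scalerA mulrC subrr.
  move/(congr1 (mulmx (invmx N1))); rewrite mulKmx ?similitude_unit // mulmx0.
  move/colP/(_ o2); rewrite !mxE /= expr1n expr0n mulr1 mulr0 subr0 => e.
  by move: ll0; rewrite e eqxx.
have [sU U10 U01] := affine_unip wa; set U := em (unip w) in sU U10 U01.
have uU := similitude_unit sU.
have sN2 := similitudeM (similitudeV sU) sN1; set N2 := invmx U *m N1 in sN2.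
have N2_10 : N2 *m veronese 1 0 = (l / l1) *: veronese 1 0.
  by rewrite /N2 -mulmxA N1_10 -scalemxAr -{1}U10 mulKmx.
have N2_01 : N2 *m veronese 0 1 = m *: veronese 0 1.
  by rewrite /N2 -mulmxA N1w -scalemxAr -U01 mulKmx.
have [b /andP[b0 /eqP b25] eN2] := similitude_diag sN2 ll0 N2_10 N2_01.
have [x ex] := e25_surj char_k theta2 b25.
have x0 : x != zero25 by rewrite -(e25_eq0 char_k theta2) -ex.
have [g [r [rr g0 er]]] := reps25P x0.
exists p, w, r; split=> //; split.
- by exists l.
- exists m => //; rewrite (em_matv char_k theta2) -/K scalemxAr -N1w /N1.
  by rewrite !mulmxA mulmxV // mul1mx.
have -> : N = (l / l1) *: (K *m (U *m em (torus r)) *m sym2 1 0 0 (e5 k g)).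
  rewrite -mulmxA -mulmxA -(torus_diag rr (etrans ex er) g0).
  by rewrite !scalemxAr -eN2 /N2 mulKVmx // /N1 mulKVmx.
rewrite -scalemxAr conic_pointsZ // (mulmxA W) conic_points_sym2.
  by rewrite !(em_mulm char_k theta2).
by rewrite mul1r mul0r subr0.
Qed.

End Decomposition.

Fixpoint pairs (T : Type) (s : seq T) : seq (T * T) :=
  if s is x :: s' then [seq (x, y) | y <- s'] ++ pairs s' else [::].

Lemma mem_pairs (T : eqType) (s : seq T) x y : uniq s -> (x, y) \in pairs s ->
  [/\ x \in s, y \in s & x != y].
Proof.
elim: s => [|z s IH] //= /andP[zs us]; rewrite mem_cat => /orP[/mapP[t ts [-> ->]]|].
  by rewrite mem_head in_cons ts orbT; split=> //; apply: contraNneq zs => ->.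
by case/(IH us)=> xs ys xy; rewrite !in_cons xs ys !orbT.
Qed.

Lemma pairs_complete (T : eqType) (s : seq T) x y : x \in s -> y \in s -> x != y ->
  ((x, y) \in pairs s) || ((y, x) \in pairs s).
Proof.
elim: s => [|z s IH] //=; rewrite !in_cons !mem_cat.
move=> /predU1P[->|xs] /predU1P[->|ys] xy.
- by rewrite eqxx in xy.
- by rewrite (map_f (fun t => (z, t))).
- by rewrite (map_f (fun t => (z, t)) xs) ?orbT.
by case/orP: (IH xs ys xy) => ->; rewrite !orbT.
Qed.

Definition cross (u v : vec) : vec :=
  let: (u0, u1, u2) := u in let: (v0, v1, v2) := v in
  let m a b c d := add25 (mul25 a b) (opp25 (mul25 c d)) in
  (m u1 v2 u2 v1, m u2 v0 u0 v2, m u0 v1 u1 v0).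

Definition secants25 (A : mat) : seq vec :=
  [seq normv (cross uv.1 uv.2) | uv <- pairs (six A)].

(** * Special secants *)

Section Lines.
Variable k : closedFieldType.
Implicit Types u x y : 'cV[k]_3.

Definition dual_space u : {vspace 'rV[k]_3} := lker (linfun (mulmxr u : 'rV[k]_3 -> 'M_1)).

Lemma mem_dual_space u (v : 'rV_3) : (v \in dual_space u) = (v *m u == 0).
Proof. by rewrite memv_ker lfunE. Qed.

Lemma dim_dual_space u : u != 0 -> \dim (dual_space u) == 2%N.
Proof.
move=> u0; have := limg_ker_dim (linfun (mulmxr u : 'rV[k]_3 -> 'M_1)) fullv.
rewrite capfv -/(dual_space u).
have -> : \dim {:'rV[k]_3} = 3%N by rewrite dimvf.
suff -> : \dim (linfun (mulmxr u : 'rV[k]_3 -> 'M_1) @: fullv) = 1%N.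
  by rewrite addn1 => -[->].
apply/eqP; rewrite eqn_leq; apply/andP; split.
  by apply: leq_trans (dimvS (subvf _)) _; rewrite dimvf.
rewrite lt0n dimv_eq0; apply: contra u0 => /eqP im0; apply/eqP.
apply/matrixP => i j; rewrite ord1.
have : linfun (mulmxr u : 'rV[k]_3 -> 'M_1) (delta_mx 0 i) \in 0%VS.
  by rewrite -im0 memv_img // memvf.
by rewrite memv0 lfunE /= -rowE => /eqP/matrixP/(_ 0 0); rewrite !mxE.
Qed.

Lemma line0_proof : \dim (dual_space (delta_mx o0 0)) == 2%N.
Proof.
apply: dim_dual_space; apply/eqP => /matrixP/(_ o0 0).
by rewrite !mxE /= => /eqP; rewrite oner_eq0.
Qed.

Definition line0 : pline k := Sub (dual_space (delta_mx o0 0%R)) line0_proof.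

Definition dual_line u : pline k := insubd line0 (dual_space u).

Lemma val_dual_line u : u != 0 -> val (dual_line u) = dual_space u.
Proof. by move=> u0; rewrite insubdK // unfold_in dim_dual_space. Qed.

Lemma on_dual_line u x : u != 0 -> x != 0 ->
  on_line (pt x) (dual_line u) <-> (x^T *m u) 0 0 = 0.
Proof.
move=> u0 x0; rewrite /on_line val_pt // val_dual_line // -memvE mem_dual_space.
split=> [/eqP ->|e]; first by rewrite mxE.
by apply/eqP/matrixP => i j; rewrite !ord1 e mxE.
Qed.

Lemma line_unique (P P' : ppoint k) (L L' : pline k) : P <> P' ->
  on_line P L -> on_line P' L -> on_line P L' -> on_line P' L' -> L = L'.
Proof.
move=> PP' h1 h2 h3 h4.
have d2 : (2 <= \dim (val P + val P'))%N.
  rewrite ltnNge; apply/negP => d1; apply: PP'; apply: val_inj.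
  have eqd (U : ppoint k) : (val U <= val P + val P')%VS -> val U = (val P + val P')%VS.
    by move=> s; apply/eqP; rewrite eqEdim s (eqP (valP U)).
  exact: etrans (eqd P (addvSl _ _)) (esym (eqd P' (addvSr _ _))).
have eqL (M : pline k) : on_line P M -> on_line P' M -> val M = (val P + val P')%VS.
  move=> h h'; apply/eqP; rewrite eq_sym eqEdim subv_add; apply/andP; split.
    by apply/andP.
  by rewrite (eqP (valP M)).
by apply: val_inj; rewrite (eqL L) // (eqL L').
Qed.

Lemma cross_proportional (u v : 'cV[k]_3) : u != 0 -> v != 0 ->
  u o1 0 * v o0 0 = u o0 0 * v o1 0 -> u o2 0 * v o0 0 = u o0 0 * v o2 0 ->
  u o2 0 * v o1 0 = u o1 0 * v o2 0 -> exists2 c : k, c != 0 & v = c *: u.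
Proof.
move=> u0 v0 z01 z02 z12.
suff [c ec] : exists c : k, v = c *: u.
  exists c; last exact: ec.
  by move: v0; rewrite ec; apply: contraNneq => ->; rewrite scale0r.
have [u00|u00] := eqVneq (u o0 0) 0; last first.
  exists (v o0 0 / u o0 0); apply/colP; apply: ord3P; rewrite mxE; apply: (mulfI u00).
  - by field.
  - by rewrite -z01; field.
  - by rewrite -z02; field.
have [u10|u10] := eqVneq (u o1 0) 0; last first.
  exists (v o1 0 / u o1 0); apply/colP; apply: ord3P; rewrite mxE; apply: (mulfI u10).
  - by rewrite z01; field.
  - by field.
  - by rewrite -z12; field.
have u20 : u o2 0 != 0.
  apply: contraNneq u0 => u20; apply/eqP/colP.
  by apply: ord3P; rewrite mxE.
exists (v o2 0 / u o2 0); apply/colP; apply: ord3P; rewrite mxE; apply: (mulfI u20).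
- by rewrite z02; field.
- by rewrite z12; field.
- by field.
Qed.

Lemma dual_line_inj (u v : 'cV[k]_3) : u != 0 -> v != 0 -> dual_line u = dual_line v ->
  exists2 c : k, c != 0 & v = c *: u.
Proof.
move=> u0 v0 /(congr1 val); rewrite !val_dual_line // => e.
have z (a b d : k) : a * u o0 0 + b * u o1 0 + d * u o2 0 = 0 ->
    a * v o0 0 + b * v o1 0 + d * v o2 0 = 0.
  move=> h; have : (cv3 a b d)^T \in dual_space v.
    rewrite -e mem_dual_space; apply/eqP/matrixP => i j.
    by rewrite !ord1 !mxE sum3 !mxE.
  by rewrite mem_dual_space => /eqP/matrixP/(_ 0 0); rewrite !mxE sum3 !mxE.
have z01 : u o1 0 * v o0 0 = u o0 0 * v o1 0.
  have := z (u o1 0) (- u o0 0) 0; rewrite !mul0r !addr0 !mulNr => h.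
  by apply/eqP; rewrite -subr_eq0; apply/eqP/h; ring.
have z02 : u o2 0 * v o0 0 = u o0 0 * v o2 0.
  have := z (u o2 0) 0 (- u o0 0); rewrite !mul0r !addr0 !mulNr => h.
  by apply/eqP; rewrite -subr_eq0; apply/eqP/h; ring.
have z12 : u o2 0 * v o1 0 = u o1 0 * v o2 0.
  have := z 0 (u o2 0) (- u o1 0); rewrite !mul0r !add0r !mulNr => h.
  by apply/eqP; rewrite -subr_eq0; apply/eqP/h; ring.
exact: cross_proportional.
Qed.

End Lines.

Lemma sesqui_regroup (R : comNzRingType) (a t x y z : R) :
  t * (y * a * (x * z)) = y * t * x * (a * z).
Proof. by ring. Qed.

Section Secants.
Variable k : closedFieldType.
Hypothesis char_k : 5%N \in [pchar k].
Variable theta : k.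
Hypothesis theta2 : theta ^+ 2 = 2%:R.
Local Notation e25 := (e25 theta).
Local Notation ev := (ev theta).
Local Notation em := (em theta).
Local Notation ptv := (ptv theta).
Local Notation frob := (map_mx (pFrobenius_aut char_k)).
Local Notation J := (herm_mx k).
Variables (W : 'M[k]_3) (c : k).
Hypotheses (uW : W \in unitmx) (c0 : c != 0).
Local Notation F := (c *: herm_form W).

(** This is what allows any totally tangent conic to play the role of the standard one: passing to
    the frame [W *m N] only rescales the equation of the curve. *)
Lemma herm_form_frame N g : N^T *m J *m frob N = g *: J -> g != 0 ->
  herm_form W = g *: herm_form (W *m N).
Proof.
move=> e g0; have uN := similitude_eq_unit g0 e; pose Z := coord (W *m N).
have char_form : 5%N \in [pchar {mpoly k[3]}].
  by rewrite inE /= -mpolyC_nat (five_eq0 char_k) mpolyC0 eqxx.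
have e1 i : coord W i = \sum_a N i a *: Z a by apply: coord_mul.
have el5 j : coord W j ^+ 5 = \sum_b (N j b) ^+ 5 *: Z b ^+ 5.
  rewrite e1 -(pFrobenius_autE char_form) rmorph_sum; apply: eq_bigr => b _.
  by rewrite /= pFrobenius_autE exprZn.
transitivity (\sum_i \sum_j \sum_a \sum_b
   (N i a * J i j * N j b ^+ 5) *: (Z a * Z b ^+ 5)).
  apply: eq_bigr => i _; apply: eq_bigr => j _; rewrite el5 e1 mulr_suml scaler_sumr.
  apply: eq_bigr => a _; rewrite mulr_sumr scaler_sumr; apply: eq_bigr => b _.
  move: (N j b ^+ 5) (Z b ^+ 5) (N i a) (J i j) => x z y t.
  rewrite -!mul_mpolyC !mpolyCM; move: x%:MP y%:MP t%:MP (Z a) => x' y' t' z'.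
  exact: sesqui_regroup.
under eq_bigr do rewrite exchange_big.
rewrite exchange_big scaler_sumr; apply: eq_bigr => a _ /=.
under eq_bigr do rewrite exchange_big.
rewrite exchange_big scaler_sumr; apply: eq_bigr => b _ /=.
under eq_bigr do rewrite -scaler_suml.
rewrite -scaler_suml scalerA; congr (_ *: _).
have -> : g * J a b = (N^T *m J *m frob N) a b by rewrite e [RHS]mxE.
rewrite mxE exchange_big; apply: eq_bigr => j _.
rewrite !mxE mulr_suml; apply: eq_bigr => i _.
by rewrite !mxE.
Qed.

(** Lines transform by the inverse transpose of the frame, so that incidence is the vanishing of a
    dot product over F_25. *)
Definition lined d : pline k := dual_line ((invmx W)^T *m ev d).

Lemma dual_neq0 d : d != zerov -> (invmx W)^T *m ev d != 0.
Proof.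
move=> d0; apply: mulmx_unit_neq0; first by rewrite unitmx_tr unitmx_inv.
by rewrite (ev_eq0 char_k theta2).
Qed.

Lemma on_lined d v : d != zerov -> v != zerov ->
  on_line (ptv W v) (lined d) <-> dot d v = zero25.
Proof.
move=> d0 v0; have Wv : W *m ev v != 0.
  by apply: mulmx_unit_neq0; rewrite // (ev_eq0 char_k theta2).
rewrite (on_dual_line (dual_neq0 d0) Wv) trmx_mul -mulmxA (mulmxA W^T) -trmx_mul.
rewrite mulVmx // trmx1 mul1mx.
have -> : ((ev v)^T *m ev d) 0 0 = e25 (dot d v).
  by rewrite (dotE char_k theta2) -[(ev v)^T *m _]trmxK trmx_mul trmxK [LHS]mxE.
split=> [/eqP|->]; last exact: e25_0.
by rewrite (e25_eq0 char_k theta2) => /eqP.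
Qed.

Lemma lined_inj d d' : normal d -> normal d' -> lined d = lined d' -> d = d'.
Proof.
move=> /andP[/eqP nd d0] /andP[/eqP nd' d'0].
move/(dual_line_inj (dual_neq0 d0) (dual_neq0 d'0)) => [x x0].
have uT : (invmx W)^T \in unitmx by rewrite unitmx_tr unitmx_inv.
rewrite scalemxAr => /(can_inj (mulKmx uT)) e.
by rewrite -nd -nd' (normv_eq char_k theta2 x0 e).
Qed.

Lemma dot_crossl u v : dot (cross u v) u = zero25.
Proof.
apply: (e25_inj char_k theta2).
case: u v => [[u0 u1] u2] [[v0 v1] v2].
by rewrite /= !(e25D char_k, e25M char_k theta2, e25N char_k) e25_0; ring.
Qed.

Lemma dot_crossr u v : dot (cross u v) v = zero25.
Proof.
apply: (e25_inj char_k theta2).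
case: u v => [[u0 u1] u2] [[v0 v1] v2].
by rewrite /= !(e25D char_k, e25M char_k theta2, e25N char_k) e25_0; ring.
Qed.

Lemma dot_normv d v : d != zerov -> dot d v = zero25 -> dot (normv d) v = zero25.
Proof.
move=> /(normvE char_k theta2)[x x0 e] /(congr1 e25).
rewrite (dotE char_k theta2) => h; apply: (e25_inj char_k theta2).
by rewrite (dotE char_k theta2) e linearZ /= -scalemxAl mxE h e25_0 mulr0.
Qed.

Lemma cross_neq0 u v : normal u -> normal v -> u != v -> cross u v != zerov.
Proof.
move=> /andP[/eqP nu u0] /andP[/eqP nv v0]; apply: contra_neq.
case: u v nu u0 nv v0 => [[u0 u1] u2] [[v0 v1] v2] nu n0 nv n0'.
move=> ez; have evu : ev (u0, u1, u2) != 0 by rewrite (ev_eq0 char_k theta2).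
have evv : ev (v0, v1, v2) != 0 by rewrite (ev_eq0 char_k theta2).
suff [x x0 ex] : exists2 x : k, x != 0 & ev (v0, v1, v2) = x *: ev (u0, u1, u2).
  by rewrite -nu -nv (normv_eq char_k theta2 x0 ex).
move: ez; rewrite /cross /zerov => -[] /(congr1 e25) z0 /(congr1 e25) z1 /(congr1 e25) z2.
move: z0 z1 z2; rewrite !(e25D char_k, e25M char_k theta2, e25N char_k) e25_0.
move=> /subr0_eq z0 /subr0_eq z1 /subr0_eq z2.
by apply: (cross_proportional evu evv); rewrite !mxE /= ?z0 ?z1 ?z2 // mulrC.
Qed.

End Secants.

Lemma card_image_undup (I : eqType) (T : Type) (s s' : seq I) (f : I -> T) :
  {in s ++ s' &, injective f} ->
  (f @` [set` s] `&` f @` [set` s']) #= `I_(size (undup [seq x <- s | x \in s'])).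
Proof.
move=> fi; set t := undup _.
have tE x : x \in t = (x \in s) && (x \in s').
  by rewrite mem_undup mem_filter andbC.
have -> : f @` [set` s] `&` f @` [set` s'] = f @` [set` t].
  apply/seteqP; split=> [y [[x xs <-] [z zs' /fi ezx]]|y [x xt <-]].
    have e : z = x by apply: ezx; rewrite mem_cat ?zs' ?orbT // (_ : x \in s).
    exists x => //; have xs1 : x \in s := xs; have zs1 : z \in s' := zs'.
    by rewrite -[[set` t] x]/(is_true (x \in t)) tE xs1 -e zs1.
  have : x \in t := xt; rewrite tE => /andP[xs xs'].
  by split; exists x.
apply: card_image_seq (undup_uniq _) _ => x y; rewrite !tE => /andP[xs _] /andP[ys _].
by apply: fi; rewrite mem_cat ?xs ?ys.
Qed.

Definition common_secants25 (A : mat) : nat :=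
  let s := secants25 A in size (undup [seq d <- secants25 idm | d \in s]).

Section SecantsOf.
Variable k : closedFieldType.
Hypothesis char_k : 5%N \in [pchar k].
Variable theta : k.
Hypothesis theta2 : theta ^+ 2 = 2%:R.
Local Notation e25 := (e25 theta).
Local Notation ev := (ev theta).
Local Notation em := (em theta).
Local Notation ptv := (ptv theta).
Local Notation lined := (lined theta).
Variables (W : 'M[k]_3) (c : k).
Hypotheses (uW : W \in unitmx) (c0 : c != 0).
Local Notation F := (c *: herm_form W).
Local Notation conic A := (conic_points (W *m em A)).

Lemma conic_zeros_six A : similitude char_k (em A) ->
  conic A `&` zeros F = ptv W @` [set` six A].
Proof.
move=> sA; rewrite (conic_zerosF uW c0 sA) (hexad_image char_k theta2) //.
exact: similitude_unit sA.
Qed.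

Lemma normal_secant A d : similitude char_k (em A) -> d \in secants25 A -> normal d.
Proof.
move=> sA /mapP[[u v] /= uv ->]; have uA := similitude_unit sA.
have [us vs n] := mem_pairs (six_uniq char_k theta2 uA) uv.
have x0 : cross u v != zerov.
  by apply: (cross_neq0 char_k theta2) => //; apply: (normal_six char_k theta2 uA).
by rewrite /normal (normvK char_k theta2) // eqxx (normv_neq0 char_k theta2).
Qed.

(** Another frame of the same conic has the given contact point at parameter 0, where
    [weierstrass_conic] applies. *)
Lemma weierstrass_six A v : similitude char_k (em A) -> v \in six A ->
  weierstrass_points F (ptv W v).
Proof.
move=> sA /(nthP zerov)[i hi <-]; have uA := similitude_unit sA.
rewrite -(hexad_six char_k theta2) //.
have [j [hj ij]] : exists j, (j < 6)%N /\ i != j.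
  by exists (i == 0%N : nat); split; case: (i) => // -[].
have [S [sS _ _ <- _]] := conic_move2 uW sA hi hj ij.
apply: (weierstrass_conic (char_k := char_k)) => //; exact: similitudeM.
Qed.

Lemma normv_crossC u v : cross u v != zerov -> normv (cross u v) = normv (cross v u).
Proof.
move=> n0; apply: (normv_eq char_k theta2 (c := -1)).
  by rewrite oppr_eq0 oner_neq0.
rewrite scaleN1r; case: u v {n0} => [[u0 u1] u2] [[v0 v1] v2].
apply/colP; apply: ord3P; rewrite !mxE /= !(e25D char_k, e25M char_k theta2, e25N char_k); ring.
Qed.

Lemma on_secant u v : normal u -> normal v -> u != v ->
  on_line (ptv W u) (lined W (normv (cross u v))) /\
  on_line (ptv W v) (lined W (normv (cross u v))).
Proof.
move=> nu nv uv; have x0 := cross_neq0 char_k theta2 nu nv uv.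
have n0 := normv_neq0 char_k theta2 x0.
case/andP: nu => _ u0; case/andP: nv => _ v0.
split; apply/(on_lined char_k theta2 uW n0) => //; apply: (dot_normv char_k theta2) => //.
- exact: (dot_crossl char_k theta2).
- exact: (dot_crossr char_k theta2).
Qed.

Lemma secants_ofE A : similitude char_k (em A) ->
  secants_of F (conic A) = lined W @` [set` secants25 A].
Proof.
move=> sA; have uA := similitude_unit sA.
have nrm v : v \in six A -> normal v by apply: (normal_six char_k theta2 uA).
rewrite /secants_of conic_zeros_six //; apply/seteqP; split=> L /=.
  case=> _ [_ [_ [[u us <-] [v vs <-] uv uL vL]]].
  have uv' : u != v by apply/eqP => e; apply: uv; rewrite e.
  have us' : u \in six A := us; have vs' : v \in six A := vs.
  have [hu hv] := on_secant (nrm _ us') (nrm _ vs') uv'.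
  exists (normv (cross u v)); last exact: line_unique uv hu hv uL vL.
  change (is_true (normv (cross u v) \in secants25 A)).
  case/orP: (pairs_complete us' vs' uv') => h; first exact: (map_f _ h).
  rewrite normv_crossC; first exact: (map_f _ h).
  exact: (cross_neq0 char_k theta2 (nrm _ us') (nrm _ vs')).
case=> d dA <-; have /mapP[[u v] /= uv ed] : d \in secants25 A := dA.
have [us vs n] := mem_pairs (six_uniq char_k theta2 uA) uv.
have [hu hv] := on_secant (nrm _ us) (nrm _ vs) n; rewrite -ed in hu hv.
have pn : ptv W u <> ptv W v.
  move/(ptv_inj char_k theta2 uW (nrm _ us) (nrm _ vs)) => e.
  by rewrite e eqxx in n.
split; exists (ptv W u), (ptv W v); split=> //.
- exact: weierstrass_six sA us.
- exact: weierstrass_six sA vs.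
- by exists u.
- by exists v.
Qed.

Lemma card_common_secants A : similitude char_k (em A) ->
  (secants_of F (conic_points W) `&` secants_of F (conic A)) #= `I_(common_secants25 A).
Proof.
move=> sA; have s1 : similitude char_k (em idm) by rewrite em_idm; apply: similitude1.
have -> : conic_points W = conic idm by rewrite em_idm mulmx1.
rewrite !secants_ofE //; apply: card_image_undup => d d'; rewrite !mem_cat => hd hd'.
apply: (lined_inj char_k theta2 uW).
- by case/orP: hd; apply: normal_secant.
- by case/orP: hd'; apply: normal_secant.
Qed.

End SecantsOf.

(** * Intersections of conics and binary quartics *)

Section BinaryForms.
Variable k : closedFieldType.

Definition bform (n : nat) (h : nat -> k) (s t : k) : k :=
  \sum_(i < n.+1) h i * (s ^+ (n - i) * t ^+ i).

Definition noncollinear (u v : k * k) := u.1 * v.2 != v.1 * u.2.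

(** A nonzero form of degree [n] has at most [n] zeros on P^1. The zero [(0 : 1)], if listed, is
    paid for by the vanishing of the coefficient [h n], which lowers the degree of [p]. *)
Lemma bform_zeros n h (rs : seq (k * k)) : (n < size rs)%N ->
  all (fun v => (v.1 != 0) || (v.2 != 0)) rs -> pairwise noncollinear rs ->
  all (fun v => bform n h v.1 v.2 == 0) rs -> forall i, (i <= n)%N -> h i = 0.
Proof.
move=> srs nz pw zs.
pose p := \poly_(i < n.+1) h i; pose fin := [seq v <- rs | v.1 != 0].
have pE s t : s != 0 -> bform n h s t = s ^+ n * p.[t / s].
  move=> s0; rewrite horner_poly mulr_sumr; apply: eq_bigr => i _.
  have -> : s ^+ n = s ^+ (n - i) * s ^+ i by rewrite -exprD subnK // -ltnS.
  by rewrite expr_div_n; field; rewrite expf_neq0.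
have roots_p : all (root p) [seq v.2 / v.1 | v <- fin].
  apply/allP => _ /mapP[v + ->]; rewrite mem_filter => /andP[v0 vrs].
  have := allP zs v vrs; rewrite pE // mulf_eq0 expf_eq0 (negbTE v0) andbF /=.
  by [].
have uniq_p : uniq [seq v.2 / v.1 | v <- fin].
  rewrite uniq_pairwise pairwise_map.
  apply: (sub_in_pairwise (P := [pred v : k * k | v.1 != 0])) (filter_all _ _)
    (pairwise_filter _ pw) => u v; rewrite !inE => u0 v0; apply: contra_neq.
  by move/eqP; rewrite eqr_div // => /eqP e; rewrite [v.1 * _]mulrC e mulrC.
(* Among pairwise non-proportional pairs at most one has first entry 0. *)
have inf1 : (size rs <= (size fin).+1)%N.
  rewrite size_filter -(count_predC (fun v : k * k => v.1 != 0) rs) -addn1 leq_add2l.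
  rewrite leqNgt; apply/negP; rewrite -size_filter.
  case e : [seq v <- rs | predC (fun v : k * k => v.1 != 0) v] => [|u [|v s]] // _.
  have := pairwise_filter (predC (fun v : k * k => v.1 != 0)) pw; rewrite e /=.
  move=> /andP[/andP[]]; rewrite /noncollinear.
  have zero w : w \in [:: u, v & s] -> w.1 = 0.
    by rewrite -e mem_filter /= negbK => /andP[/eqP].
  by rewrite (zero u) ?mem_head // (zero v) ?in_cons ?eqxx ?orbT // !mul0r eqxx.
suff p0 : p = 0.
  by move=> i hi; have := coef_poly n.+1 h i; rewrite -/p p0 coef0 ltnS hi.
apply/eqP; apply: contraT => p0.
have := max_poly_roots p0 roots_p uniq_p; rewrite size_map => lt_p.
case e : (all (fun v : k * k => v.1 != 0) rs).
  have sp : (size p <= n.+1)%N by apply: size_poly.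
  have ef : size fin = size rs by congr size; apply/all_filterP.
  by move: (leq_trans lt_p sp); rewrite ef ltnS leqNgt srs.
have /allPn[v vrs] := negbT e; rewrite negbK => /eqP v0.
have v2 : v.2 != 0 by have := allP nz v vrs; rewrite v0 eqxx.
have hn : h n = 0.
  have := allP zs v vrs; rewrite /bform big_ord_recr big1 /= => [|i _].
    by rewrite add0r subnn expr0 mul1r mulf_eq0 expf_eq0 (negbTE v2) andbF orbF => /eqP.
  by rewrite v0 expr0n subn_eq0 leqNgt ltn_ord mul0r mulr0.
have sp : (size p <= n)%N.
  apply/leq_sizeP => j; rewrite leq_eqVlt => /orP[/eqP <-|nj]; rewrite coef_poly.
    by rewrite ltnS leqnn.
  by rewrite ltnS leqNgt nj.
by move: (leq_trans lt_p sp); rewrite ltnNge -ltnS (leq_trans srs).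
Qed.

(** The coefficients of [y1 ^ 2 - y0 y2] at [y = B (s ^ 2, s t, t ^ 2)]. With [B] inverse to a
    frame, its zeros are the parameters of the points shared with the conic of that frame. *)
Definition conic_quartic (B : 'M[k]_3) (i : nat) : k :=
  nth 0 [:: B o1 o0 ^+ 2 - B o0 o0 * B o2 o0;
    2%:R * B o1 o0 * B o1 o1 - (B o0 o0 * B o2 o1 + B o0 o1 * B o2 o0);
    2%:R * B o1 o0 * B o1 o2 + B o1 o1 ^+ 2
      - (B o0 o0 * B o2 o2 + B o0 o1 * B o2 o1 + B o0 o2 * B o2 o0);
    2%:R * B o1 o1 * B o1 o2 - (B o0 o1 * B o2 o2 + B o0 o2 * B o2 o1);
    B o1 o2 ^+ 2 - B o0 o2 * B o2 o2] i.

Lemma conic_quarticE (B : 'M[k]_3) s t : let y := B *m veronese s t in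
  y o1 0 ^+ 2 - y o0 0 * y o2 0 = bform 4 (conic_quartic B) s t.
Proof.
rewrite /= /bform !big_ord_recl big_ord0 !mxE !sum3 !mxE /conic_quartic /=.
rewrite /bump /= !addn1 ?add1n ?subSS ?subn0 ?subnn.
ring.
Qed.

Lemma mem_conic_quartic (M B : 'M[k]_3) d s t : M \in unitmx -> B *m M = d%:M ->
  d != 0 -> forall W : 'M[k]_3, W \in unitmx -> (s != 0) || (t != 0) ->
  conic_points (W *m M) (pt (W *m veronese s t)) <-> bform 4 (conic_quartic B) s t = 0.
Proof.
move=> uM e d0 W uW st; have uWM : W *m M \in unitmx by rewrite unitmx_mul uW.
have v0 : W *m veronese s t != 0 by apply: mulmx_unit_neq0 => //; apply: veronese_neq0.
rewrite -(zeros_conic_form (oner_neq0 k) uWM).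
rewrite (zeros_pt (dhomogZ 1 (conic_form_homog _)) v0) mevalZ mul1r /conic_form.
rewrite expr2 mevalB !mevalM !meval_coord -expr2.
have -> : W *m veronese s t = W *m M *m (invmx M *m veronese s t).
  by rewrite -mulmxA mulKVmx.
rewrite mulKmx //.
have eB : B = d *: invmx M by rewrite -[B](mulmxK uM) e mul_scalar_mx.
rewrite -conic_quarticE eB -scalemxAl; move: (invmx M *m _) => y.
rewrite ![(d *: y) _ _]mxE conic_rescale.
split=> [->|/eqP]; first by rewrite mulr0.
by rewrite mulf_eq0 sqrf_eq0 (negbTE d0) => /eqP.
Qed.

(** Five common points annihilate the quartic. *)
Lemma conic_subset (M M' : 'M[k]_3) (rs : seq (k * k)) : M \in unitmx -> M' \in unitmx ->
  (4 < size rs)%N -> all (fun v => (v.1 != 0) || (v.2 != 0)) rs ->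
  pairwise noncollinear rs ->
  (forall v, v \in rs -> conic_points M' (pt (M *m veronese v.1 v.2))) ->
  conic_points M `<=` conic_points M'.
Proof.
move=> uM uM' srs nz pw h _ [s [t [st ->]]].
have uN : invmx M *m M' \in unitmx by rewrite unitmx_mul unitmx_inv uM.
have eM' : M' = M *m (invmx M *m M') by rewrite mulKVmx.
have inv : invmx M' *m M *m (invmx M *m M') = 1%:M.
  by rewrite !mulmxA mulmxK // mulVmx.
have mem s' t' := mem_conic_quartic (s := s') (t := t') uN inv (oner_neq0 _) uM.
rewrite eM'; apply/(mem _ _ st).
have z : forall i, (i <= 4)%N -> conic_quartic (invmx M' *m M) i = 0.
  apply: (bform_zeros srs nz pw); apply/allP => v vrs.
  by apply/eqP/(mem _ _ (allP nz v vrs)); rewrite -eM'; apply: h.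
by rewrite /bform big1 // => i _; rewrite z ?mul0r // -ltnS.
Qed.

End BinaryForms.

(** * The graph G *)

Definition hermm_inv : mat :=
  ((zero25, zero25, one25), (zero25, (f2, f0), zero25), (one25, zero25, zero25)).
(** For a similitude [A] this is the multiplier times the inverse of [A], obtained without
    division. *)
Definition adjm (A : mat) : mat := mulm hermm_inv (mulm (trm (mapm conj25 A)) hermm).

Definition quartic25 (A : mat) : seq F25 :=
  let: ((a, b, c), (d, e, f), (g, h, i)) := adjm A in
  let sub x y := add25 x (opp25 y) in
  let dbl x := add25 x x in
  [:: sub (mul25 d d) (mul25 a g);
      sub (dbl (mul25 d e)) (add25 (mul25 a h) (mul25 b g));
      sub (add25 (dbl (mul25 d f)) (mul25 e e))
        (add25 (add25 (mul25 a i) (mul25 b h)) (mul25 c g));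
      sub (dbl (mul25 e f)) (add25 (mul25 b i) (mul25 c h));
      sub (mul25 f f) (mul25 c i)].

Definition horner25 (h : seq F25) (t : F25) : F25 :=
  foldr (fun x y => add25 x (mul25 t y)) zero25 h.

Definition roots25 (h : seq F25) : seq (F25 * F25) :=
  (if isz (last zero25 h) then [:: (zero25, one25)] else [::]) ++
  [seq (one25, t) | t <- [seq t <- all25 | isz (horner25 h t)]].

(** Four zeros in P^1(F_25) of a nonzero quartic are all its zeros over [k]. *)
Definition split25 (h : seq F25) : bool :=
  (size (roots25 h) == 4%N) && has (fun x => ~~ isz x) h.

Definition eqs (s t : seq F25) : bool :=
  (size s == size t) && all (fun xy => eq25 xy.1 xy.2) (zip s t).

(* Recognizes the quartics [c * (l1 * l2) ^ 2] with [l1], [l2] vanishing at the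
   two roots in F_25. *)
Definition square25 (h : seq F25) : bool :=
  if roots25 h is [:: (s1, t1); (s2, t2)] then
    let u0 := mul25 t1 t2 in let u2 := mul25 s1 s2 in
    let u1 := opp25 (add25 (mul25 t1 s2) (mul25 s1 t2)) in
    let dbl x := add25 x x in
    has (fun c => ~~ isz c && eqs h [seq mul25 c x | x <-
      [:: mul25 u0 u0; dbl (mul25 u0 u1); add25 (mul25 u1 u1) (dbl (mul25 u0 u2));
          dbl (mul25 u1 u2); mul25 u2 u2]]) all25
  else false.

(** Decides equality of conics, since six common points force it; one inclusion is enough because
    both lists have six distinct entries. *)
Definition same_six (A B : mat) : bool :=
  let s := six B in all (fun v => has (eqv v) s) (six A).

(* The unipotent automorphisms of the standard conic: t |-> t + x. *)
Definition translation x : mat :=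
  ((one25, zero25, zero25), (nat5 x, one25, zero25),
   (nat5 (mul5 x x), nat5 (double5 x), one25)).
(* Two neighbours in G of the standard conic, found by search. *)
Definition seed0 : mat :=
  (((f0, f1), zero25, one25), (zero25, (f2, f0), zero25), (one25, zero25, (f0, f1))).
Definition seed1 : mat :=
  ((one25, zero25, (f0, f2)), (zero25, (f0, f1), zero25), ((f0, f2), zero25, one25)).
Definition nbrs25 : seq mat :=
  [seq mulm (translation x) s | s <- [:: seed0; seed1], x <- all5].

(** Certifies that each of the ten candidates is a neighbour of the standard conic; that there are
    no others is left to [nbrs25_complete]. *)
Lemma nbrs25_check : all (fun r => [&& simil25 r, common_secants25 r == 3%N,
  split25 (quartic25 r) & ~~ same_six r idm]) nbrs25.
Proof. by vm_compute. Qed.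

(* A conic sharing a special secant with the standard one is, after moving its two
   points on that secant to the parameters 0 and infinity, one of those below. *)
Lemma nbrs25_complete : all (fun p =>
  let ds := [seq d <- secants25 idm | isz (dot d p)] in
  if ds is [::] then true else let K := transport p in
  all (fun w => let q := matv K w in
    if has (fun d => isz (dot d q)) ds then
      all (fun b => let A := mulm K (mulm (unip w) (torus b)) in
        [|| common_secants25 A != 3%N, square25 (quartic25 A) | has (same_six A) nbrs25])
      reps25
    else true) affine25) points25.
Proof. by vm_compute. Qed.

Lemma pairwise_neq (T : eqType) (r : rel T) s : ssrbool.symmetric r -> pairwise r s ->
  {in s &, forall x y, x != y -> r x y}.
Proof.
move=> rC; elim: s => //= z s IH /andP[/allP zs /IH {}IH] x y.
rewrite !inE => /predU1P[->|xs] /predU1P[->|ys]; rewrite ?eqxx // => n.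
- exact: zs.
- by rewrite rC zs.
- exact: IH.
Qed.

Section Meeting.
Variable k : closedFieldType.
Hypothesis char_k : 5%N \in [pchar k].
Variable theta : k.
Hypothesis theta2 : theta ^+ 2 = 2%:R.
Local Notation e25 := (e25 theta).
Local Notation ev := (ev theta).
Local Notation em := (em theta).
Local Notation ptv := (ptv theta).
Local Notation frob := (map_mx (pFrobenius_aut char_k)).
Local Notation J := (herm_mx k).
Variable W : 'M[k]_3.
Hypothesis uW : W \in unitmx.
Local Notation conic A := (conic_points (W *m em A)).

Lemma adjm_inv A : similitude char_k (em A) ->
  exists2 d, d != 0 & em (adjm A) *m em A = d%:M.
Proof.
case=> g [g0 _ e]; exists g => //; rewrite /adjm !(em_mulm char_k theta2) em_trm.
rewrite (em_conj char_k theta2) (em_hermm char_k) -!mulmxA.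
have -> : (frob (em A))^T *m (J *m em A) = g *: J.
  by have := congr1 trmx e; rewrite !trmx_mul trmxK linearZ /= herm_mx_sym.
have : em (mulm hermm_inv hermm) = 1%:M by rewrite -(em_idm theta).
rewrite (em_mulm char_k theta2) (em_hermm char_k) -scalemxAr => ->.
by rewrite scalemx1.
Qed.

Lemma quartic25E A i : e25 (nth zero25 (quartic25 A) i) = conic_quartic (em (adjm A)) i.
Proof.
rewrite /quartic25; case: (adjm A) => [[[[a b] c] [[d e] f]] [[g h] j]].
rewrite /conic_quartic !mxE /=.
case: i => [|[|[|[|[|i]]]]] /=; last by rewrite !nth_nil e25_0.
- by rewrite !(e25D char_k, e25M char_k theta2, e25N char_k); ring.
- by rewrite !(e25D char_k, e25M char_k theta2, e25N char_k); ring.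
- by rewrite !(e25D char_k, e25M char_k theta2, e25N char_k); ring.
- by rewrite !(e25D char_k, e25M char_k theta2, e25N char_k); ring.
- by rewrite !(e25D char_k, e25M char_k theta2, e25N char_k); ring.
Qed.

Lemma size_quartic25 A : size (quartic25 A) = 5%N.
Proof. by rewrite /quartic25; case: (adjm A) => [[[[a b] c] [[d e] f]] [[g h] j]]. Qed.

Local Notation form25 h := (bform 4 (fun i => e25 (nth zero25 h i))).

Lemma meet_conic A s t : similitude char_k (em A) -> (s != 0) || (t != 0) ->
  conic A (pt (W *m veronese s t)) <-> form25 (quartic25 A) s t = 0.
Proof.
move=> sA st; have [d d0 e] := adjm_inv sA.
rewrite (mem_conic_quartic (similitude_unit sA) e d0 uW st).
suff -> : bform 4 (conic_quartic (em (adjm A))) s t = form25 (quartic25 A) s t by [].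
by apply: eq_bigr => i _; rewrite quartic25E.
Qed.

Lemma horner25E h t : size h = 5%N -> e25 (horner25 h t) = form25 h 1 (e25 t).
Proof.
case: h => [|h0 [|h1 [|h2 [|h3 [|h4 []]]]]] //= _.
rewrite /bform !big_ord_recl big_ord0 /= /bump /= !expr1n !add1n.
rewrite !(e25D char_k, e25M char_k theta2) e25_0; ring.
Qed.

Lemma last25E h : size h = 5%N -> e25 (last zero25 h) = form25 h 0 1.
Proof.
case: h => [|h0 [|h1 [|h2 [|h3 [|h4 []]]]]] //= _.
rewrite /bform !big_ord_recl big_ord0 /= /bump /= !add1n !expr1n ?subSS ?subn0 ?subnn.
by rewrite !expr0n /= ?expr0 !(mul0r, mulr0, add0r, addr0, mulr1).
Qed.

Definition e25pair (v : F25 * F25) : k * k := (e25 v.1, e25 v.2).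

Lemma roots25P h v : size h = 5%N -> v \in roots25 h ->
  ((e25 v.1 != 0) || (e25 v.2 != 0)) && (form25 h (e25 v.1) (e25 v.2) == 0).
Proof.
move=> sh; rewrite mem_cat => /orP[|/mapP[t + ->]].
  case: ifP => // + /[!inE] /eqP ->.
  rewrite (iszE char_k theta2) last25E //= e25_0 e25_1 => ->.
  by rewrite oner_neq0 orbT.
rewrite mem_filter (iszE char_k theta2) horner25E // => /andP[h0 _] /=.
by rewrite e25_1 h0 oner_neq0.
Qed.

Lemma roots25_pairwise h :
  pairwise (@noncollinear k) [seq e25pair v | v <- roots25 h].
Proof.
rewrite /roots25 map_cat -map_comp.
have : uniq [seq t <- all25 | isz (horner25 h t)] by apply: filter_uniq.
move: [seq t <- all25 | _] => s us.
have aff : pairwise (@noncollinear k) [seq (e25pair \o pair one25) t | t <- s].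
  rewrite pairwise_map; move: us; rewrite uniq_pairwise; apply: sub_pairwise.
  move=> x y; apply: contra_neq; rewrite /e25pair /= e25_1 !mul1r => /esym.
  exact: (e25_inj char_k theta2).
case: ifP => _ //=; rewrite aff andbT; apply/allP => _ /mapP[t _ ->].
by rewrite /noncollinear /= e25_0 e25_1 mul0r mul1r eq_sym oner_neq0.
Qed.

Lemma split25P A : similitude char_k (em A) -> split25 (quartic25 A) ->
  (conic_points W `&` conic A) #= `I_4.
Proof.
move=> sA; have sh := size_quartic25 A; have mem s t := meet_conic (s := s) (t := t) sA.
move: (quartic25 A) sh mem => h sh mem /andP[/eqP s4 nzh].
have nz v : v \in roots25 h -> (e25 v.1 != 0) || (e25 v.2 != 0).
  by move/(roots25P sh)/andP => [].
have z v : v \in roots25 h -> form25 h (e25 v.1) (e25 v.2) = 0.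
  by move/(roots25P sh)/andP => [_ /eqP].
have pw := roots25_pairwise h.
pose f v := pt (W *m veronese (e25 v.1) (e25 v.2)).
have -> : conic_points W `&` conic A = f @` [set` roots25 h].
  apply/seteqP; split=> [_ [[s [t [st ->]]]]|_ [v vh <-]]; last first.
    have vh' : v \in roots25 h := vh.
    by split; [exists (e25 v.1), (e25 v.2); split=> //; apply: nz | apply/mem; [apply: nz | apply: z]].
  move/(mem _ _ st) => z0.
  (* A common point outside the list would be a fifth zero of the quartic and annihilate it. *)
  have [|nc] := boolP (has (fun v => ~~ noncollinear (s, t) (e25pair v)) (roots25 h)).
    case/hasP=> v vh; rewrite negbK => /eqP e; exists v => //.
    by apply/(conic_point_eq uW (nz _ vh) st); apply: esym.
  suff : ~~ has (fun x => ~~ isz x) h by rewrite nzh.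
  apply/hasPn => x.
  case/(nthP zero25)=> i hi <-; rewrite negbK (iszE char_k theta2); apply/eqP.
  apply: (@bform_zeros k 4 (fun i => e25 (nth zero25 h i))
    ((s, t) :: [seq e25pair v | v <- roots25 h])).
  - by rewrite /= size_map s4.
  - by rewrite /= st; apply/allP => _ /mapP[v vh ->]; apply: nz.
  - rewrite /= pw andbT; apply/allP => _ /mapP[v vh ->].
    by apply: contraNT nc => n; apply/hasP; exists v.
  - by rewrite /= z0 eqxx; apply/allP => _ /mapP[v vh ->]; rewrite /= z.
  - by rewrite -ltnS -sh.
rewrite -s4; apply: card_image_seq.
  have : uniq [seq e25pair v | v <- roots25 h].
    rewrite uniq_pairwise; apply: sub_pairwise pw => u v; apply: contraTneq => ->.
    by rewrite /noncollinear eqxx.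
  by move/map_uniq.
move=> u v uh vh /(conic_point_eq uW (nz _ uh) (nz _ vh)) e.
apply/eqP; apply: contraT => uv.
have nc : e25pair u != e25pair v.
  apply: contra_neq uv; case: u v {uh vh e} => [u1 u2] [v1 v2] [].
  by move=> /(e25_inj char_k theta2) -> /(e25_inj char_k theta2) ->.
have ncC : ssrbool.symmetric (@noncollinear k) by move=> x y; rewrite /noncollinear eq_sym.
have := pairwise_neq ncC pw (map_f _ uh) (map_f _ vh) nc.
by rewrite /noncollinear /= e eqxx.
Qed.

Lemma eqsP s t : eqs s t -> s = t.
Proof.
elim: s t => [|x s IH] [|y t] //=; rewrite /eqs /= eqSS => /and3P[hs /=].
by rewrite eq25E => /eqP -> h; rewrite (IH t) // /eqs hs h.
Qed.

(** The quartic vanishes at no more than two points, whereas among three points of an enumeration of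
    four two would then have to coincide. *)
Lemma square25P A : similitude char_k (em A) -> square25 (quartic25 A) ->
  ~ ((conic_points W `&` conic A) #= `I_4).
Proof.
move=> sA; have sh := size_quartic25 A; have mem s t := meet_conic (s := s) (t := t) sA.
move: (quartic25 A) sh mem => h sh mem; rewrite /square25.
have nz v : v \in roots25 h -> (e25 v.1 != 0) || (e25 v.2 != 0).
  by move/(roots25P sh)/andP => [].
case e : (roots25 h) nz => [|[s1 t1] [|[s2 t2] []]] // nz /hasP[c _ /andP[c0 /eqsP eh]].
have n1 : (e25 s1 != 0) || (e25 t1 != 0) by apply: (nz (s1, t1)); rewrite mem_head.
have n2 : (e25 s2 != 0) || (e25 t2 != 0) by apply: (nz (s2, t2)); rewrite !inE eqxx orbT.
have ez s t : form25 h s t = e25 c * ((e25 t1 * s - e25 s1 * t) * (e25 t2 * s - e25 s2 * t)) ^+ 2.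
  rewrite eh /bform !big_ord_recl big_ord0 /= /bump /= !add1n ?subSS ?subn0 ?subnn.
  by rewrite !(e25D char_k, e25M char_k theta2, e25N char_k); ring.
have sub x : (conic_points W `&` conic A) x ->
    x = pt (W *m veronese (e25 s1) (e25 t1)) \/ x = pt (W *m veronese (e25 s2) (e25 t2)).
  case=> -[s [t [st ->]]] /(mem _ _ st) /eqP.
  rewrite ez mulf_eq0 -(iszE char_k theta2) (negbTE c0) sqrf_eq0 mulf_eq0 !subr_eq0 /=.
  by case/orP=> /eqP e'; [left | right]; apply/(conic_point_eq uW) => //; rewrite mulrC.
case/(card_enum (point0 k)) => p [pinj pE].
have q i : (i < 4)%N -> p i = pt (W *m veronese (e25 s1) (e25 t1)) \/
    p i = pt (W *m veronese (e25 s2) (e25 t2)).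
  by move=> hi; apply/sub/pE; exists i.
by case: (q 0%N isT) (q 1%N isT) (q 2%N isT) => e0 [] e1 [] e2;
  [have := pinj 0%N 1%N isT isT | have := pinj 0%N 1%N isT isT |
   have := pinj 0%N 2%N isT isT | have := pinj 1%N 2%N isT isT |
   have := pinj 1%N 2%N isT isT | have := pinj 0%N 2%N isT isT |
   have := pinj 0%N 1%N isT isT | have := pinj 0%N 1%N isT isT];
  rewrite ?e0 ?e1 ?e2 => /(_ erefl).
Qed.

Lemma six_subset A B : similitude char_k (em A) -> similitude char_k (em B) ->
  {subset six A <= six B} -> conic A `<=` conic B.
Proof.
move=> sA sB AB; have uA := similitude_unit sA; have uB := similitude_unit sB.
have uWA : W *m em A \in unitmx by rewrite unitmx_mul uW.
have uWB : W *m em B \in unitmx by rewrite unitmx_mul uW.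
apply: (@conic_subset k _ _ [seq line5 k i | i <- iota 0 6]) => //.
- by apply/allP => _ /mapP[i _ ->]; apply: line5_neq0.
- rewrite pairwise_map; apply: (sub_in_pairwise (P := mem (iota 0 6)) (r := fun x y => x != y)).
  + move=> i j hi hj; apply: contra_neq => e.
    apply: (hexad_inj char_k uWA hi hj).
    by apply/(conic_point_eq uWA (line5_neq0 k i) (line5_neq0 k j)).
  + exact/allP.
  + by rewrite -uniq_pairwise.
move=> _ /mapP[i + ->]; rewrite mem_iota => /andP[_ hi].
rewrite -/(hexad _ i) (hexad_six char_k theta2) //.
have /AB /(nthP zerov)[j hj <-] : nth zerov (six A) i \in six A by apply: mem_nth.
rewrite -(hexad_six char_k theta2) //.
by exists (line5 k j).1, (line5 k j).2; split=> //; apply: line5_neq0.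
Qed.

Lemma same_sixP A B : similitude char_k (em A) -> similitude char_k (em B) ->
  same_six A B <-> conic A = conic B.
Proof.
move=> sA sB; have uA := similitude_unit sA; have uB := similitude_unit sB.
have -> : same_six A B = all (mem (six B)) (six A).
  apply: eq_all => v; apply/hasP/idP => [[u us]|vs]; first by rewrite eqvE => /eqP ->.
  by exists v; rewrite ?eqvE.
split=> [/allP AB|e].
  apply/seteqP; split; apply: six_subset => //.
  have [_] := uniq_min_size (six_uniq char_k theta2 uA) AB (leqnn _).
  by move=> h v; rewrite h.
have := conic_zeros_six theta2 uW (oner_neq0 k) sB.
rewrite -e (conic_zeros_six theta2 uW (oner_neq0 k) sA) => e'.
apply/allP => v vA; have : (ptv W @` [set` six B]) (ptv W v) by rewrite -e'; exists v.
case=> u uB' /(ptv_inj char_k theta2 uW) => <- //.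
- exact: (normal_six char_k theta2 uB).
- exact: (normal_six char_k theta2 uA).
Qed.

End Meeting.

Lemma nbrs25_completeP p w b d : p \in points25 -> w \in affine25 -> b \in reps25 ->
  let A := mulm (transport p) (mulm (unip w) (torus b)) in
  d \in secants25 idm -> dot d p = zero25 -> dot d (matv (transport p) w) = zero25 ->
  common_secants25 A = 3%N -> ~~ square25 (quartic25 A) -> has (same_six A) nbrs25.
Proof.
move=> hp hw hb A hd dp dq c3 nsq.
have := allP nbrs25_complete p hp; lazy beta zeta.
have : d \in [seq d <- secants25 idm | isz (dot d p)] by rewrite mem_filter dp hd.
move: [seq d <- secants25 idm | _] => [|x ds] // hds.
move=> /allP/(_ w hw); lazy beta zeta.
have -> : has (fun d => isz (dot d (matv (transport p) w))) (x :: ds).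
  by apply/hasP; exists d; rewrite ?dq.
move=> /allP/(_ b hb); lazy beta zeta; rewrite -/A c3 eqxx (negbTE nsq).
by [].
Qed.

Lemma affine25_neq0 w : w \in affine25 -> w != zerov.
Proof.
rewrite mem_filter => /andP[_ /allpairsP[[a b] [_ _ ->]]].
by rewrite /zerov xpair_eqE andbF.
Qed.

Section Adjacency.
Variable k : closedFieldType.
Hypothesis char_k : 5%N \in [pchar k].
Variable theta : k.
Hypothesis theta2 : theta ^+ 2 = 2%:R.
Local Notation ev := (ev theta).
Local Notation em := (em theta).
Local Notation ptv := (ptv theta).
Variables (W : 'M[k]_3) (c : k).
Hypotheses (uW : W \in unitmx) (c0 : c != 0).
Local Notation F := (c *: herm_form W).
Local Notation conic A := (conic_points (W *m em A)).

Lemma similitude_idm : similitude char_k (em idm).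
Proof. by rewrite em_idm; apply: similitude1. Qed.

Lemma conic_idm : conic idm = conic_points W.
Proof. by rewrite em_idm mulmx1. Qed.

Lemma similitude_mulm A B : similitude char_k (em A) -> similitude char_k (em B) ->
  similitude char_k (em (mulm A B)).
Proof. by move=> sA sB; rewrite (em_mulm char_k theta2); apply: similitudeM. Qed.

Lemma tt_conic_two_points Q P P' : tt_conics F Q -> (Q `&` zeros F) P ->
  (Q `&` zeros F) P' -> P <> P' ->
  exists p w b, [/\ p \in points25, w \in affine25 & b \in reps25] /\
    [/\ P = ptv W p, P' = ptv W (matv (transport p) w)
      & Q = conic (mulm (transport p) (mulm (unip w) (torus b)))].
Proof.
move=> /(tt_conic_classification char_k uW c0)[N sN ->].
rewrite (conic_zerosF uW c0 sN) => -[i /mem_iota0 hi <-] [j /mem_iota0 hj <-] PP'.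
have ij : i != j by apply: contra_not_neq PP' => ->.
have [S [sS <- _ eP eP']] := conic_move2 uW sN hi hj ij.
have sNS := similitudeM sN sS.
have [p [w [b [[hp hw hb] [[l l0 el] [m m0 em'] e]]]]] :=
  similitude_decomposition theta2 uW sNS.
exists p, w, b; split=> //; split=> //.
- by rewrite -eP el -scalemxAr pt_scale.
- by rewrite -eP' em' -scalemxAr pt_scale.
Qed.

(** Three common special secants provide at least one. It passes through two contact points of [Q],
    which normalize [Q], and it belongs to the secants of the standard conic: these are the cases
    examined by [nbrs25_complete]. *)
Lemma adjG_conic Q : tt_conics F Q ->
  adjG F (conic_points W) Q <-> exists2 r, r \in nbrs25 & Q = conic r.
Proof.
move=> tQ; split; last first.
  case=> r hr ->; have /and4P[/(simil25P char_k theta2) sr /eqP c3 sp nsame] :=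
    allP nbrs25_check r hr.
  split; last by have := card_common_secants theta2 uW c0 sr; rewrite c3.
    move=> e; move/negP: nsame; apply.
    apply/(same_sixP theta2 uW sr similitude_idm).
    by rewrite conic_idm.
  exact: (split25P theta2 uW sr sp).
case=> _ i4 i3.
have [N sN eN] := tt_conic_classification char_k uW c0 tQ.
have [L [LW LQ]] : exists L, (secants_of F (conic_points W) `&` secants_of F Q) L.
  have [p [_ pE]] := card_enum (dual_line (0 : 'cV[k]_3)) i3.
  by exists (p 0%N); apply/pE; exists 0%N.
case: LQ => _ [P [P' [zP zP' PP' PL P'L]]].
have [p [w [b [[hp hw hb] [eP eP' eQ]]]]] := tt_conic_two_points tQ zP zP' PP'.
have [sK _] := points_transport char_k theta2 hp.
have [sw _ _] := affine_unip char_k theta2 hw.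
have sb := simil25P char_k theta2 (allP torus_check b hb).
set A := mulm _ _ in eQ; have sA : similitude char_k (em A) by do 2?[apply: similitude_mulm].
move: LW; rewrite -conic_idm secants_ofE //; last exact: similitude_idm.
case=> d dI eL; have hd : d \in secants25 idm := dI.
have /andP[_ d0] := normal_secant theta2 similitude_idm hd.
have p0 : p != zerov by case/points25P: (hp) => [->|/affine25_neq0].
have q0 : matv (transport p) w != zerov.
  apply: (matv_neq0 char_k theta2 (similitude_unit sK)); exact: affine25_neq0.
have dp : dot d p = zero25 by apply/(on_lined char_k theta2 uW d0 p0); rewrite -eP eL.
have dq : dot d (matv (transport p) w) = zero25.
  by apply/(on_lined char_k theta2 uW d0 q0); rewrite -eP' eL.
have c3 : common_secants25 A = 3%N.
  by apply: (card_eq_unique _ i3); rewrite eQ; apply: card_common_secants.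
have nsq : ~~ square25 (quartic25 A).
  by apply/negP => /(square25P theta2 uW sA); apply; rewrite -eQ.
have /hasP[r hr same] := nbrs25_completeP hp hw hb hd dp dq c3 nsq.
have /and4P[/(simil25P char_k theta2) sr _ _ _] := allP nbrs25_check r hr.
exists r => //; rewrite eQ.
exact/(same_sixP theta2 uW sA sr).
Qed.

End Adjacency.

(* The component of the standard conic in the graph G. *)
Definition block0 : seq mat := idm :: nbrs25 ++
  [seq mulm (mulm (translation x) seed0) (mulm (translation y) seed0)
     | y <- [:: f1; f2], x <- all5].
Definition block (h : mat) : seq mat := [seq mulm h g | g <- block0].

Lemma block0_simil : all simil25 block0.
Proof. by vm_compute. Qed.

(** Bounds the component from above: since [g] is a change of frame, the neighbours of its conic are
    the conics of the [mulm g r], and all of them are in the block. *)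
Lemma block0_closed : all (fun g => all (fun r => has (same_six (mulm g r)) block0) nbrs25)
  block0.
Proof. by vm_compute. Qed.

(** Consequently every component of G has a conic through any given isotropic point, in particular
    through [inf25]. *)
Lemma block0_cover : all (fun p => has (fun g => has (eqv p) (six g)) block0) points25.
Proof. by vm_compute. Qed.

(** Bounds the component from below: each conic of the block is reached from the standard one by at
    most two edges. *)
Lemma block0_words g : g \in block0 -> [\/ g = idm, g \in nbrs25 |
  exists r r', [/\ r \in nbrs25, r' \in nbrs25 & g = mulm r r']].
Proof.
rewrite in_cons mem_cat => /orP[/eqP ->|/orP[gn|/allpairsP[[y x] [_ _ ->]]]].
- by constructor 1.
- by constructor 2.
have seed0P z : mulm (translation z) seed0 \in nbrs25.
  by apply/allpairsP; exists (seed0, z); rewrite mem_head; case: z.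
by constructor 3; exists (mulm (translation x) seed0), (mulm (translation y) seed0).
Qed.

(** * Components of the graph G *)

Section Blocks.
Variable k : closedFieldType.
Hypothesis char_k : 5%N \in [pchar k].
Variable theta : k.
Hypothesis theta2 : theta ^+ 2 = 2%:R.
Local Notation ev := (ev theta).
Local Notation em := (em theta).
Local Notation ptv := (ptv theta).

Lemma simil_nbrs25 r : r \in nbrs25 -> similitude char_k (em r).
Proof. by move=> /(allP nbrs25_check)/and4P[/(simil25P char_k theta2)]. Qed.

Lemma simil_block0 g : g \in block0 -> similitude char_k (em g).
Proof. by move=> /(allP block0_simil)/(simil25P char_k theta2). Qed.

Lemma simil_block h g : similitude char_k (em h) -> g \in block h ->
  similitude char_k (em g).
Proof.
by move=> sh /mapP[a ha ->]; apply: (similitude_mulm theta2 sh); apply: simil_block0.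
Qed.

Variables (W : 'M[k]_3) (c : k).
Hypotheses (uW : W \in unitmx) (c0 : c != 0).
Local Notation F := (c *: herm_form W).

Lemma frame_change N : similitude char_k N ->
  exists2 d, d != 0 & F = d *: herm_form (W *m N).
Proof.
case=> g [g0 g5 e]; exists (c * g); first by rewrite mulf_neq0.
by rewrite (herm_form_frame uW e g0) scalerA.
Qed.

Lemma adjG_similitude N Q : similitude char_k N -> tt_conics F Q ->
  adjG F (conic_points (W *m N)) Q <->
  exists2 r, r \in nbrs25 & Q = conic_points (W *m N *m em r).
Proof.
move=> sN tQ; have [d d0 eF] := frame_change sN; rewrite eF in tQ *.
have uWN : W *m N \in unitmx by rewrite unitmx_mul uW (similitude_unit sN).
exact: (adjG_conic char_k theta2 uWN d0 tQ).
Qed.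

Lemma adjG_sym Q Q' : adjG F Q Q' -> adjG F Q' Q.
Proof. by case=> n h h'; split; [move=> e; apply: n | rewrite setIC | rewrite setIC]. Qed.

Lemma component_similitude N : similitude char_k N ->
  component (tt_conics F) (adjG F) (conic_points (W *m N)) =
  (fun g => conic_points (W *m N *m em g)) @` [set` block0].
Proof.
move=> sN; have uWN : W *m N \in unitmx by rewrite unitmx_mul uW similitude_unit.
pose Q g := conic_points (W *m N *m em g).
have tQ g : similitude char_k (em g) -> tt_conics F (Q g).
  move=> sg; rewrite /Q -mulmxA; apply: (tt_conic_similitude uW c0).
  exact: similitudeM.
have step x y : (exists2 g, g \in block0 & x = Q g) -> tt_conics F y -> adjG F x y ->
    exists2 g, g \in block0 & y = Q g.
  case=> g hg -> ty; have sg := simil_block0 hg; rewrite /Q -mulmxA.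
  case/(adjG_similitude (similitudeM sN sg) ty) => r hr ->.
  have /hasP[g' hg' same] := allP (allP block0_closed g hg) r hr.
  exists g' => //; have sgr := similitude_mulm theta2 sg (simil_nbrs25 hr).
  rewrite -!mulmxA -(em_mulm char_k theta2) !mulmxA.
  by apply/(same_sixP theta2 uWN sgr (simil_block0 hg')).
have edge g r : similitude char_k (em g) -> r \in nbrs25 ->
    joined (tt_conics F) (adjG F) (Q g) (Q (mulm g r)).
  move=> sg hr; have sr := simil_nbrs25 hr; have sgr := similitude_mulm theta2 sg sr.
  apply: rst_step; split; [exact: tQ | exact: tQ |].
  rewrite {1}/Q -mulmxA; apply/(adjG_similitude (similitudeM sN sg) (tQ _ sgr)).
  by exists r => //; rewrite /Q (em_mulm char_k theta2) !mulmxA.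
have Q1 : conic_points (W *m N) = Q idm by rewrite /Q em_idm mulmx1.
apply/seteqP; split=> [y|_ [g hg <-]].
  have : exists2 g, g \in block0 & conic_points (W *m N) = Q g.
    by exists idm; rewrite ?mem_head.
  rewrite /component /joined /= => hx hxy.
  suff /(_ hx) [g hg ->] : (exists2 g, g \in block0 & conic_points (W *m N) = Q g) ->
    exists2 g, g \in block0 & y = Q g by exists g.
  (* Stating the invariant as an equivalence lets the induction on the symmetric closure treat both
     directions at once. *)
  suff [] : ((exists2 g, g \in block0 & conic_points (W *m N) = Q g) <->
    exists2 g, g \in block0 & y = Q g) by [].
  elim: hxy => {hx y} [x y [tx ty xy]|x|x y _ [] //|x y z _ h1 _ h2] //.
  - split=> h; first exact: step h ty xy.
    exact: step h tx (adjG_sym xy).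
  - by split=> h; [apply/h2/h1 | apply/h1/h2].
have edge1 r : r \in nbrs25 -> joined (tt_conics F) (adjG F) (conic_points (W *m N)) (Q r).
  move=> hr; have sr := simil_nbrs25 hr; apply: rst_step.
  split; [exact: tt_conic_similitude | exact: tQ |].
  by apply/(adjG_similitude sN (tQ _ sr)); exists r.
change (joined (tt_conics F) (adjG F) (conic_points (W *m N)) (Q g)).
case: (block0_words hg) => [->|hr|[r [r' [hr hr' ->]]]].
- by rewrite -Q1; apply: rst_refl.
- exact: edge1.
- exact: rst_trans (edge1 _ hr) (edge _ _ (simil_nbrs25 hr) hr').
Qed.

End Blocks.

Lemma component_joined (T : Type) (V : set T) e (x y : T) : joined V e x y ->
  component V e x = component V e y.
Proof.
move=> xy; apply/seteqP; split=> z hz.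
- exact: rst_trans (rst_sym _ _ _ _ xy) hz.
- exact: rst_trans xy hz.
Qed.

(* One conic through the point [inf25] from each component of G. *)
Definition pencil b : seq mat := [seq mulm (unip w) (torus b) | w <- affine25 &
  let: (_, (y, z), _) := w in if eq25 b one25 then eq5 y f0 else eq5 z f0].
(** The five contact points other than [inf25] of the conic given by [w] and [b], normalized to last
    coordinate 1, have middle coordinates filling a coset of [F_5 b] in F_25. The filter of [pencil]
    keeps one point of each such coset: real part 0 if [b = 1], [theta] part 0 otherwise. Each of
    the 6 values of [b] contributes 25 conics. *)
Definition heads : seq mat := flatten [seq pencil b | b <- reps25].

Lemma heads_simil : all simil25 heads.
Proof. by vm_compute. Qed.

Lemma size_heads : size heads = 150%N.
Proof. by vm_compute. Qed.

(** The pairs [(w, b)] give all conics through [inf25], each with marked second point; every one of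
    them has the hexad of some head. Binding [hs] computes the hexads of the heads once. *)
Lemma heads_complete : let hs := [seq six h | h <- heads] in
  all (fun b => all (fun w => let s := six (mulm idm (mulm (unip w) (torus b))) in
    has (fun t => all (fun v => has (eqv v) t) s) hs) affine25) reps25.
Proof. by vm_compute. Qed.

Lemma heads_completeP w b : w \in affine25 -> b \in reps25 ->
  has (same_six (mulm idm (mulm (unip w) (torus b)))) heads.
Proof.
move=> hw hb; have := heads_complete; lazy beta zeta.
by move=> /allP/(_ b hb); lazy beta; move=> /allP/(_ w hw); lazy beta; rewrite has_map.
Qed.

Section Heads.
Variable k : closedFieldType.
Hypothesis char_k : 5%N \in [pchar k].
Variable theta : k.
Hypothesis theta2 : theta ^+ 2 = 2%:R.
Local Notation ev := (ev theta).
Local Notation em := (em theta).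
Local Notation ptv := (ptv theta).
Local Notation frob := (map_mx (pFrobenius_aut char_k)).
Variables (W : 'M[k]_3) (c : k).
Hypotheses (uW : W \in unitmx) (c0 : c != 0).
Local Notation F := (c *: herm_form W).
Local Notation conic A := (conic_points (W *m em A)).

Lemma simil_heads h : h \in heads -> similitude char_k (em h).
Proof. by move=> /(allP heads_simil)/(simil25P char_k theta2). Qed.

Lemma component_block h : similitude char_k (em h) ->
  component (tt_conics F) (adjG F) (conic h) = (fun A => conic A) @` [set` block h].
Proof.
move=> sh; rewrite (component_similitude theta2 uW c0 sh).
apply/seteqP; split=> [_ [g hg <-]|_ [A hA <-]].
  exists (mulm h g); last by rewrite (em_mulm char_k theta2) mulmxA.
  by apply: map_f; have : g \in block0 := hg.
have /mapP[g hg ->] : A \in block h := hA.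
by exists g; rewrite // (em_mulm char_k theta2) mulmxA.
Qed.

Lemma normal_inf25 : normal inf25.
Proof. by []. Qed.

Lemma normal_points25 p : p \in points25 -> normal p.
Proof.
case/points25P => [->|]; first exact: normal_inf25.
rewrite mem_filter => /andP[_ /allpairsP[[a b] [_ _ ->]]].
by rewrite /normal /= -?[isz _]/false; case: a b => [[] []] [[] []].
Qed.

Lemma points25_cover N : similitude char_k N ->
  exists2 p, p \in points25 & pt (W *m (N *m ev p)) = ptv W inf25.
Proof.
move=> sN; have uN := similitude_unit sN; have sV := similitudeV sN.
have r : frob (frob (invmx N *m veronese 1 0)) = invmx N *m veronese 1 0.
  by rewrite !map_mxM (similitude_frob sV) !frob_veronese !(expr1n, expr0n).
have v0 : invmx N *m veronese 1 0 != 0 :> 'cV[k]_3.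
  apply: mulmx_unit_neq0; first exact: similitude_unit.
  by apply: veronese_neq0; rewrite oner_neq0.
have [p [hp [l l0 e]]] := isotropic_point theta2 r v0
  (similitude_isotropic sV (isotropic10 char_k)).
exists p => //; rewrite /ptv ev_inf25 -[veronese 1 0](mulKVmx uN) e.
by rewrite -!scalemxAr pt_scale.
Qed.

(** By [block0_cover], read in a frame of the component, some conic of the component passes through
    [inf25]. A second contact point puts it in the form of [tt_conic_two_points] with [p = inf25],
    so it is the conic of a head. *)
Lemma calD_heads : calD F = (fun h => (fun A => conic A) @` [set` block h]) @` [set` heads].
Proof.
apply/seteqP; split=> [_ [Q tQ ->]|_ [h hh <-]]; last first.
  have sh : similitude char_k (em h) by apply: simil_heads.
  by exists (conic h); [apply: tt_conic_similitude | rewrite component_block].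
have [N sN eQ] := tt_conic_classification char_k uW c0 tQ.
have [p hp ep] := points25_cover sN.
have /hasP[g hg pg] := allP block0_cover p hp.
have sg := simil_block0 char_k theta2 hg.
pose Q' := conic_points (W *m N *m em g).
have QQ' : component (tt_conics F) (adjG F) Q Q'.
  by rewrite eQ (component_similitude theta2 uW c0 sN); exists g.
have tQ' : tt_conics F Q'.
  by rewrite /Q' -mulmxA; apply: (tt_conic_similitude uW c0); apply: similitudeM.
have uWN : W *m N \in unitmx by rewrite unitmx_mul uW similitude_unit.
have zQ' : Q' `&` zeros F = ptv (W *m N) @` [set` six g].
  have [d d0 ->] := frame_change uW c0 sN.
  exact: conic_zeros_six.
have us := six_uniq char_k theta2 (similitude_unit sg).
have ps : p \in six g by case/hasP: pg => v vs; rewrite eqvE => /eqP ->.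
have [q qs qp] : exists2 q, q \in six g & q != p.
  have n : nth zerov (six g) 0 != nth zerov (six g) 1 by rewrite nth_uniq.
  have [e|e] := eqVneq (nth zerov (six g) 0) p; last first.
    by exists (nth zerov (six g) 0); rewrite // mem_nth.
  by exists (nth zerov (six g) 1); rewrite ?mem_nth // -e eq_sym.
have zP : (Q' `&` zeros F) (ptv W inf25).
  by rewrite zQ' -ep mulmxA; exists p.
have zP' : (Q' `&` zeros F) (ptv (W *m N) q) by rewrite zQ'; exists q.
have nP : ptv W inf25 <> ptv (W *m N) q.
  rewrite -ep mulmxA => /(ptv_inj char_k theta2 uWN) e.
  have nrm v : v \in six g -> normal v.
    exact: (normal_six char_k theta2 (similitude_unit sg)).
  by rewrite e ?eqxx // in qp; apply: nrm.
have [p0 [w [b [[hp0 hw hb] [e0 _ eQ']]]]] :=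
  tt_conic_two_points char_k theta2 uW c0 tQ' zP zP' nP.
have e1 : inf25 = p0.
  exact: (ptv_inj char_k theta2 uW normal_inf25 (normal_points25 hp0) e0).
move: eQ'; rewrite -e1 -[transport inf25]/idm.
have sA : similitude char_k (em (mulm idm (mulm (unip w) (torus b)))).
  have [sw _ _] := affine_unip char_k theta2 hw.
  apply: similitude_mulm => //; first exact: similitude_idm.
  apply: similitude_mulm => //.
  exact: (simil25P char_k theta2 (allP torus_check b hb)).
have /hasP[h hh same] := heads_completeP hw hb.
have sh : similitude char_k (em h) by apply: simil_heads.
rewrite ((same_sixP theta2 uW sA sh).1 same) => eQ'.
by exists h; rewrite // (component_joined QQ') eQ' component_block.
Qed.

End Heads.

(** * Types *)

Section ImageFilter.
Variables (I : eqType) (T : Type) (f : I -> T) (s : seq I).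
Hypotheses (us : uniq s) (fi : {in s &, injective f}).
Implicit Types p q : pred I.

Lemma image_filter p (P : T -> Prop) : (forall i, i \in s -> (P (f i) <-> p i)) ->
  [set y | (f @` [set` s]) y /\ P y] = f @` [set` [seq i <- s | p i]].
Proof.
move=> h; apply/seteqP; split=> y.
  case=> -[i si <-] Pi; have si' : i \in s := si; exists i => //.
  change (is_true (i \in [seq i <- s | p i])); rewrite mem_filter si' andbT.
  exact/(h _ si').
case=> i ip <-; have : i \in [seq i <- s | p i] := ip.
rewrite mem_filter => /andP[pi si]; split; first by exists i.
exact/(h _ si).
Qed.

Lemma image_filterU p q : f @` [set` [seq i <- s | p i]] `|` f @` [set` [seq i <- s | q i]] =
  f @` [set` [seq i <- s | p i || q i]].
Proof.
have mem r i : [set` [seq i <- s | r i]] i <-> r i /\ i \in s.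
  by rewrite /mkset /= mem_filter; split=> [/andP|] // [-> ->].
rewrite -image_setU; congr (image _ f); apply/seteqP; split=> i.
  by case=> /mem[pi si]; apply/mem; rewrite pi ?orbT.
by move/mem=> [/orP[pi|qi] si]; [left | right]; apply/mem.
Qed.

Lemma image_filter_all p :
  f @` [set` s] = f @` [set` [seq i <- s | p i]] <-> all p s.
Proof.
split=> [e|/all_filterP -> //]; apply/allP => i si.
have : (f @` [set` s]) (f i) by exists i.
rewrite e => -[j jp]; have : j \in [seq i <- s | p i] := jp.
by rewrite mem_filter => /andP[pj sj] /(fi sj si) <-.
Qed.

Lemma card_image_filter p n :
  (f @` [set` [seq i <- s | p i]]) #= `I_n <-> count p s = n.
Proof.
have h : (f @` [set` [seq i <- s | p i]]) #= `I_(count p s).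
  rewrite -size_filter; apply: card_image_seq; first exact: filter_uniq.
  by move=> i j; rewrite !mem_filter => /andP[_ si] /andP[_ sj]; apply: fi.
by split=> [|<- //]; apply: card_eq_unique.
Qed.

End ImageFilter.

Definition common_points (A B : mat) : nat := count (mem (six B)) (six A).

Definition is_type (t : ttype) (m : seq nat) : bool :=
  match t with
  | alpha => [&& all (fun n => (n == 2%N) || (n == 0%N)) m,
      count (pred1 2%N) m == 3%N & count (pred1 0%N) m == 18%N]
  | beta => [&& all (fun n => (n == 2%N) || (n == 1%N) || (n == 0%N)) m,
      count (pred1 2%N) m == 1%N, count (pred1 1%N) m == 4%N & count (pred1 0%N) m == 16%N]
  | gamma => [&& all (fun n => (n == 1%N) || (n == 0%N)) m,
      count (pred1 1%N) m == 6%N & count (pred1 0%N) m == 15%N]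
  end.

Definition type25 (h : mat) (t : ttype) (A : mat) : bool :=
  is_type t [seq common_points A B | B <- block h].

(** The 21 entries give different conics, so subsets of a component may be counted on the list. *)
Lemma block0_distinct :
  pairwise (fun g g' => ~~ same_six g g' && ~~ same_six g' g) block0.
Proof. by vm_compute. Qed.

Section Types.
Variable k : closedFieldType.
Hypothesis char_k : 5%N \in [pchar k].
Variable theta : k.
Hypothesis theta2 : theta ^+ 2 = 2%:R.
Local Notation ev := (ev theta).
Local Notation em := (em theta).
Local Notation ptv := (ptv theta).
Variables (W : 'M[k]_3) (c : k).
Hypotheses (uW : W \in unitmx) (c0 : c != 0).
Local Notation F := (c *: herm_form W).
Local Notation conic := (fun A => conic_points (W *m em A)).
Local Notation comp h := (conic @` [set` block h]).

Lemma card_common_points A B : similitude char_k (em A) -> similitude char_k (em B) ->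
  (conic A `&` conic B `&` zeros F) #= `I_(common_points A B).
Proof.
move=> sA sB.
have -> : conic A `&` conic B `&` zeros F =
    (conic A `&` zeros F) `&` (conic B `&` zeros F).
  by rewrite setIACA setIid.
rewrite !(conic_zeros_six theta2 uW c0) //.
have -> : common_points A B = size (undup [seq x <- six A | x \in six B]).
  rewrite undup_id ?size_filter //; apply: filter_uniq.
  exact: (six_uniq char_k theta2 (similitude_unit sA)).
apply: card_image_undup => u v; rewrite !mem_cat => hu hv.
apply: (ptv_inj char_k theta2 uW).
- by case/orP: hu; apply: (normal_six char_k theta2); apply: similitude_unit.
- by case/orP: hv; apply: (normal_six char_k theta2); apply: similitude_unit.
Qed.

Lemma block_inj h : similitude char_k (em h) ->
  uniq (block h) /\ {in block h &, injective conic}.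
Proof.
move=> sh; have uWh : W *m em h \in unitmx by rewrite unitmx_mul uW similitude_unit.
have inj g g' : g \in block0 -> g' \in block0 ->
    conic (mulm h g) = conic (mulm h g') -> g = g'.
  move=> hg hg'; rewrite !(em_mulm char_k theta2) !mulmxA => e.
  apply/eqP; apply: contraT => n.
  have C : ssrbool.symmetric (fun g g' => ~~ same_six g g' && ~~ same_six g' g).
    by move=> ? ?; rewrite andbC.
  have /andP[/negP[]] := pairwise_neq C block0_distinct hg hg' n.
  apply/(same_sixP theta2 uWh) => //; exact: (simil_block0 char_k theta2).
split; last first.
  by move=> _ _ /mapP[g hg ->] /mapP[g' hg' ->] e; rewrite (inj _ _ hg hg' e).
rewrite map_inj_in_uniq; last by move=> g g' hg hg' e; apply: inj => //; rewrite e.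
rewrite uniq_pairwise; apply: sub_pairwise block0_distinct => g g'.
apply: contraTneq => ->; rewrite negb_and !negbK orbb /same_six.
by apply/allP => v vs; apply/hasP; exists v; rewrite ?eqvE.
Qed.

Lemma has_tE h A t : similitude char_k (em h) -> similitude char_k (em A) ->
  has_t F (conic A) (comp h) t <-> type25 h t A.
Proof.
move=> sh sA; have [ub ib] := block_inj sh.
have N n : conics_meeting F (conic A) (comp h) n =
    conic @` [set` [seq B <- block h | common_points A B == n]].
  apply: image_filter => B hB; have sB := simil_block theta2 sh hB.
  have cAB := card_common_points sA sB.
  by split=> [e|/eqP <- //]; apply/eqP; apply: card_eq_unique cAB e.
rewrite /type25 /is_type /has_t; case: t; lazy beta iota zeta;
  rewrite !N ?image_filterU all_map !count_map.
- split.
    case=> /(image_filter_all ib) h1 /(card_image_filter ub ib) h2.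
    move=> /(card_image_filter ub ib) h3; apply/and3P.
    by split; [exact: h1 | exact/eqP/h2 | exact/eqP/h3].
  by case/and3P=> h1 /eqP h2 /eqP h3; split;
    [exact/(image_filter_all ib) | exact/(card_image_filter ub ib)
    | exact/(card_image_filter ub ib)].
- split.
    case=> /(image_filter_all ib) h1 /(card_image_filter ub ib) h2.
    move=> /(card_image_filter ub ib) h3 /(card_image_filter ub ib) h4.
    by apply/and4P; split; [exact: h1 | exact/eqP/h2 | exact/eqP/h3 | exact/eqP/h4].
  by case/and4P=> h1 /eqP h2 /eqP h3 /eqP h4; split;
    [exact/(image_filter_all ib) | exact/(card_image_filter ub ib)
    | exact/(card_image_filter ub ib) | exact/(card_image_filter ub ib)].
- split.
    case=> /(image_filter_all ib) h1 /(card_image_filter ub ib) h2.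
    move=> /(card_image_filter ub ib) h3; apply/and3P.
    by split; [exact: h1 | exact/eqP/h2 | exact/eqP/h3].
  by case/and3P=> h1 /eqP h2 /eqP h3; split;
    [exact/(image_filter_all ib) | exact/(card_image_filter ub ib)
    | exact/(card_image_filter ub ib)].
Qed.

Lemma has_TE h h' t : similitude char_k (em h) -> similitude char_k (em h') ->
  has_T F (comp h) (comp h') t <->
  match t with
  | beta21 => all (type25 h' beta) (block h)
  | gamma21 => all (type25 h' gamma) (block h)
  | alpha15gamma6 => [&& all (fun A => type25 h' alpha A || type25 h' gamma A) (block h),
      count (type25 h' alpha) (block h) == 15%N & count (type25 h' gamma) (block h) == 6%N]
  | alpha3gamma18 => [&& all (fun A => type25 h' alpha A || type25 h' gamma A) (block h),
      count (type25 h' alpha) (block h) == 3%N & count (type25 h' gamma) (block h) == 18%N]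
  end.
Proof.
move=> sh sh'; have [ub ib] := block_inj sh.
have N s : [set Q | comp h Q /\ has_t F Q (comp h') s] =
    conic @` [set` [seq A <- block h | type25 h' s A]].
  apply: image_filter => A hA; apply: has_tE => //; exact: (simil_block theta2 sh hA).
rewrite /has_T; case: t; lazy beta iota zeta; rewrite !N ?image_filterU.
- exact: (image_filter_all ib).
- exact: (image_filter_all ib).
- split.
    case=> /(image_filter_all ib) h1 /(card_image_filter ub ib) h2.
    move=> /(card_image_filter ub ib) h3; apply/and3P.
    by split; [exact: h1 | exact/eqP/h2 | exact/eqP/h3].
  by case/and3P=> h1 /eqP h2 /eqP h3; split;
    [exact/(image_filter_all ib) | exact/(card_image_filter ub ib)
    | exact/(card_image_filter ub ib)].
- split.
    case=> /(image_filter_all ib) h1 /(card_image_filter ub ib) h2.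
    move=> /(card_image_filter ub ib) h3; apply/and3P.
    by split; [exact: h1 | exact/eqP/h2 | exact/eqP/h3].
  by case/and3P=> h1 /eqP h2 /eqP h3; split;
    [exact/(image_filter_all ib) | exact/(card_image_filter ub ib)
    | exact/(card_image_filter ub ib)].
Qed.

End Types.

(** * Types by tabulation of the isotropic points *)

Inductive five (A : Type) := Five of A & A & A & A & A.
Definition five_const A (a : A) : five A := Five a a a a a.
Definition five_get A (t : five A) (x : F5) : A := let: Five a b c d e := t in
  match x with f0 => a | f1 => b | f2 => c | f3 => d | f4 => e end.
Definition five_map A (t : five A) (x : F5) (u : A -> A) : five A :=
  let: Five a b c d e := t in
  match x with
  | f0 => Five (u a) b c d e | f1 => Five a (u b) c d e | f2 => Five a b (u c) d e
  | f3 => Five a b c (u d) e | f4 => Five a b c d (u e)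
  end.

(* Labels of the isotropic points: one for [inf25], and a trie on the coordinates
   [(x, y)] of the points [(x, y, 1)]. *)
Definition table : Type := F25 * five (five (five (five F25))).
Definition lookup (t : table) (v : vec) : F25 := let: (x, y, z) := v in
  if isz z then t.1
  else five_get (five_get (five_get (five_get t.2 x.1) x.2) y.1) y.2.
Definition update (t : table) (v : vec) (l : F25) : table := let: (x, y, z) := v in
  if isz z then (l, t.2)
  else (t.1, five_map t.2 x.1 (fun t => five_map t x.2
    (fun t => five_map t y.1 (fun t => five_map t y.2 (fun => l))))).

(** Names for the 21 conics of a block; elements of F_25 are used because their equality test is
    cheap. *)
Definition labels : seq F25 := take 21 all25.
(** The default entry [zero25] is itself a label; [tabulate_check] verifies that no isotropic point
    carries it wrongly. *)
Definition tabulate (ss : seq (seq vec)) : table :=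
  foldl (fun t ls => foldl (fun t v => update t v ls.1) t ls.2)
    (zero25, five_const (five_const (five_const (five_const zero25)))) (zip labels ss).
Definition sixes (h : mat) : seq (seq vec) := [seq six g | g <- block h].

Definition occurrences (x : F25) (L : seq F25) : nat :=
  foldr (fun y n => if eq25 x y then n.+1 else n) 0%N L.
Fixpoint equal_pairs (L : seq F25) : nat :=
  if L is x :: L' then (occurrences x L' + equal_pairs L')%N else 0%N.

(* 0, 1, 2 encode gamma, beta, alpha. The number of pairs of equal labels determines
   the multiplicities, except that 2 + 2 + 2 and 3 + 1 + 1 + 1 both give three pairs. *)
Definition type_code (L : seq F25) : nat :=
  match equal_pairs L with
  | 0 => 0
  | 1 => 1
  | 3 => if all (fun x => match occurrences x L with 2 => true | _ => false end) L
    then 2 else 3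
  | _ => 3
  end%N.
(* 1 and 2 encode beta21 and alpha15gamma6; 0 stands for everything else. *)
Definition pair_code (ss : seq (seq vec)) (t : table) : nat :=
  let s := [seq type_code [seq lookup t v | v <- b] | b <- ss] in
  (if all (fun n => match n with 1 => true | _ => false end) s then 1
  else if all (fun n => match n with 0 | 2 => true | _ => false end) s
    && (count (fun n => match n with 0 => true | _ => false end) s == 6)
  then 2 else 0)%N.

Definition pair_codes : seq (seq nat) :=
  let bs := [seq sixes h | h <- heads] in let ts := [seq tabulate ss | ss <- bs] in
  [seq [seq pair_code ss t | t <- ts] | ss <- bs].

(** The evaluated matrix is kept as a constant, so that the graph checks below do not recompute the
    types. *)
Definition codes := Eval vm_compute in pair_codes.

Lemma codesE : pair_codes = codes.
Proof. by vm_compute. Qed.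

(** The hexads of a block partition the isotropic points: each point lies on the conic whose label
    it carries and on no other. *)
Lemma tabulate_check : all (fun h => let ss := sixes h in let t := tabulate ss in
  all (fun p => let l := lookup t p in has (eq25 l) labels &&
    all (fun ls => has (eqv p) ls.2 == eq25 l ls.1) (zip labels ss)) points25) heads.
Proof. by vm_compute. Qed.

Lemma occurrencesE x L : occurrences x L = count_mem x L.
Proof. by elim: L => //= y L ->; rewrite eq25E eq_sym; case: eqP. Qed.

Lemma sum_delta (ls : seq F25) x (f : F25 -> nat) : uniq ls -> x \in ls ->
  (\sum_(l <- ls) (x == l) * f l = f x)%N.
Proof.
move=> uls xl; rewrite (bigD1_seq x) //= eqxx mul1n big1 ?addn0 // => l.
by rewrite eq_sym => /negbTE ->.
Qed.

Lemma sum_occurrences (ls L : seq F25) : uniq ls -> {subset L <= ls} ->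
  (\sum_(l <- ls) count_mem l L = size L)%N.
Proof.
move=> uls; elim: L => [|x L IH] sub; first by rewrite big1.
have xl : x \in ls by apply: sub; rewrite mem_head.
rewrite /= big_split /= IH => [|y yL]; last by apply: sub; rewrite in_cons yL orbT.
have := sum_delta (fun=> 1%N) uls xl; under eq_bigr do rewrite muln1.
by move=> ->; rewrite add1n.
Qed.

(** Pairs of equal entries are grouped by their common value. *)
Lemma sum_pairs (ls L : seq F25) : uniq ls -> {subset L <= ls} ->
  (\sum_(l <- ls) 'C(count_mem l L, 2) = equal_pairs L)%N.
Proof.
move=> uls; elim: L => [|x L IH] sub; first by rewrite big1.
have xl : x \in ls by apply: sub; rewrite mem_head.
rewrite /= -IH => [|y yL]; last by apply: sub; rewrite in_cons yL orbT.
rewrite occurrencesE -(sum_delta (fun l => count_mem l L) uls xl) -big_split /=.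
apply: eq_bigr => l _; case: (x == l) => /=; last by rewrite mul0n.
by rewrite add1n binS bin1 mul1n addnC.
Qed.

(** Here [r], [s] and [t] account for the entries at least 3: their number, their sum and their
    contribution in pairs. Each gives at least three pairs, and this inequality turns the case
    analyses on types into linear arithmetic. *)
Lemma multiplicities (ms : seq nat) : exists r s t,
  [/\ size ms = count (pred1 0) ms + count (pred1 1) ms + count (pred1 2) ms + r,
      sumn ms = count (pred1 1) ms + 2 * count (pred1 2) ms + s,
      \sum_(n <- ms) 'C(n, 2) = count (pred1 2) ms + t,
      3 * r <= t & r = 0 -> s = 0 /\ t = 0]%N.
Proof.
elim: ms => [|n ms [r [s [t [e1 e2 e3 h1 h2]]]]].
  by exists 0%N, 0%N, 0%N; rewrite big_nil.
rewrite big_cons e3 /= e1 e2; move: (count _ ms) (count _ ms) (count _ ms) => a b d.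
case: n => [|[|[|n]]] /=; rewrite ?bin0n ?binn ?(@bin_small 1 2) //.
- by exists r, s, t; split=> //; lia.
- by exists r, s, t; split=> //; lia.
- by exists r, s, t; split=> //; lia.
exists r.+1, (s + n.+3)%N, (t + 'C(n.+3, 2))%N; split=> //; try lia.
rewrite binS bin1 binS bin1; lia.
Qed.

Lemma all_pred2 a b (ms : seq nat) : a != b ->
  all (fun n => (n == a) || (n == b)) ms =
  (count (pred1 a) ms + count (pred1 b) ms == size ms)%N.
Proof.
move=> ab; rewrite all_count -(count_predUI (pred1 a) (pred1 b)).
rewrite [X in (_ + X)%N](_ : _ = 0%N) ?addn0 //.
apply/eqP; rewrite -leqn0 leqNgt -has_count; apply/hasPn => n _ /=.
by apply/andP => -[/eqP -> ]; apply/negP.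
Qed.

Lemma all_pred3 a b c (ms : seq nat) : a != b -> a != c -> b != c ->
  all (fun n => (n == a) || (n == b) || (n == c)) ms =
  (count (pred1 a) ms + count (pred1 b) ms + count (pred1 c) ms == size ms)%N.
Proof.
move=> ab ac bc; rewrite all_count -(count_predUI (pred1 a) (pred1 b)).
rewrite [X in (_ + X + _)%N](_ : _ = 0%N) ?addn0; last first.
  apply/eqP; rewrite -leqn0 leqNgt -has_count; apply/hasPn => n _ /=.
  by apply/andP => -[/eqP -> ]; apply/negP.
rewrite -(count_predUI _ (pred1 c)) [X in (_ + X)%N](_ : _ = 0%N) ?addn0 //.
apply/eqP; rewrite -leqn0 leqNgt -has_count; apply/hasPn => n _ /=.
by apply/andP => -[/orP[] /eqP ->]; apply/negP.
Qed.

(** The 21 multiplicities have sum 6. No equal pair means that all are at most 1 (gamma), one pair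
    that exactly one is 2 (beta), and three pairs mean 2 + 2 + 2 (alpha) unless some label occurs
    three times. *)
Lemma type_codeP L : size L = 6%N -> {subset L <= labels} ->
  let ms := [seq count_mem l L | l <- labels] in
  [/\ is_type gamma ms = (type_code L == 0%N), is_type beta ms = (type_code L == 1%N)
    & is_type alpha ms = (type_code L == 2%N)].
Proof.
move=> sL sub ms; have uls : uniq labels by [].
have [r [s [t [e1 e2 e3 h1 h2]]]] := multiplicities ms.
have z1 : size ms = 21%N by rewrite size_map.
have z2 : sumn ms = 6%N by rewrite sumnE big_map sum_occurrences.
have z3 : (\sum_(n <- ms) 'C(n, 2) = equal_pairs L)%N by rewrite big_map sum_pairs.
have all2 : is_type alpha ms =
    (equal_pairs L == 3%N) && all (fun x => occurrences x L == 2%N) L.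
  apply/idP/andP.
    case/and3P=> h c2 c0; split; first by apply/eqP; lia.
    apply/allP => x xL; rewrite occurrencesE.
    have := allP h _ (map_f (fun l => count_mem l L) (sub _ xL)).
    by case/orP=> //; rewrite -leqn0 leqNgt -has_count has_pred1 xL.
  case=> /eqP p3 /allP h.
  have h' : all (fun n => (n == 2%N) || (n == 0%N)) ms.
    rewrite all_map; apply/allP => l _ /=; case lL: (l \in L).
      by have := h l lL; rewrite occurrencesE => ->.
    by rewrite orbC; apply/orP; left; rewrite -leqn0 leqNgt -has_count has_pred1 lL.
  rewrite /is_type h'; move: h'; rewrite all_pred2 // => /eqP h'.
  by apply/andP; split; apply/eqP; lia.
have g0 : is_type gamma ms = (equal_pairs L == 0%N).
  by rewrite /is_type all_pred2 //; apply/idP/eqP => [/and3P[/eqP ? /eqP ? /eqP ?]|?];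
    [lia | apply/and3P; split; apply/eqP; lia].
have b0 : is_type beta ms = (equal_pairs L == 1%N).
  rewrite /is_type all_pred3 //; apply/idP/eqP.
    by case/and4P=> /eqP ? /eqP ? /eqP ? /eqP ?; lia.
  by move=> ?; apply/and4P; split; apply/eqP; lia.
rewrite all2 g0 b0 /type_code; case: (equal_pairs L) => [|[|[|[|n]]]] //.
have -> : all (fun x => match occurrences x L with 2%N => true | _ => false end) L =
    all (fun x => occurrences x L == 2%N) L.
  by apply: eq_all => x; case: (occurrences x L) => [|[|[]]].
by case: all.
Qed.

Lemma size_block h : size (block h) = 21%N.
Proof. by rewrite size_map. Qed.

(** Once all 21 codes are 0 or 2, six zeros force fifteen twos, which is why [pair_code] counts only
    the zeros. *)
Lemma pair_codeE ss t : size ss = 21%N ->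
  let cs := [seq type_code [seq lookup t v | v <- b] | b <- ss] in
  [/\ (pair_code ss t == 1)%N = all (pred1 1%N) cs
    & (pair_code ss t == 2)%N = [&& all (fun n => (n == 2) || (n == 0)) cs,
        count (pred1 2) cs == 15 & count (pred1 0) cs == 6]]%N.
Proof.
move=> s21; have : size [seq type_code [seq lookup t v | v <- b] | b <- ss] = 21%N.
  by rewrite size_map.
rewrite /pair_code; move: [seq type_code _ | _ <- _] => cs s21' /=.
have e1 : all (fun n => match n with 1%N => true | _ => false end) cs = all (pred1 1%N) cs.
  by apply: eq_all => -[|[]].
have e2 : all (fun n => match n with 0%N | 2%N => true | _ => false end) cs =
    all (fun n => (n == 2%N) || (n == 0%N)) cs.
  by apply: eq_all => -[|[|[]]].
have e3 : count (fun n => match n with 0%N => true | _ => false end) cs = count (pred1 0%N) cs.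
  by apply: eq_count => -[].
rewrite e1 e2 e3 all_pred2 // s21' all_count s21'.
have : (count (pred1 0%N) cs + count (pred1 1%N) cs <= 21)%N.
  by have [r [s [? [h _ _ _ _]]]] := multiplicities cs; lia.
move: (count _ cs) (count _ cs) (count _ cs) => a b d h.
have [ha|ha] := altP (a =P 21%N).
  by split=> //; apply/esym/negbTE/negP => /and3P[_ _ /eqP]; lia.
have [hd|hd] := altP ((d + b)%N =P 21%N); last by split.
have [hb|hb] := altP (b =P 6%N); last by rewrite !andbF; split.
by split=> //; rewrite andbT; apply/esym/eqP; lia.
Qed.

Section PairCodes.
Variable k : closedFieldType.
Hypothesis char_k : 5%N \in [pchar k].
Variable theta : k.
Hypothesis theta2 : theta ^+ 2 = 2%:R.
Local Notation ev := (ev theta).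
Local Notation em := (em theta).
Local Notation frob := (map_mx (pFrobenius_aut char_k)).
Local Notation J := (herm_mx k).

Lemma isotropic_veronese s t : s ^+ 5 = s -> t ^+ 5 = t ->
  ((veronese s t : 'cV[k]_3)^T *m J *m frob (veronese s t)) 0 0 = 0.
Proof.
move=> hs ht; have e : (1%:M : 'M[k]_3)^T *m J *m frob 1%:M = 1 *: J.
  by rewrite trmx1 mul1mx map_mx1 mulmx1 scale1r.
by have := herm_conic s t e; rewrite /= mul1mx hs ht => ->; ring.
Qed.

(** A similitude carries the isotropic points of the standard conic over F_5 to isotropic points,
    and its entries lie in F_25. *)
Lemma six_points25 A v : similitude char_k (em A) -> v \in six A -> v \in points25.
Proof.
move=> sA /mapP[u /(nthP zerov)[i hi <-] ->].
have uA := similitude_unit sA; have [h1 h2] := line5_fixed char_k i.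
have eu := ev_base6 char_k theta hi.
have iso := similitude_isotropic sA (isotropic_veronese h1 h2).
rewrite -eu -(em_matv char_k theta2) in iso.
have n0 := matv_neq0 char_k theta2 uA (base6_neq0 hi).
set x := matv A _ in iso n0 *.
have fv : frob (frob (ev x)) = ev x.
  rewrite (em_matv char_k theta2) eu !map_mxM (similitude_frob sA) !frob_veronese.
  by rewrite !h1 !h2.
have v0 : ev x != 0 by rewrite (ev_eq0 char_k theta2).
have [p [hp [l l0 e]]] := isotropic_point theta2 fv v0 iso.
rewrite (normv_eq char_k theta2 l0 e).
by have /andP[/eqP -> _] := normal_points25 hp.
Qed.

(** By the partition property, the contact points shared by [A] and a conic of the block are those
    of [A] carrying the label of that conic. *)
Lemma common_labels h' A : h' \in heads -> similitude char_k (em A) ->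
  let L := [seq lookup (tabulate (sixes h')) v | v <- six A] in
  {subset L <= labels} /\
  [seq common_points A B | B <- block h'] = [seq count_mem l L | l <- labels].
Proof.
move=> hh' sA L; have := allP tabulate_check h' hh'; lazy beta zeta => /allP ok.
have okA v : v \in six A -> _ := fun vA => ok v (six_points25 sA vA).
split.
  move=> _ /mapP[v vA ->]; have /andP[/hasP[l ll]] := okA v vA.
  by rewrite eq25E => /eqP ->.
have sz : size labels = size (sixes h') by rewrite size_map size_block.
have -> : [seq common_points A B | B <- block h'] =
    [seq count (mem s) (six A) | s <- sixes h'] by rewrite -map_comp.
have e1 : sixes h' = [seq ls.2 | ls <- zip labels (sixes h')].
  by rewrite -/(unzip2 _) unzip2_zip // sz.
have e2 : labels = [seq ls.1 | ls <- zip labels (sixes h')].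
  by rewrite -/(unzip1 _) unzip1_zip // sz.
rewrite [in RHS]e2 {1}e1 -!map_comp; apply/eq_in_map => ls hls.
change (count (mem ls.2) (six A) = count_mem ls.1 L).
rewrite /L [in RHS]count_map; apply: eq_in_count => v vA.
change ((v \in ls.2) = (lookup (tabulate (sixes h')) v == ls.1)).
have /andP[_ /allP/(_ ls hls)/eqP] := okA v vA.
rewrite eq25E => <-; apply/idP/hasP => [vs|[u us]]; first by exists v; rewrite ?eqvE.
by rewrite eqvE => /eqP ->.
Qed.

Lemma pair_codeP h h' : h \in heads -> h' \in heads ->
  let b := pair_code (sixes h) (tabulate (sixes h')) in
  [/\ (b == 1)%N = all (type25 h' beta) (block h)
    & (b == 2)%N =
      [&& all (fun A => type25 h' alpha A || type25 h' gamma A) (block h),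
        count (type25 h' alpha) (block h) == 15%N & count (type25 h' gamma) (block h) == 6%N]].
Proof.
move=> hh hh' b.
have sz : size (sixes h) = 21%N by rewrite size_map size_block.
have [e1 e2] := pair_codeE (tabulate (sixes h')) sz.
have sh : similitude char_k (em h) by apply: simil_heads.
pose L A := [seq lookup (tabulate (sixes h')) v | v <- six A].
have tc A : A \in block h ->
    [/\ type25 h' gamma A = (type_code (L A) == 0%N),
        type25 h' beta A = (type_code (L A) == 1%N)
      & type25 h' alpha A = (type_code (L A) == 2%N)].
  move=> hA; have sA := simil_block theta2 sh hA.
  have [sub e] := common_labels hh' sA; rewrite /type25 e.
  by apply: type_codeP => //; rewrite size_map.
have ecs : [seq type_code [seq lookup (tabulate (sixes h')) v | v <- b] | b <- sixes h] =
    [seq type_code (L A) | A <- block h] by rewrite /sixes -map_comp.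
rewrite /b e1 e2 ecs; move: (block h) tc => s tc; rewrite !all_map !count_map; split.
  by apply: eq_in_all => A /tc[_ -> _].
congr andb; first by apply: eq_in_all => A /tc[-> _ ->].
congr andb; [congr (_ == _) | congr (_ == _)].
- by apply: eq_in_count => A /tc[_ _ ->].
- by apply: eq_in_count => A /tc[-> _ _].
Qed.

End PairCodes.

(** * The graphs H and H' *)

(** Counts the positions true in both lists without building their conjunction. *)
Fixpoint both (r s : seq bool) : nat :=
  match r, s with
  | true :: r', true :: s' => (both r' s').+1
  | _ :: r', _ :: s' => both r' s'
  | _, _ => 0
  end.

Lemma all_iota p n : all p (iota 0 n) -> forall i, (i < n)%N -> p i.
Proof. by move=> /allP h i hi; apply: h; rewrite mem_iota. Qed.

(** * Graphs given by boolean adjacency rows *)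

Section FiniteGraph.

Definition meet (r s : seq bool) : seq bool := [seq p.1 && p.2 | p <- zip r s].

Lemma size_meet r s : size r = size s -> size (meet r s) = size r.
Proof. by move=> e; rewrite size_map size1_zip ?e. Qed.

Lemma nth_meet r s i : size r = size s ->
  nth false (meet r s) i = nth false r i && nth false s i.
Proof.
move=> e; have [hi|hi] := ltnP i (size r); last first.
  by rewrite !nth_default ?size_meet // -e.
rewrite (nth_map (false, false)); first by rewrite nth_zip.
by rewrite size_zip -e minnn.
Qed.

Lemma bothE r s : both r s = count id (meet r s).
Proof. by elim: r s => [|[] r IH] [|[] s] //=; rewrite IH. Qed.

(** Allows [srg_check] to restrict only one of the two rows to the mask [m]. *)
Lemma meet_absorb m r s : size m = size r -> size m = size s ->
  meet (meet m r) (meet m s) = meet (meet m r) s.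
Proof.
move=> er es; apply: (@eq_from_nth _ false); rewrite !size_meet -?es //.
by move=> i _; rewrite !nth_meet ?size_meet -?es //; case: nth.
Qed.

Variables (n : nat) (rows : seq (seq bool)) (T : Type) (D : nat -> T) (E : T -> T -> Prop).
Local Notation row i := (nth [::] rows i).
Definition adj i j := nth false (nth [::] rows i) j.

Definition graph_check : bool := (size rows == n) && all (fun r => size r == n) rows
  && all (fun i => ~~ adj i i && all (fun j => adj i j == adj j i) (iota 0 n)) (iota 0 n).

Hypothesis rows_ok : graph_check.
Hypothesis D_inj : {in iota 0 n &, injective D}.
Hypothesis D_adj : forall i j, (i < n)%N -> (j < n)%N -> (E (D i) (D j) <-> adj i j).

Lemma size_row i : (i < n)%N -> size (row i) = n.
Proof.
by case/andP: rows_ok => /andP[/eqP sr /allP h] _ hi; apply/eqP/h/mem_nth; rewrite sr.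
Qed.

Lemma adj_irr i : (i < n)%N -> ~~ adj i i.
Proof.
by case/andP: rows_ok => _ /all_iota h /h /andP[].
Qed.

Lemma adj_sym i j : (i < n)%N -> (j < n)%N -> adj i j = adj j i.
Proof.
by case/andP: rows_ok => _ /all_iota h /h /andP[_ /all_iota h'] /h' /eqP.
Qed.

(** Vertex sets are boolean masks, so that neighbourhoods and their intersections become
    conjunctions of lists. *)
Definition vertices (m : seq bool) : set T :=
  [set x | exists i, [/\ (i < n)%N, nth false m i & x = D i]].

Lemma vertices_D m i : (i < n)%N -> vertices m (D i) <-> nth false m i.
Proof.
move=> hi; split=> [[j [hj mj /D_inj e]]|mi]; last by exists i.
by rewrite e ?mem_iota.
Qed.

Lemma card_vertices m : size m = n -> vertices m #= `I_(count id m).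
Proof.
move=> sm; have -> : vertices m = D @` [set` [seq i <- iota 0 n | nth false m i]].
  apply/seteqP; split=> [_ [i [hi mi ->]]|_ [i im <-]].
    exists i => //; change (is_true (i \in [seq i <- iota 0 n | nth false m i])).
    by rewrite mem_filter mi mem_iota.
  have : i \in [seq i <- iota 0 n | nth false m i] := im.
  by rewrite mem_filter mem_iota => /andP[mi /andP[_ hi]]; exists i.
have -> : count id m = size [seq i <- iota 0 n | nth false m i].
  by rewrite size_filter -sm -{1}[m](mkseq_nth false) count_map.
apply: card_image_seq; first by rewrite filter_uniq ?iota_uniq.
by move=> i j; rewrite !mem_filter => /andP[_ hi] /andP[_ hj]; apply: D_inj.
Qed.

Lemma neighboursE m i : size m = n -> (i < n)%N ->
  neighbours (vertices m) E (D i) = vertices (meet m (row i)).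
Proof.
move=> sm hi; have sr := size_row hi.
apply/seteqP; split=> [_ [[j [hj mj ->]] /(D_adj hi hj) ij]|_ [j [hj + ->]]].
  by exists j; split=> //; rewrite nth_meet ?sr // mj.
rewrite nth_meet ?sr // => /andP[mj ij].
by split; [exists j | apply/D_adj].
Qed.

Lemma verticesI m m' : size m = size m' ->
  vertices m `&` vertices m' = vertices (meet m m').
Proof.
move=> e; apply/seteqP; split=> [x [[i [hi mi ex]]]|_ [i [hi + ->]]].
  by rewrite ex => /(vertices_D _ hi) m'i; exists i; rewrite nth_meet // mi.
by rewrite nth_meet // => /andP[mi m'i]; split; exists i.
Qed.

Lemma vertices_simple m : simple_graph (vertices m) E.
Proof.
split=> [_ [i [hi _ ->]]|_ _ [i [hi _ ->]] [j [hj _ ->]]].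
  by move/(D_adj hi hi); apply/negP/adj_irr.
by move/(D_adj hi hj) => h; apply/D_adj => //; rewrite adj_sym.
Qed.

Definition regular_check m d :=
  all (fun i => nth false m i ==> (both m (row i) == d)) (iota 0 n).

Lemma regular_checkP m d : size m = n -> regular_check m d ->
  regular_graph (vertices m) E d.
Proof.
move=> sm /all_iota h; split=> [|_ [i [hi mi ->]]]; first exact: vertices_simple.
have /implyP/(_ mi)/eqP <- := h i hi; rewrite bothE.
by rewrite neighboursE //; apply: card_vertices; rewrite size_meet ?size_row.
Qed.

Definition srg_check m v d l mu :=
  [&& count id m == v, regular_check m d &
    all (fun i => nth false m i ==> (let mi := meet m (row i) in
      all (fun j => nth false m j ==> (i == j) ||
        (both mi (row j) == if adj i j then l else mu)) (iota 0 n)))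
    (iota 0 n)].

Lemma srg_checkP m v d l mu : size m = n -> srg_check m v d l mu ->
  strongly_regular (vertices m) E v d l mu.
Proof.
move=> sm /and3P[/eqP cv reg /all_iota h].
have key i j : (i < n)%N -> (j < n)%N -> nth false m i -> nth false m j -> i != j ->
    (neighbours (vertices m) E (D i) `&` neighbours (vertices m) E (D j))
      #= `I_(if adj i j then l else mu).
  move=> hi hj mi mj ij; rewrite !neighboursE //.
  have si : size (meet m (row i)) = n by rewrite size_meet ?size_row.
  have sj : size (meet m (row j)) = n by rewrite size_meet ?size_row.
  have /implyP/(_ mi)/all_iota h' := h i hi.
  have /implyP/(_ mj) := h' j hj.
  rewrite (negbTE ij) => /eqP <-; rewrite bothE -meet_absorb ?size_row //.
  by rewrite verticesI ?si ?sj //; apply: card_vertices; rewrite size_meet ?si.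
split; first by rewrite -cv; apply: card_vertices.
- exact: regular_checkP.
- move=> _ _ [i [hi mi ->]] [j [hj mj ->]] /(D_adj hi hj) ij.
  have := key i j hi hj mi mj; rewrite ij; apply.
  by apply: contraTneq ij => <-; apply: adj_irr.
- move=> _ _ [i [hi mi ->]] [j [hj mj ->]] Dij nij.
  have := key i j hi hj mi mj; case: ifP => [/(D_adj hi hj)//|_]; apply.
  by apply: contra_not_neq Dij => ->.
Qed.

Local Notation V := (vertices (nseq n true)).

(** Paths of length at most 2 from a suitable vertex reach its whole component in each graph
    considered, so no search is required. *)
Definition within2 i j := [|| i == j, adj i j | has id (meet (row i) (row j))].

Lemma within2_joined i j : (i < n)%N -> (j < n)%N -> within2 i j -> joined V E (D i) (D j).
Proof.
move=> hi hj; have VD l : (l < n)%N -> V (D l) by move=> hl; exists l; rewrite nth_nseq hl.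
have step l l' : (l < n)%N -> (l' < n)%N -> adj l l' -> joined V E (D l) (D l').
  by move=> hl hl' a; apply: rst_step; split; [exact: VD | exact: VD | apply/D_adj].
case/or3P=> [/eqP ->|a|]; [exact: rst_refl | exact: step |].
have := size_row hi; have := size_row hj; move=> sj si.
case/(has_nthP false)=> l; rewrite size_meet ?si ?sj // => hl; rewrite nth_meet ?si ?sj //.
case/andP=> il jl; apply: (@rst_trans _ _ _ (D l)); first exact: step.
by apply: step; rewrite // adj_sym.
Qed.

Lemma connectedP i0 : (i0 < n)%N -> all (within2 i0) (iota 0 n) -> connected_graph V E.
Proof.
move=> h0 /all_iota h; split.
  by exists (D i0), i0; rewrite nth_nseq h0.
move=> _ _ [i [hi _ ->]] [j [hj _ ->]].
apply: (@rst_trans _ _ _ (D i0)); first by apply/rst_sym/within2_joined/h.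
by apply/within2_joined/h.
Qed.

(** One inclusion is the reachability of [m] from [r], the other the stability of [m] under
    adjacency. *)
Lemma componentP r m : size m = n -> (r < n)%N -> nth false m r ->
  all (fun j => nth false m j ==> within2 r j) (iota 0 n) ->
  all (fun i => nth false m i ==> all (fun j => adj i j ==> nth false m j) (iota 0 n))
    (iota 0 n) ->
  component V E (D r) = vertices m.
Proof.
move=> sm hr mr /all_iota h1 /all_iota h2; apply/seteqP; split=> x; last first.
  by case=> j [hj mj ->]; apply: within2_joined => //; apply/implyP: mj; apply: h1.
have step y z : V y -> V z -> E y z -> vertices m y -> vertices m z.
  move=> _ [j [hj _ ->]] + [i [hi mi ey]]; rewrite ey => /(D_adj hi hj) ij.
  have /implyP/(_ mi)/all_iota/(_ j hj)/implyP/(_ ij) mj := h2 i hi.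
  by exists j.
have : vertices m (D r) by exists r.
rewrite /component /= /joined => + xy; suff [] : vertices m (D r) <-> vertices m x by [].
elim: xy => {x} [y z [Vy Vz yz]|y|y z _ []|y z w _ h3 _ h4] //.
  split; first exact: step.
  by apply: step => //; case: (vertices_simple (nseq n true)) => _; apply.
by split=> [/h3/h4|/h4/h3].
Qed.

End FiniteGraph.

Definition rowsH : seq (seq bool) := [seq [seq n == 2%N | n <- r] | r <- codes].
Definition rowsH' : seq (seq bool) :=
  [seq [seq (n == 1%N) || (n == 2%N) | n <- r] | r <- codes].
(* The components of H have diameter 2; they are represented by 0, 50 and 75. *)
Definition class (r : nat) : seq bool := [seq within2 rowsH r j | j <- iota 0 150].
Definition rep (i : 'I_3) : nat := nth 0%N [:: 0; 50; 75]%N i.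

Lemma rowsH_check : graph_check 150 rowsH.
Proof. by vm_compute. Qed.

(** Distinctness of the rows serves to separate the 150 components in [component25_inj]. *)
Lemma rowsH'_check : graph_check 150 rowsH' && uniq rowsH'.
Proof. by vm_compute. Qed.

Lemma rowsH'_connected : all (within2 rowsH' 0) (iota 0 150).
Proof. by vm_compute. Qed.

Lemma rowsH'_regular : regular_check 150 rowsH' (nseq 150 true) 37.
Proof. by vm_compute. Qed.

Lemma class_closed : all (fun r => let m := class r in
  all (fun i => nth false m i ==> all (fun j => adj rowsH i j ==> nth false m j)
    (iota 0 150)) (iota 0 150)) [:: 0; 50; 75]%N.
Proof. by vm_compute. Qed.

Lemma class_cover :
  all (fun j => has (fun r => within2 rowsH r j) [:: 0; 50; 75]%N) (iota 0 150).
Proof. by vm_compute. Qed.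

Lemma class_disjoint : all (fun r => all (fun r' =>
  within2 rowsH r r' == (r == r')) [:: 0; 50; 75]%N) [:: 0; 50; 75]%N.
Proof. by vm_compute. Qed.

Definition join (r s : seq bool) : seq bool := [seq p.1 || p.2 | p <- zip r s].

(** The alternative [r' <= r] leaves each unordered pair of classes to be checked once. *)
Lemma classes_srg : all (fun r => all (fun r' => (r' <= r)%N ||
  srg_check 150 rowsH' (join (class r) (class r')) 100 22 0 6) [:: 0; 50; 75]%N)
  [:: 0; 50; 75]%N.
Proof. by vm_compute. Qed.

Lemma nth_class r j : (j < 150)%N -> nth false (class r) j = within2 rowsH r j.
Proof. by move=> hj; rewrite (nth_map 0%N) ?size_iota // nth_iota. Qed.

Lemma size_class r : size (class r) = 150%N.
Proof. by rewrite size_map size_iota. Qed.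

Lemma nth_join r s i : size r = size s ->
  nth false (join r s) i = nth false r i || nth false s i.
Proof.
move=> e; have [hi|hi] := ltnP i (size r); last first.
  by rewrite !nth_default ?size_map ?size_zip -?e ?minnn.
rewrite (nth_map (false, false)); first by rewrite nth_zip.
by rewrite size_zip -e minnn.
Qed.

Lemma nth_codes i j : (i < 150)%N -> (j < 150)%N ->
  nth 0%N (nth [::] codes i) j =
  pair_code (sixes (nth idm heads i)) (tabulate (sixes (nth idm heads j))).
Proof.
move=> hi hj; rewrite -codesE /pair_codes; lazy zeta.
have sz : size heads = 150%N := size_heads.
rewrite (nth_map [::]) ?size_map ?sz // (nth_map (tabulate [::])) ?size_map ?sz //.
by rewrite (nth_map [::]) ?size_map ?sz // !(nth_map idm) ?sz.
Qed.

(** A component has neither of the two adjacency types with respect to itself, so the condition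
    [D <> D'] follows from the type. *)
Lemma codes_diag_check : all (fun i => nth 0%N (nth [::] codes i) i == 0%N) (iota 0 150).
Proof. by vm_compute. Qed.

Lemma size_codes : (size codes == 150%N) && all (fun r => size r == 150%N) codes.
Proof. by vm_compute. Qed.

Lemma adj_codes (p : pred nat) i j : (i < 150)%N -> (j < 150)%N ->
  adj [seq [seq p n | n <- r] | r <- codes] i j = p (nth 0%N (nth [::] codes i) j).
Proof.
move=> hi hj; have /andP[/eqP sc /allP h] := size_codes.
have hr : nth [::] codes i \in codes by rewrite mem_nth ?sc.
rewrite /adj (nth_map [::]) ?sc // (nth_map 0%N) //.
by rewrite (eqP (h _ hr)).
Qed.

(** * Transfer to the graphs H and H' of components *)

Section Graphs.
Variable k : closedFieldType.
Hypothesis char_k : 5%N \in [pchar k].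
Variable theta : k.
Hypothesis theta2 : theta ^+ 2 = 2%:R.
Local Notation em := (em theta).
Variables (W : 'M[k]_3) (c : k).
Hypotheses (uW : W \in unitmx) (c0 : c != 0).
Local Notation F := (c *: herm_form W).
Local Notation conic := (fun A => conic_points (W *m em A)).

Definition component25 (i : nat) : set (set (ppoint k)) :=
  conic @` [set` block (nth idm heads i)].

Lemma calD_vertices : calD F = vertices 150 component25 (nseq 150 true).
Proof.
rewrite (calD_heads char_k theta2 uW c0); apply/seteqP; split.
  move=> _ [h hh <-]; have /(nthP idm)[i hi <-] : h \in heads := hh.
  by exists i; rewrite size_heads in hi; rewrite nth_nseq hi.
move=> _ [i [hi _ ->]]; exists (nth idm heads i) => //.
by change (is_true (nth idm heads i \in heads)); rewrite mem_nth ?size_heads.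
Qed.

Lemma has_T_codes i j : (i < 150)%N -> (j < 150)%N ->
  let code := nth 0%N (nth [::] codes i) j in
  (has_T F (component25 i) (component25 j) beta21 <-> code == 1%N) /\
  (has_T F (component25 i) (component25 j) alpha15gamma6 <-> code == 2%N).
Proof.
move=> hi hj code.
have hh l : (l < 150)%N -> nth idm heads l \in heads by move=> ?; rewrite mem_nth ?size_heads.
have sh l (hl : (l < 150)%N) := simil_heads char_k theta2 (hh l hl).
have [e1 e2] := pair_codeP char_k theta2 (hh i hi) (hh j hj).
rewrite /code nth_codes // e1 e2.
by split; apply: (has_TE theta2 uW c0 beta21 (sh i hi) (sh j hj)) ||
  apply: (has_TE theta2 uW c0 alpha15gamma6 (sh i hi) (sh j hj)).
Qed.

Lemma component25_neq i j : (i < 150)%N -> (j < 150)%N ->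
  has_T F (component25 i) (component25 j) beta21 \/
  has_T F (component25 i) (component25 j) alpha15gamma6 -> component25 i <> component25 j.
Proof.
move=> hi hj h e; rewrite -e in h; have [e1 e2] := has_T_codes hi hi.
have /eqP diag := all_iota codes_diag_check hi; rewrite diag in e1 e2.
by case: h => [/e1|/e2].
Qed.

Lemma adjH_component i j : (i < 150)%N -> (j < 150)%N ->
  adjH F (component25 i) (component25 j) <-> adj rowsH i j.
Proof.
move=> hi hj; rewrite adj_codes //; have [_ e2] := has_T_codes hi hj.
split=> [[_ /e2 //]|/e2 h]; split=> //.
by apply: component25_neq => //; right.
Qed.

Lemma adjH'_component i j : (i < 150)%N -> (j < 150)%N ->
  adjH' F (component25 i) (component25 j) <-> adj rowsH' i j.
Proof.
move=> hi hj; rewrite (adj_codes (fun n => (n == 1%N) || (n == 2%N))) //.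
have [e1 e2] := has_T_codes hi hj.
split=> [[_ [/e1 ->|/e2 ->]]|h]; rewrite ?orbT //.
have t : has_T F (component25 i) (component25 j) beta21 \/
    has_T F (component25 i) (component25 j) alpha15gamma6.
  by case/orP: h => h; [left; apply/e1 | right; apply/e2].
by split=> //; apply: component25_neq.
Qed.

(** Equal components would have the same neighbours in H', hence equal adjacency rows, and the rows
    are distinct. *)
Lemma component25_inj : {in iota 0 150 &, injective component25}.
Proof.
move=> i j; rewrite !mem_iota => /andP[_ hi] /andP[_ hj] e.
have /andP[/andP[/andP[/eqP sr /allP sz] _] ur] := rowsH'_check.
have szr l : (l < 150)%N -> size (nth [::] rowsH' l) = 150%N.
  by move=> hl; apply/eqP/sz/mem_nth; rewrite sr.
apply/eqP; rewrite -(nth_uniq [::] _ _ ur) ?sr //; apply/eqP.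
apply: (@eq_from_nth _ false); rewrite !szr // => l hl.
change (adj rowsH' i l = adj rowsH' j l).
by apply/idP/idP => /adjH'_component h; apply/adjH'_component => //; [rewrite -e | rewrite e];
  apply: h.
Qed.

Lemma calD_connected_regular : connected_graph (calD F) (adjH' F) /\
  regular_graph (calD F) (adjH' F) 37.
Proof.
have /andP[ok _] := rowsH'_check; rewrite calD_vertices; split.
  exact: (connectedP ok adjH'_component _ rowsH'_connected).
apply: (regular_checkP ok component25_inj adjH'_component _ rowsH'_regular).
by rewrite size_nseq.
Qed.

Definition classH (i : 'I_3) := vertices 150 component25 (class (rep i)).

Lemma rep_mem i : rep i \in [:: 0; 50; 75]%N.
Proof. by rewrite mem_nth. Qed.

Lemma rep_lt i : (rep i < 150)%N.
Proof. by case: i => [[|[|[|]]]]. Qed.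

Lemma rep_inj : injective rep.
Proof.
by case=> [[|[|[|]]] //= h] [[|[|[|]]] //= h'] // _; apply: val_inj.
Qed.

Lemma within2_rep i j : within2 rowsH (rep i) (rep j) = (i == j).
Proof.
have := allP (allP class_disjoint _ (rep_mem i)) _ (rep_mem j).
by move/eqP => ->; rewrite (inj_eq rep_inj).
Qed.

Lemma component_classH i :
  component (calD F) (adjH F) (component25 (rep i)) = classH i.
Proof.
rewrite calD_vertices; apply: (componentP rowsH_check adjH_component).
- exact: size_class.
- exact: rep_lt.
- by rewrite nth_class ?rep_lt // within2_rep.
- apply/allP => j; rewrite mem_iota => /andP[_ hj]; apply/implyP.
  by rewrite nth_class.
- exact: (allP class_closed _ (rep_mem i)).
Qed.

Lemma classH_srg i j : i != j -> is_Higman_Sims (classH i `|` classH j) (adjH' F).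
Proof.
wlog lt_ij : i j / (rep i < rep j)%N => [hw|_].
  move=> ij; have : rep i != rep j by rewrite (inj_eq rep_inj).
  rewrite neq_ltn => /orP[h|h]; first exact: hw.
  by rewrite setUC; apply: hw; rewrite // eq_sym.
have -> : classH i `|` classH j =
    vertices 150 component25 (join (class (rep i)) (class (rep j))).
  have sz : size (class (rep i)) = size (class (rep j)) by rewrite !size_class.
  apply/seteqP; split=> [x [] [l [hl ml ->]]|_ [l [hl + ->]]].
  - by exists l; split; rewrite // nth_join // ml.
  - by exists l; split; rewrite // nth_join // ml orbT.
  - by rewrite nth_join // => /orP[ml|ml]; [left | right]; exists l.
have /andP[ok _] := rowsH'_check.
apply: (srg_checkP ok component25_inj adjH'_component).
  by rewrite size_map size_zip !size_class.
have := allP (allP classes_srg _ (rep_mem i)) _ (rep_mem j).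
by rewrite leqNgt lt_ij.
Qed.

Lemma components_H : exists C : 'I_3 -> set (set (set (ppoint k))),
  [/\ injective C, range C = components (calD F) (adjH F)
    & forall i j : 'I_3, i != j -> is_Higman_Sims (C i `|` C j) (adjH' F)].
Proof.
exists classH; split; last exact: classH_srg.
- move=> i j e; have : classH i (component25 (rep i)).
    by apply/(vertices_D component25_inj _ (rep_lt i)); rewrite nth_class ?rep_lt ?within2_rep.
  rewrite e => /(vertices_D component25_inj _ (rep_lt i)).
  by rewrite nth_class ?rep_lt // within2_rep => /eqP.
apply/seteqP; split=> [_ [i _ <-]|_ [x + ->]].
  exists (component25 (rep i)); last by rewrite component_classH.
  by rewrite calD_vertices; exists (rep i); rewrite nth_nseq rep_lt.
rewrite calD_vertices => -[j [hj _ ->]].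
have /hasP[r hr rj] := all_iota class_cover hj.
have [i ei] : exists i, rep i = r.
  have /(nthP 0%N)[l hl <-] := hr.
  by exists (Ordinal (hl : (l < 3)%N)).
exists i => //; rewrite -component_classH -calD_vertices; apply: component_joined.
rewrite calD_vertices ei; apply: (within2_joined rowsH_check adjH_component) => //.
by rewrite -ei rep_lt.
Qed.

End Graphs.

Theorem theorem1p10 (k : closedFieldType) (char_k : 5%N \in [pchar k])
    (F : {mpoly k[3]}) (F_hermitian : hermitian_sextic F) :
  [/\ connected_graph (calD F) (adjH' F),
      regular_graph (calD F) (adjH' F) 37
    & exists C : 'I_3 -> set (set (set (ppoint k))),
        [/\ injective C,
            range C = components (calD F) (adjH F)
          & forall i j : 'I_3, i != j ->
              is_Higman_Sims (C i `|` C j) (adjH' F)]].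
Proof.
have [W [c [uW c0 ->]]] := hermitian_normal_form char_k F_hermitian.
(* 2 is not a square in F_5, so [theta] generates F_25 inside [k]. *)
have [theta theta2] : exists theta : k, theta ^+ 2 = 2%:R.
  exact: root_exists.
have [conn reg] := calD_connected_regular char_k theta2 uW c0.
by split=> //; apply: (components_H char_k theta2 uW c0).
Qed.
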